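(* Let $e\in (K,G)^{eq}$. Then there exists a tuple $c\gamma$ from $(K,K/G)$ (with $c$ a tuple from $K$ and $\gamma$ a tuple from $K/G$) such that $c\gamma\in \mathrm{acl}^{eq}(e)$ and $e\in \mathrm{dcl}^{eq}(c\gamma)$. It follows that $(K,K/G)$ has weak elimination of imaginaries.
   Context: Fix a prime $p>0$. Let $\mathcal{L}_G$ be the language of rings expanded by a unary predicate $G$, and let $\mathrm{ACFG}$ be the model companion of the $\mathcal{L}_G$-theory of algebraically closed fields of characteristic $p$ in which $G$ is a predicate for an additive subgroup. Let $(K,G)$ be a saturated (monster) model of $\mathrm{ACFG}$, and let $\pi : K\rightarrow K/G$ be the canonical projection. Consider the 2-sorted structure $(K,K/G)$, with the ring structure on the sort $K$, the abelian group structure on the sort $K/G$, and the group epimorphism $\pi : K\rightarrow K/G$ (the predicate $G$ is $0$-definable in it as the kernel of $\pi$); this structure is bi-interpretable with $(K,G)$, and is viewed as a $0$-definable subset of $(K,G)^{eq}$. *)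

(* Defs.v *)
From HB Require Import structures.
From mathcomp Require Import all_boot all_algebra.
From mathcomp Require Import boolp classical_sets functions cardinality.

Set Implicit Arguments.
Unset Strict Implicit.
Unset Printing Implicit Defensive.

Import GRing.Theory.
Local Open Scope ring_scope.
Local Open Scope classical_set_scope.
Local Open Scope card_scope.

(* Sorted contexts: a context is a list of sorts, [var Gam s] is the type of
   its (de Bruijn) variables of sort [s], and [tup F Gam] is the product of the
   [F s], for [s] in [Gam]. *)

Inductive var (S : Type) : seq S -> S -> Type :=
| VZ s Gam : var (s :: Gam) s
| VS s t Gam : var Gam s -> var (t :: Gam) s.
Arguments VZ {S s Gam}.
Arguments VS {S s t Gam}.

Fixpoint var_map (S S' : Type) (h : S -> S') (Gam : seq S) (s : S)
    (v : var Gam s) : var (map h Gam) (h s) :=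
  match v with
  | VZ _ _ => VZ
  | VS _ _ _ w => VS (var_map h w)
  end.

Definition tup (S : Type) (F : S -> Type) (Gam : seq S) : Type :=
  forall s, var Gam s -> F s.

Section Tuples.
Variables (S : Type) (F : S -> Type).

Definition tnil : tup F [::] := fun s v =>
  match v in var Gam s' return (if Gam is [::] then F s' else unit) with
  | VZ _ _ => tt
  | VS _ _ _ _ => tt
  end.

Definition tcons (t : S) (Gam : seq S) (x : F t) (a : tup F Gam) :
    tup F (t :: Gam) := fun s v =>
  match v in var Del s'
    return (if Del is t' :: Gam' then F t' -> tup F Gam' -> F s' else unit)
  with
  | VZ _ _ => fun x _ => x
  | VS _ _ _ w => fun _ a => a _ w
  end x a.

Definition ttail (t : S) (Gam : seq S) (a : tup F (t :: Gam)) : tup F Gam :=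
  fun s v => a s (VS v).

Fixpoint tcat (Gam Del : seq S) : tup F Gam -> tup F Del -> tup F (Gam ++ Del) :=
  match Gam with
  | [::] => fun _ b => b
  | t :: Gam' => fun a b => tcons (a t VZ) (tcat (ttail a) b)
  end.

End Tuples.

Arguments tnil {S F}.

Record language := Language {
  sort : Type;
  fsym : Type;
  fdom : fsym -> seq sort;
  fcod : fsym -> sort;
  rsym : Type;
  rdom : rsym -> seq sort }.

Inductive term (L : language) (Gam : seq (sort L)) : sort L -> Type :=
| Var s : var Gam s -> term Gam s
| App (f : fsym L) : (forall s, var (fdom f) s -> term Gam s) ->
    term Gam (fcod f).

(* The other connectives and the existential quantifier are the usual classical
   abbreviations; the last variable bound by [FAll] is [VZ]. *)
Inductive formula (L : language) : seq (sort L) -> Type :=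
| FBot Gam : formula Gam
| FEq Gam s : term Gam s -> term Gam s -> formula Gam
| FRel Gam (r : rsym L) : tup (@term L Gam) (rdom r) -> formula Gam
| FImp Gam : formula Gam -> formula Gam -> formula Gam
| FAll Gam s : formula (s :: Gam) -> formula Gam.

Record structure (L : language) := Structure {
  carrier :> sort L -> Type;
  fint : forall f : fsym L, tup carrier (fdom f) -> carrier (fcod f);
  rint : forall r : rsym L, tup carrier (rdom r) -> Prop }.

Fixpoint eval (L : language) (M : structure L) (Gam : seq (sort L))
    (a : tup M Gam) (s : sort L) (t : term Gam s) : M s :=
  match t with
  | Var _ v => a _ v
  | App f ts => fint (fun s v => eval a (ts s v))
  end.

Fixpoint sat (L : language) (M : structure L) (Gam : seq (sort L))
    (phi : formula Gam) : tup M Gam -> Prop :=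
  match phi with
  | FBot _ => fun _ => False
  | FEq _ _ t u => fun a => eval a t = eval a u
  | FRel _ r ts => fun a => @rint L M r (fun s v => eval a (ts s v))
  | FImp _ phi1 phi2 => fun a => sat phi1 a -> sat phi2 a
  | FAll _ s phi1 => fun a => forall x : M s, sat phi1 (tcons x a)
  end.

Definition theory (L : language) := set (@formula L [::]).

Definition models (L : language) (T : theory L) (M : structure L) : Prop :=
  forall phi, T phi -> sat phi (@tnil _ M).

Definition tmap (S : Type) (F F' : S -> Type) (h : forall s, F s -> F' s)
    (Gam : seq S) (a : tup F Gam) : tup F' Gam := fun s v => h s (a s v).

Definition embedding (L : language) (M N : structure L)
    (h : forall s, M s -> N s) : Prop :=
  [/\ forall s, injective (h s),
      forall (f : fsym L) (a : tup M (fdom f)), h _ (fint a) = fint (tmap h a)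
    & forall (r : rsym L) (a : tup M (rdom r)), rint a <-> rint (tmap h a)].

Definition elementary (L : language) (M N : structure L)
    (h : forall s, M s -> N s) : Prop :=
  forall (Gam : seq (sort L)) (phi : formula Gam) (a : tup M Gam),
    sat phi a <-> sat phi (tmap h a).

Definition model_complete (L : language) (T : theory L) : Prop :=
  forall (M N : structure L) (h : forall s, M s -> N s),
    models T M -> models T N -> embedding h -> elementary h.

Definition embeds_in_models (L : language) (T T' : theory L) : Prop :=
  forall M : structure L, models T M ->
    exists (N : structure L) (h : forall s, M s -> N s),
      models T' N /\ embedding h.

Definition model_companion (L : language) (T T' : theory L) : Prop :=
  [/\ embeds_in_models T T', embeds_in_models T' T & model_complete T'].

Definition elem (L : language) (M : structure L) : Type := {s : sort L & M s}.

Definition el (L : language) (M : structure L) (s : sort L) (x : M s) : elem M :=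
  existT _ s x.

Definition entries (L : language) (M : structure L) (Gam : seq (sort L))
    (a : tup M Gam) : set (elem M) :=
  [set b | exists s (v : var Gam s), b = el (a s v)].

Definition acl (L : language) (M : structure L) (A : set (elem M)) :
    set (elem M) :=
  [set b | exists (Gam : seq (sort L)) (a : tup M Gam)
             (phi : formula (projT1 b :: Gam)),
     [/\ entries a `<=` A,
         sat phi (tcons (projT2 b) a)
       & finite_set [set x | sat phi (tcons x a)]]].

Definition dcl (L : language) (M : structure L) (A : set (elem M)) :
    set (elem M) :=
  [set b | exists (Gam : seq (sort L)) (a : tup M Gam)
             (phi : formula (projT1 b :: Gam)),
     entries a `<=` A /\
     [set x | sat phi (tcons x a)] = [set projT2 b]].

(* Formulas in one free variable, of sort [s], with parameters from M. *)
Record pformula (L : language) (M : structure L) (s : sort L) := PFormula {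
  pctx : seq (sort L);
  pfml : formula (s :: pctx);
  ppar : tup M pctx }.

Definition psat (L : language) (M : structure L) (s : sort L)
    (phi : pformula M s) (x : M s) : Prop :=
  sat (pfml phi) (tcons x (@ppar _ _ _ phi)).

Definition realizes_types_over (L : language) (M : structure L)
    (A : set (elem M)) : Prop :=
  forall (s : sort L) (Sigma : set (pformula M s)),
    (forall phi, Sigma phi -> entries (@ppar _ _ _ phi) `<=` A) ->
    (forall n (phi : 'I_n -> pformula M s), (forall i, Sigma (phi i)) ->
       exists x, forall i, psat (phi i) x) ->
    exists x, forall phi, Sigma phi -> psat phi x.

(* Saturation in the cardinality of M: A ranges over the sets of parameters that
   are strictly smaller than M. One-variable types suffice. *)
Definition saturated (L : language) (M : structure L) : Prop :=
  forall A : set (elem M), ~~ ([set: elem M] #<= A) -> realizes_types_over A.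

(* M^eq: besides the sorts of M, a sort for every 0-definable equivalence
   relation on a finite product of sorts of M, together with the projection onto
   it; its elements are the equivalence classes, as subsets of that product. *)

Record defequiv (L : language) (M : structure L) := DefEquiv {
  dctx : seq (sort L);
  dfml : formula (dctx ++ dctx);
  drefl : forall a : tup M dctx, sat dfml (tcat a a);
  dsym : forall a b : tup M dctx,
    sat dfml (tcat a b) -> sat dfml (tcat b a);
  dtrans : forall a b c : tup M dctx,
    sat dfml (tcat a b) -> sat dfml (tcat b c) -> sat dfml (tcat a c) }.

Section Eq.
Variables (L : language) (M : structure L).

Definition eqclass (E : defequiv M) (a : tup M (dctx E)) :
    set (tup M (dctx E)) := [set b | sat (dfml E) (tcat a b)].

Inductive eq_sort := Home of sort L | Imag of defequiv M.
Inductive eq_fsym := EqFun of fsym L | EqProj of defequiv M.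

Definition eq_fdom (f : eq_fsym) : seq eq_sort :=
  match f with
  | EqFun f => map Home (fdom f)
  | EqProj E => map Home (dctx E)
  end.

Definition eq_fcod (f : eq_fsym) : eq_sort :=
  match f with EqFun f => Home (fcod f) | EqProj E => Imag E end.

Definition eq_language : language :=
  @Language eq_sort eq_fsym eq_fdom eq_fcod (rsym L)
    (fun r => map Home (rdom r)).

Definition eq_carrier (s : eq_sort) : Type :=
  match s with
  | Home s => M s
  | Imag E => {C : set (tup M (dctx E)) | exists a, C = eqclass a}
  end.

Definition eq_proj (E : defequiv M) (a : tup M (dctx E)) : eq_carrier (Imag E) :=
  exist _ (eqclass a) (ex_intro _ a erefl).

Definition unhome (Gam : seq (sort L)) (a : tup eq_carrier (map Home Gam)) :
    tup M Gam := fun s v => a (Home s) (var_map Home v).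

Definition eq_fint (f : eq_fsym) :
    tup eq_carrier (eq_fdom f) -> eq_carrier (eq_fcod f) :=
  match f with
  | EqFun f => fun a => fint (unhome a)
  | EqProj E => fun a => eq_proj (unhome a)
  end.

Definition eq_structure : structure eq_language :=
  @Structure eq_language eq_carrier eq_fint
    (fun r a => @rint L M r (unhome a)).

End Eq.

Definition weak_elimination_of_imaginaries (L : language) (M : structure L) :
    Prop :=
  forall e : elem (eq_structure M),
    exists (Gam : seq (sort L)) (c : tup M Gam),
      let C : set (elem (eq_structure M)) :=
        [set x | exists s (v : var Gam s),
                   x = @el _ (eq_structure M) (Home M s) (c s v)] in
      C `<=` acl [set e] /\ dcl C e.

Inductive ring_fsym := Zero | One | Opp | Add | Mul.

Definition ring_arity (f : ring_fsym) : nat :=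
  match f with Zero | One => 0 | Opp => 1 | Add | Mul => 2 end.

Definition LG : language :=
  @Language unit ring_fsym (fun f => nseq (ring_arity f) tt) (fun=> tt)
    unit (fun=> [:: tt]).

Section FieldWithSubgroup.
Variables (K : fieldType) (G : zmodClosed K).

Definition KG_fint (f : ring_fsym) :
    tup (fun _ : unit => K : Type) (nseq (ring_arity f) tt) -> K :=
  match f with
  | Zero => fun _ => 0
  | One => fun _ => 1
  | Opp => fun a => - a tt VZ
  | Add => fun a => a tt VZ + a tt (VS VZ)
  | Mul => fun a => a tt VZ * a tt (VS VZ)
  end.

Definition KG : structure LG :=
  @Structure LG (fun _ => K) KG_fint (fun _ a => a tt VZ \in G).

End FieldWithSubgroup.

(* The set of all sentences that are true in every algebraically closed field of
   characteristic p with a distinguished additive subgroup. *)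
Definition ACF_subgroup_theory (p : nat) : theory LG :=
  [set phi | forall (K : closedFieldType) (G : zmodClosed K),
     p \in [pchar K] -> sat phi (@tnil _ (KG G))].

Inductive sort2 := SK | SQ.

Inductive fsym2 := RingOp of ring_fsym | QZero | QOpp | QAdd | Pi.

Definition fdom2 (f : fsym2) : seq sort2 :=
  match f with
  | RingOp f => nseq (ring_arity f) SK
  | QZero => [::]
  | QOpp => [:: SQ]
  | QAdd => [:: SQ; SQ]
  | Pi => [:: SK]
  end.

Definition fcod2 (f : fsym2) : sort2 := if f is RingOp _ then SK else SQ.

Definition L2 : language :=
  @Language sort2 fsym2 fdom2 fcod2 void (fun r => match r with end).

Section TwoSorted.
Variables (K : fieldType) (G : zmodClosed K).

Definition carrier2 (s : sort2) : Type :=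
  match s with SK => K | SQ => Quotient.quot G end.

Definition ring_fint2 (f : ring_fsym) :
    tup carrier2 (nseq (ring_arity f) SK) -> K :=
  match f with
  | Zero => fun _ => 0
  | One => fun _ => 1
  | Opp => fun a => - (a SK VZ : K)
  | Add => fun a => (a SK VZ : K) + a SK (VS VZ)
  | Mul => fun a => (a SK VZ : K) * a SK (VS VZ)
  end.

Definition fint2 (f : fsym2) : tup carrier2 (fdom2 f) -> carrier2 (fcod2 f) :=
  match f with
  | RingOp f => fun a => ring_fint2 a
  | QZero => fun _ => (0 : Quotient.quot G)
  | QOpp => fun a => - (a SQ VZ : Quotient.quot G)
  | QAdd => fun a => (a SQ VZ : Quotient.quot G) + a SQ (VS VZ)
  | Pi => fun a => (\pi_(Quotient.quot G) (a SK VZ : K))%qT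
  end.

Definition KQ : structure L2 :=
  @Structure L2 carrier2 fint2 (fun r => match r with end).

End TwoSorted.

(* (K, K/G) inside (K, G)^eq: K is the home sort, and the coset of x is sent to
   the class of x modulo the 0-definable relation x - y \in G. *)

Section Cosets.
Variables (K : fieldType) (G : zmodClosed K).

Definition coset_formula : @formula LG [:: tt; tt] :=
  @FRel LG [:: tt; tt] tt
    (tcons (@App LG [:: tt; tt] Add
      (tcons (Var VZ : @term LG [:: tt; tt] tt)
        (tcons (@App LG [:: tt; tt] Opp
          (tcons (Var (VS VZ) : @term LG [:: tt; tt] tt) tnil)) tnil))) tnil).

Let coset_formulaE (a b : tup (KG G) [:: tt]) :
  sat coset_formula (tcat a b) = (a tt VZ - b tt VZ \in G :> Prop).
Proof. by []. Qed.

Fact coset_refl (a : tup (KG G) [:: tt]) : sat coset_formula (tcat a a).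
Proof. by rewrite coset_formulaE subrr rpred0. Qed.

Fact coset_sym (a b : tup (KG G) [:: tt]) :
  sat coset_formula (tcat a b) -> sat coset_formula (tcat b a).
Proof. by rewrite !coset_formulaE -opprB rpredN. Qed.

Fact coset_trans (a b c : tup (KG G) [:: tt]) :
  sat coset_formula (tcat a b) -> sat coset_formula (tcat b c) ->
  sat coset_formula (tcat a c).
Proof.
rewrite !coset_formulaE => ab bc.
by have := rpredD ab bc; rewrite addrA subrK.
Qed.

Definition coset_equiv : defequiv (KG G) :=
  @DefEquiv LG (KG G) [:: tt] coset_formula coset_refl coset_sym coset_trans.

Definition home_elem (x : K) : elem (eq_structure (KG G)) :=
  @el _ (eq_structure (KG G)) (Home _ (tt : sort LG)) x.

Definition coset_elem (q : Quotient.quot G) : elem (eq_structure (KG G)) :=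
  @el _ (eq_structure (KG G)) (Imag coset_equiv)
    (@eq_proj _ (KG G) coset_equiv
      (tcons (repr q : KG G tt) (@tnil _ (KG G)))).

End Cosets.

(* Main.v *)
(** Let [e] be the class of a finite tuple [a] of [K] under a 0-definable
    equivalence relation [E], and let [C], [Gamma] be the elements of [K] and the
    classes of [K/G] that are algebraic over [e].  Suppose that [e] is not definable
    over [C] and [Gamma].  A finiteness argument for hitting sets gives, in an
    elementary extension, some [a1] equivalent to [a] such that every element
    (resp. coset) of [K] that is field-algebraic over [a1] lies in [C] (resp. in
    [Gamma]); and compactness gives an elementary embedding [tau] fixing [C] and
    [Gamma] with [tau a] not equivalent to [a].  Choose [b] equivalent to [a] with
    as few relations as possible over the model [K2] reached so far.  Compared with
    its copies in free amalgams, [b] is linearly disjoint from [K2] over the field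
    closures of [a] and of [a1], hence over their intersection, which lies in [C].
    Two copies of [K2] can be amalgamated over [C], twisted by [tau] on [Gamma],
    and [b] can then be realized independently over both: its images make [tau a]
    equivalent to [a], a contradiction.  That isomorphic algebraically closed
    subfields with the same trace of [G] have the same type follows from model
    completeness and the free amalgam. *)

From HB Require Import structures.
From mathcomp Require Import all_boot all_algebra closed_field.
From mathcomp Require Import boolp classical_sets functions cardinality filter.
From mathcomp Require Import finmap ring.
From Stdlib Require List.
Require Import Defs.

Set Implicit Arguments.
Unset Strict Implicit.
Unset Printing Implicit Defensive.

Import GRing.Theory.
Local Open Scope ring_scope.
Local Open Scope classical_set_scope.

(** * Fields and ultrapowers *)

(** A second copy of the model serves as a neutral reference. It meets the first one only in [C], so
    [b] can be realized over [a] in the first copy and [a] in the second, and again over [tau a] in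
    the first copy and [a] in the second; the reference is then equivalent to both. The subgroup is
    the other obstacle. In an amalgam it is generated by the subgroups of the pieces, and it must
    not grow on any of them. Trouble comes from a congruence between an element of the closure of
    [a] and an element algebraic over [C] and [b]. This is why the relations of [b] to be minimized
    include congruences, and why the twist is needed. Amalgams are not built from tensor products:
    they are ultrapowers indexed by maps that are retractions on finite sets, which the
    Nullstellensatz provides. Linear and additive relations in the amalgam can then be tested on one
    or two such maps. *)

Lemma build_zmodClosed (V : zmodType) (P : V -> Prop) :
  P 0 -> (forall x y, P x -> P y -> P (x - y)) ->
  exists G : zmodClosed V, forall x, x \in G <-> P x.
Proof.
move=> P0 PB; pose S : {pred V} := [pred x | `[<P x>]].
have clS : zmod_closed S.
  split=> [|x y]; rewrite !inE; first exact/asboolP.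
  by move=> /asboolP Px /asboolP Py; apply/asboolP/PB.
pose G : zmodClosed V := HB.pack S (GRing.isZmodClosed.Build V S clS).
by exists G => x; split => [/asboolP|Px] //; apply/asboolP.
Qed.

Lemma build_subringClosed (V : nzRingType) (P : V -> Prop) :
  P 1 -> (forall x y, P x -> P y -> P (x - y)) ->
  (forall x y, P x -> P y -> P (x * y)) ->
  exists G : subringClosed V, forall x, x \in G <-> P x.
Proof.
move=> P1 PB PM; pose S : {pred V} := [pred x | `[<P x>]].
have clS : subring_closed S.
  split=> [|x y|x y]; rewrite !inE; first exact/asboolP.
    by move=> /asboolP Px /asboolP Py; apply/asboolP/PB.
  by move=> /asboolP Px /asboolP Py; apply/asboolP/PM.
pose G : subringClosed V := HB.pack S (GRing.isSubringClosed.Build V S clS).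
by exists G => x; split => [/asboolP|Px] //; apply/asboolP.
Qed.

Lemma build_rmorphism (R S : nzRingType) (f : R -> S) :
  f 1 = 1 -> (forall x y, f (x - y) = f x - f y) ->
  (forall x y, f (x * y) = f x * f y) ->
  exists h : {rmorphism R -> S}, forall x, h x = f x.
Proof.
move=> f1 fB fM.
pose H : {rmorphism R -> S} := HB.pack f (GRing.isZmodMorphism.Build _ _ f fB)
  (GRing.isMonoidMorphism.Build _ _ f (f1, fM)).
by exists H.
Qed.

(** Inverses are only asserted to exist; [build_field] turns this into a function by choice, with
    value 0 at 0 as the field structure demands. *)
Record field_laws (T : Type) (zero one : T) (opp : T -> T) (add mul : T -> T -> T)
    : Prop := FieldLaws {
  fl_addA : associative add;
  fl_addC : commutative add;
  fl_add0 : left_id zero add;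
  fl_addN : left_inverse zero opp add;
  fl_mulA : associative mul;
  fl_mulC : commutative mul;
  fl_mul1 : left_id one mul;
  fl_mulD : left_distributive mul add;
  fl_10 : one <> zero;
  fl_inv : forall x, x <> zero -> exists y, mul y x = one }.

Lemma build_field (T : Type) zero one opp add mul :
  @field_laws T zero one opp add mul ->
  exists (K : fieldType) (f : T -> K),
    [/\ bijective f, f zero = 0, f one = 1 &
     [/\ forall x, f (opp x) = - f x,
         forall x y, f (add x y) = f x + f y &
         forall x y, f (mul x y) = f x * f y]].
Proof.
case=> addA addC add0 addN mulA mulC mul1 mulD one0 inv_ex.
pose C : choiceType := HB.pack T (gen_eqMixin T) (gen_choiceMixin T).
pose Z : zmodType := HB.pack T C (@GRing.isZmodule.Build C _ _ _ addA addC add0 addN).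
have one_neq0 : one != zero :> Z by apply/eqP.
pose R : comNzRingType := HB.pack T Z
  (GRing.Zmodule_isComNzRing.Build Z mulA mulC mul1 mulD one_neq0).
have inv_ex' (x : R) : exists y : R, (x != 0 -> y * x = 1) /\ (x = 0 -> y = 0).
  have [->|x0] := pselect (x = 0); first by exists 0; split => //; rewrite eqxx.
  have [y yx] := inv_ex x x0.
  by exists y; split.
have [inv invP] := choice inv_ex'.
pose K : fieldType := HB.pack T R (GRing.ComNzRing_isField.Build R
  (fun x => (invP x).1) ((invP 0).2 erefl)).
exists K, id; split => //; by exists id.
Qed.

Lemma build_closedField (F : fieldType) : GRing.closed_field_axiom F ->
  exists (K : closedFieldType) (f : {rmorphism F -> K}), bijective f.
Proof.
case: F => T c Fcl; pose F := GRing.Field.Pack c.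
pose K := HB.pack_for closedFieldType T F (@Field_isAlgClosed.Build F Fcl).
by exists K, (idfun : {rmorphism F -> F}); exists id.
Qed.

Definition ultra (I : Type) (U : set (set I)) : Prop :=
  [/\ forall A B : set I, A `<=` B -> U A -> U B,
      forall A B, U A -> U B -> U (A `&` B),
      forall A, U A \/ U (~` A) & ~ U set0].

(** The source of every compactness argument below: requirements on a point that can be met finitely
    many at a time are all met almost everywhere for one ultrafilter, hence by a point of the
    ultrapower. *)
Lemma ultra_extension (I : Type) (F : set (set I)) :
  (forall s : seq (set I), (forall A, A \in s -> F A) ->
     exists i, forall A, A \in s -> A i) ->
  exists U, ultra U /\ F `<=` U.
Proof.
move=> Ffin.
have /finI_filter FF : finI F id.
  move=> D DF; case: (Ffin (enum_fset D)) => [A AD|i iD].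
    by apply: set_mem; apply: DF.
  by exists i => A AD; apply: iD.
have [U [UU FU]] := ultraFilterLemma FF.
have [UP _] := UU.
exists U; split.
  split.
  - by move=> A B AB UA; apply: filterS UA.
  - by move=> A B; apply: filterI.
  - by move=> A; have := @in_ultra_setVsetC _ _ A UU.
  - by apply: filter_not_empty.
move=> A FA; apply: FU; exists A => //; exists [fset A]%fset.
  by move=> B /fset1P ->; apply: mem_set.
rewrite predeqE => i; split => [|Ai B /fset1P -> //].
by apply; apply/fset1P.
Qed.

Section UltraTheory.
Variables (I : Type) (U : set (set I)).
Hypothesis UU : ultra U.

Lemma ultraS (A B : set I) : (forall i, A i -> B i) -> U A -> U B.
Proof. by case: UU => + _ _ _ => /[apply]. Qed.

Lemma ultraI (A B : set I) : U A -> U B -> U [set i | A i /\ B i].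
Proof. by case: UU => _ + _ _; apply. Qed.

Lemma ultraT (A : set I) : (forall i, A i) -> U A.
Proof.
move=> AT; case: UU => US _ UC U0; case: (UC A) => // UA.
by case: U0; apply: US UA => i; apply.
Qed.

Lemma ultra_ex (A : set I) : U A -> exists i, A i.
Proof.
case: UU => US _ _ U0 UA; apply: contrapT => nA; apply: U0.
by apply: US UA => i Ai; apply: nA; exists i.
Qed.

Lemma ultra_not (A : set I) : U [set i | ~ A i] <-> ~ U A.
Proof.
split=> [UnA UA|nUA].
  by have [i []] := ultra_ex (ultraI UnA UA).
by case: UU => _ _ /(_ A) [/nUA|].
Qed.

Lemma ultra_imp (A B : set I) : U [set i | A i -> B i] <-> (U A -> U B).
Proof.
split=> [UAB UA|UAB].
  by apply: ultraS (ultraI UAB UA) => i [].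
have [UA|/ultra_not nUA] := pselect (U A); first by apply: (ultraS _ (UAB UA)) => i Bi.
by apply: ultraS nUA => i nA /nA.
Qed.

Lemma ultra_const (P : Prop) : U [set _ | P] <-> P.
Proof.
by split=> [/ultra_ex[]|p] //; apply: ultraT.
Qed.

Definition ueq (T : Type) (g g' : I -> T) := U [set i | g i = g' i].

Lemma ueq_refl (T : Type) (g : I -> T) : ueq g g.
Proof. exact: ultraT. Qed.

Lemma ueq_sym (T : Type) (g g' : I -> T) : ueq g g' -> ueq g' g.
Proof. exact: ultraS. Qed.

Lemma ueq_trans (T : Type) (g g' g'' : I -> T) :
  ueq g g' -> ueq g' g'' -> ueq g g''.
Proof. by move=> e e'; apply: ultraS (ultraI e e') => i /= [-> ->]. Qed.

End UltraTheory.

(** The ultrapower is known only through its class map; preservation of 1, subtraction and product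
    already determines the rest of the ring structure. *)
Record ultrapower (I : Type) (U : set (set I)) (K O : closedFieldType)
    (cls : (I -> K) -> O) : Prop := Ultrapower {
  cls_surj : forall x, exists g, cls g = x;
  cls_eq : forall g g', cls g = cls g' <-> U [set i | g i = g' i];
  cls1 : cls (fun=> 1) = 1;
  clsB : forall g g', cls (fun i => g i - g' i) = cls g - cls g';
  clsM : forall g g', cls (fun i => g i * g' i) = cls g * cls g' }.

Lemma ultrapower_exists (I : Type) (U : set (set I)) (K : closedFieldType) :
  ultra U -> exists (O : closedFieldType) (cls : (I -> K) -> O), ultrapower U cls.
Proof.
move=> UU.
pose T := {C : set (I -> K) | exists g, C = [set g' | ueq U g g']}.
pose c (g : I -> K) : T := exist _ _ (ex_intro _ g erefl).
have cE g g' : c g = c g' <-> U [set i | g i = g' i].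
  split=> [/(congr1 (@proj1_sig _ _)) /= e|e].
    have : [set h | ueq U g h] g' by rewrite e; apply: ueq_refl.
    by [].
  apply: eq_exist => /=; rewrite predeqE => h; split=> /=.
    by apply: ueq_trans => //; apply: ueq_sym.
  exact: ueq_trans.
have c_surj (x : T) : exists g, c g = x.
  by case: x => C [g e]; exists g; apply: eq_exist.
have [r rK] := choice c_surj.
have rc g : U [set i | r (c g) i = g i] by apply/cE/rK.
pose add (x y : T) := c (fun i => r x i + r y i).
pose mul (x y : T) := c (fun i => r x i * r y i).
pose opp (x : T) := c (fun i => - r x i).
have addE g g' : add (c g) (c g') = c (fun i => g i + g' i).
  by apply/cE; apply: (ultraS UU) (ultraI UU (rc g) (rc g')) => i /= [-> ->].
have mulE g g' : mul (c g) (c g') = c (fun i => g i * g' i).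
  by apply/cE; apply: (ultraS UU) (ultraI UU (rc g) (rc g')) => i /= [-> ->].
have oppE g : opp (c g) = c (fun i => - g i).
  by apply/cE; apply: (ultraS UU) (rc g) => //= i ->.
have laws :
    field_laws (c (fun=> 0)) (c (fun=> 1)) opp add mul.
  split.
  - move=> x y z; rewrite -(rK x) -(rK y) -(rK z) !addE; apply/cE/(ultraT UU) => i.
    exact: addrA.
  - move=> x y; rewrite -(rK x) -(rK y) !addE; apply/cE/(ultraT UU) => i.
    exact: addrC.
  - move=> x; rewrite -(rK x) !addE; apply/cE/(ultraT UU) => i; exact: add0r.
  - move=> x; rewrite -(rK x) oppE !addE; apply/cE/(ultraT UU) => i; exact: addNr.
  - move=> x y z; rewrite -(rK x) -(rK y) -(rK z) !mulE; apply/cE/(ultraT UU) => i.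
    exact: mulrA.
  - move=> x y; rewrite -(rK x) -(rK y) !mulE; apply/cE/(ultraT UU) => i.
    exact: mulrC.
  - move=> x; rewrite -(rK x) !mulE; apply/cE/(ultraT UU) => i; exact: mul1r.
  - move=> x y z; rewrite -(rK x) -(rK y) -(rK z) !(addE, mulE).
    by apply/cE/(ultraT UU) => i; exact: mulrDl.
  - by move=> /cE/(ultra_ex UU)[i] /eqP; rewrite oner_eq0.
  (* A class other than 0 has a representative that is nonzero almost everywhere, and there the
     pointwise inverse works. *)
  - move=> x; rewrite -(rK x) => x0; exists (c (fun i => (r x i)^-1)).
    have /(ultra_not UU) nx : ~ U [set i | r x i = 0] by move=> /cE.
    by rewrite mulE; apply/cE; apply: (ultraS UU) nx => i /= /eqP ?; rewrite mulVf.
have [F [f [fbij f0 f1 [fN fD fM]]]] := build_field laws.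
pose d g := f (c g).
have dE g g' : d g = d g' <-> U [set i | g i = g' i].
  by rewrite -cE; split=> [/(bij_inj fbij)|e] //; rewrite /d e.
have d_surj (x : F) : exists g, d g = x.
  by case: fbij => f' fK f'K; have [g e] := c_surj (f' x); exists g; rewrite /d e f'K.
have dD g g' : d (fun i => g i + g' i) = d g + d g' by rewrite /d -fD addE.
have dM g g' : d (fun i => g i * g' i) = d g * d g' by rewrite /d -fM mulE.
have dN g : d (fun i => - g i) = - d g by rewrite /d -fN oppE.
have dX g n : d (fun i => g i ^+ n) = d g ^+ n.
  elim: n => [|n IHn]; first exact: f1.
  by rewrite exprS -IHn -dM; congr d; apply/funext => i; rewrite exprS.
have dsum n (g : 'I_n -> I -> K) : d (fun i => \sum_k g k i) = \sum_k d (g k).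
  elim: n g => [|n IHn] g.
    by rewrite big_ord0 -f0; congr (f (c _)); apply/funext => i; rewrite big_ord0.
  rewrite big_ord_recl -IHn -dD; congr d; apply/funext => i.
  by rewrite big_ord_recl.
(* A monic equation is solved coordinate by coordinate, and the class of the chosen roots is a
   root. *)
have Fcl : GRing.closed_field_axiom F.
  move=> n P n0; have [p pP] := choice (fun k => d_surj (P k)).
  have [x xP] := choice (fun i => solve_monicpoly (fun k => p k i) n0).
  have e : d (fun i => \sum_(k < n) p k i * x i ^+ k) = \sum_(k < n) P k * d x ^+ k.
    by rewrite dsum; apply: eq_bigr => k _; rewrite dM dX pP.
  by exists (d x); rewrite -dX -e; apply/dE/(ultraT UU).
have [O [h hbij]] := build_closedField Fcl.
exists O, (fun g => h (d g)); split.
- move=> x; case: hbij => h' hK h'K; have [g e] := d_surj (h' x).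
  by exists g; rewrite e h'K.
- by move=> g g'; rewrite -dE; split=> [/(bij_inj hbij)|->].
- by rewrite -[RHS](rmorph1 h) -f1.
- by move=> g g'; rewrite dD dN rmorphB.
- by move=> g g'; rewrite dM rmorphM.
Qed.

Section UltrapowerTheory.
Variables (I : Type) (U : set (set I)) (K O : closedFieldType).
Variables (cls : (I -> K) -> O).
Hypotheses (UU : ultra U) (UP : ultrapower U cls).

Lemma cls0 : cls (fun=> 0) = 0.
Proof.
by rewrite -[RHS](subrr (cls (fun=> 0))) -(clsB UP); congr cls; apply/funext=> i; rewrite subr0.
Qed.

Lemma clsN g : cls (fun i => - g i) = - cls g.
Proof.
by rewrite -[RHS]sub0r -cls0 -(clsB UP); congr cls; apply/funext => i; rewrite sub0r.
Qed.

Lemma clsD g g' : cls (fun i => g i + g' i) = cls g + cls g'.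
Proof.
by rewrite -[cls g']opprK -clsN -(clsB UP); congr cls; apply/funext => i; rewrite opprK.
Qed.

Lemma cls_sum n (g : 'I_n -> I -> K) :
  cls (fun i => \sum_k g k i) = \sum_k cls (g k).
Proof.
elim: n g => [|n IHn] g.
  by rewrite big_ord0 -cls0; congr cls; apply/funext => i; rewrite big_ord0.
rewrite big_ord_recl -IHn -clsD; congr cls; apply/funext => i.
by rewrite big_ord_recl.
Qed.

Lemma diag_exists : exists h : {rmorphism K -> O}, forall x, h x = cls (fun=> x).
Proof.
apply: build_rmorphism => [|x y|x y]; first exact: cls1 UP.
  by rewrite -(clsB UP).
by rewrite -(clsM UP).
Qed.

End UltrapowerTheory.

(** * Renaming and uniformly definable relations *)

Section TupleTheory.
Variables (S : Type) (F : S -> Type).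

Lemma tup_ext (Gam : seq S) (a b : tup F Gam) : (forall s v, a s v = b s v) -> a = b.
Proof.
move=> ab; apply: functional_extensionality_dep => s.
exact: functional_extensionality_dep.
Qed.

Lemma tcons_eta (t : S) (Gam : seq S) (a : tup F (t :: Gam)) :
  a = tcons (a t VZ) (ttail a).
Proof.
apply: tup_ext => s v.
refine (match v in var D s' return
    (match D return var D s' -> Prop with
     | [::] => fun _ => True
     | t' :: G' => fun v' => forall b : tup F (t' :: G'),
         b s' v' = tcons (b t' VZ) (ttail b) v' end v)
  with VZ _ _ => _ | VS _ _ _ w => _ end a) => //.
Qed.

Lemma tup_consP (t : S) (Gam : seq S) (a b : tup F (t :: Gam)) :
  a t VZ = b t VZ -> (forall s (v : var Gam s), a s (VS v) = b s (VS v)) -> a = b.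
Proof.
move=> e0 eS; rewrite (tcons_eta a) (tcons_eta b) e0; congr tcons.
apply: functional_extensionality_dep => s; apply: functional_extensionality_dep.
exact: eS.
Qed.

Lemma tup_nil (a b : tup F [::]) : a = b.
Proof.
apply: tup_ext => s v.
by refine (match v in var D s' return
    (match D return var D s' -> Prop with
     | [::] => fun v' => forall a b : tup F [::], a s' v' = b s' v'
     | _ :: _ => fun _ => True end v)
  with VZ _ _ => _ | VS _ _ _ w => _ end a b).
Qed.

Lemma var_nilP (Q : forall s, var [::] s -> Prop) (s : S) (v : var [::] s) : Q s v.
Proof.
by refine (match v in var D s' return
    (match D return var D s' -> Prop with
     | [::] => fun v' => forall Q : forall s, var [::] s -> Prop, Q s' v'
     | _ :: _ => fun _ => True end v)
  with VZ _ _ => _ | VS _ _ _ w => _ end Q).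
Qed.

Lemma var_consP (t : S) (Gam : seq S) (Q : forall s, var (t :: Gam) s -> Prop) :
  Q t VZ -> (forall s v, Q s (VS v)) -> forall s v, Q s v.
Proof.
move=> Q0 QS s v; move: Q Q0 QS.
by refine (match v in var D s' return
    (match D return var D s' -> Prop with
     | [::] => fun _ => True
     | t' :: G' => fun v' => forall Q : forall s, var (t' :: G') s -> Prop,
         Q t' VZ -> (forall s v, Q s (VS v)) -> Q s' v' end v)
  with VZ _ _ => _ | VS _ _ _ w => _ end).
Qed.

End TupleTheory.

Definition trename (S : Type) (F : S -> Type) (Gam Del : seq S)
    (r : tup (var Del) Gam) (a : tup F Del) : tup F Gam :=
  fun s v => a s (r s v).

Definition vlift (S : Type) (t : S) (Gam Del : seq S) (r : tup (var Del) Gam) :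
    tup (var (t :: Del)) (t :: Gam) := tcons VZ (fun s v => VS (r s v)).

Lemma trename_lift (S : Type) (F : S -> Type) (t : S) (Gam Del : seq S)
    (r : tup (var Del) Gam) (x : F t) (a : tup F Del) :
  trename (vlift r) (tcons x a) = tcons x (trename r a).
Proof. exact: tup_consP. Qed.

Fixpoint vinl (S : Type) (G D : seq S) : tup (var (G ++ D)) G :=
  match G with
  | [::] => tnil
  | t :: G' => tcons VZ (fun s v => VS (vinl D v))
  end.

Fixpoint vinr (S : Type) (G D : seq S) : tup (var (G ++ D)) D :=
  match G with
  | [::] => fun s v => v
  | t :: G' => fun s v => VS (@vinr _ G' D s v)
  end.

Lemma trename_inl (S : Type) (F : S -> Type) (G D : seq S) (a : tup F G) (b : tup F D) :
  trename (@vinl _ G D) (tcat a b) = a.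
Proof.
elim: G a => [|t G IHG] a; first exact: tup_nil.
apply: tup_consP => // s v.
by rewrite -[RHS]/(ttail a v) -[in RHS](IHG (ttail a)).
Qed.

Lemma trename_inr (S : Type) (F : S -> Type) (G D : seq S) (a : tup F G) (b : tup F D) :
  trename (@vinr _ G D) (tcat a b) = b.
Proof.
elim: G a => [|t G IHG] a //=.
by rewrite -[RHS](IHG (ttail a)).
Qed.

Lemma tcat_surj (S : Type) (F : S -> Type) (G D : seq S) (c : tup F (G ++ D)) :
  c = tcat (trename (@vinl _ G D) c) (trename (@vinr _ G D) c).
Proof.
elim: G c => [|t G IHG] c //=.
by rewrite {1}(tcons_eta c) {1}(IHG (ttail c)).
Qed.

Lemma tmap_tcons (S : Type) (F F' : S -> Type) (h : forall s, F s -> F' s)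
    (t : S) (G : seq S) (x : F t) (a : tup F G) :
  tmap h (tcons x a) = tcons (h t x) (tmap h a).
Proof. exact: tup_consP. Qed.

Section Renaming.
Variable L : language.

Fixpoint rn_term (Gam Del : seq (sort L)) (r : tup (var Del) Gam) (s : sort L)
    (t : term Gam s) : term Del s :=
  match t with
  | Var _ v => Var (r _ v)
  | App f ts => App (fun s v => rn_term r (ts s v))
  end.

Fixpoint rn_formula (Gam : seq (sort L)) (phi : formula Gam) :
    forall Del : seq (sort L), tup (var Del) Gam -> formula Del :=
  match phi with
  | FBot _ => fun Del _ => FBot Del
  | FEq _ _ t u => fun Del r => FEq (rn_term r t) (rn_term r u)
  | FRel _ q ts => fun Del r => @FRel L Del q (fun s v => rn_term r (ts s v))
  | FImp _ phi1 phi2 => fun Del r => FImp (rn_formula phi1 r) (rn_formula phi2 r)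
  | FAll _ s phi1 => fun Del r => FAll (rn_formula phi1 (vlift r))
  end.

Lemma eval_rn (M : structure L) (Gam Del : seq (sort L)) (r : tup (var Del) Gam)
    (a : tup M Del) (s : sort L) (t : term Gam s) :
  eval a (rn_term r t) = eval (trename r a) t.
Proof.
elim: t => [//|f ts IHt] /=; congr fint.
by apply: tup_ext => s' v.
Qed.

Lemma sat_rn (M : structure L) (Gam Del : seq (sort L)) (phi : formula Gam)
    (r : tup (var Del) Gam) (a : tup M Del) :
  sat (rn_formula phi r) a <-> sat phi (trename r a).
Proof.
elim: phi Del r a => {Gam} [Gam|Gam s t u|Gam q ts|Gam p1 IH1 p2 IH2|Gam s p1 IH1] Del r a //=.
- by rewrite !eval_rn.
- rewrite (_ : (fun s v => eval a (rn_term r (ts s v))) =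
    (fun s v => eval (trename r a) (ts s v))) //.
  apply: tup_ext => s v.
  exact: eval_rn.
- by rewrite IH1 IH2.
- by split=> H x; move: (H x); rewrite IH1 trename_lift.
Qed.

End Renaming.

(** Variables are names from an arbitrary type instead of positions in a context, so that elements
    of a model, indices and fresh symbols can all serve as names. *)
Inductive tm (V : Type) :=
| TVar (v : V) | T0 | T1 | TOpp of tm V | TAdd of tm V & tm V | TMul of tm V & tm V.

Section Raw.
Variable M : structure LG.
Definition m0 : M tt := @fint LG M Zero (@tnil _ M).
Definition m1 : M tt := @fint LG M One (@tnil _ M).
Definition mopp (x : M tt) : M tt := @fint LG M Opp (@tcons _ M tt _ x (@tnil _ M)).
Definition madd (x y : M tt) : M tt :=
  @fint LG M Add (@tcons _ M tt _ x (@tcons _ M tt _ y (@tnil _ M))).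
Definition mmul (x y : M tt) : M tt :=
  @fint LG M Mul (@tcons _ M tt _ x (@tcons _ M tt _ y (@tnil _ M))).
Definition mG (x : M tt) : Prop := @rint LG M tt (@tcons _ M tt _ x (@tnil _ M)).

Fixpoint teval (V : Type) (x : V -> M tt) (t : tm V) : M tt :=
  match t with
  | TVar v => x v
  | T0 => m0
  | T1 => m1
  | TOpp t => mopp (teval x t)
  | TAdd t u => madd (teval x t) (teval x u)
  | TMul t u => mmul (teval x t) (teval x u)
  end.

Definition asg (V : Type) (Gam : seq unit) (r : tup (fun=> V) Gam) (x : V -> M tt) :
    tup M Gam :=
  fun s => match s return var Gam s -> M s with tt => fun v => x (r tt v) end.

End Raw.

Lemma asg_trename (M : structure LG) (V : Type) (G D : seq unit)
    (r : tup (fun=> V) D) (q : tup (var D) G) (x : V -> M tt) :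
  trename q (asg r x) = asg (trename q r) x.
Proof.
by apply: functional_extensionality_dep => -[]; apply: functional_extensionality_dep.
Qed.

Lemma asg_tcat (M : structure LG) (V : Type) (G D : seq unit)
    (r : tup (fun=> V) G) (q : tup (fun=> V) D) (x : V -> M tt) :
  asg (tcat r q) x = tcat (asg r x) (asg q x).
Proof. by rewrite [LHS]tcat_surj !asg_trename trename_inl trename_inr. Qed.

Lemma asg_comp (M : structure LG) (V W : Type) (G : seq unit)
    (r : tup (fun=> V) G) (f : V -> W) (x : W -> M tt) :
  asg (fun s v => f (r s v)) x = asg r (x \o f).
Proof. by apply: functional_extensionality_dep => -[]. Qed.

Lemma tmap_asg (M N : structure LG) (V : Type) (G : seq unit)
    (r : tup (fun=> V) G) (h : forall s, M s -> N s) (x : V -> M tt) :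
  tmap h (asg r x) = asg r (h tt \o x).
Proof. by apply: functional_extensionality_dep => -[]. Qed.

Definition upd (V T : Type) (x : V -> T) (v : V) (y : T) : V -> T :=
  fun w => if pselect (w = v) then y else x w.

Lemma updE (V T : Type) (x : V -> T) (v : V) (y : T) : upd x v y v = y.
Proof. by rewrite /upd; case: pselect. Qed.

Lemma upd_neq (V T : Type) (x : V -> T) (v w : V) (y : T) :
  w <> v -> upd x v y w = x w.
Proof. by rewrite /upd; case: pselect. Qed.

Definition relation_on (V : Type) := forall M : structure LG, (V -> M tt) -> Prop.

Definition tdefinable (V : Type) (f : forall M : structure LG, (V -> M tt) -> M tt) :=
  exists (Gam : seq unit) (u : @term LG Gam tt) (r : tup (fun=> V) Gam),
    forall M x, f M x = eval (asg r x) u.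

(** One formula must work in all structures at once, without parameters; parameters come back by
    taking the elements of a model among the names. This uniformity is what allows comparison along
    embeddings and ultrapowers. *)
Definition definable (V : Type) (P : relation_on V) :=
  exists (Gam : seq unit) (phi : @formula LG Gam) (r : tup (fun=> V) Gam),
    forall M x, P M x <-> sat phi (asg r x).

Lemma tdefinable_tm (V : Type) (t : tm V) : tdefinable (fun M x => teval x t).
Proof.
have evalE (M : structure LG) (G : seq unit) (a : tup M G) (D : seq unit)
    (ts : tup (@term LG G) D) : (fun s v => eval a (ts s v)) = tmap (fun s => @eval LG M G a s) ts.
  by [].
have tmap0 (M : structure LG) (G : seq unit) (a : tup M G) :
    tmap (fun s => @eval LG M G a s) tnil = tnil by apply: tup_nil.
elim: t => [v|||t [G [u [r E]]]|t [G1 [u1 [r1 E1]]] w [G2 [u2 [r2 E2]]]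
           |t [G1 [u1 [r1 E1]]] w [G2 [u2 [r2 E2]]]] /=.
- by exists [:: tt], (Var VZ), (tcons v tnil).
- exists [::], (@App LG _ Zero tnil), tnil => M x /=.
  by congr fint; apply: tup_nil.
- exists [::], (@App LG _ One tnil), tnil => M x /=.
  by congr fint; apply: tup_nil.
- exists G, (@App LG G Opp (tcons (u : @term LG G tt) tnil)), r => M x /=.
  by rewrite evalE tmap_tcons tmap0 E.
- exists (G1 ++ G2), (@App LG _ Add
    (tcons (@rn_term LG _ _ (@vinl _ G1 G2) _ u1 : @term LG (G1 ++ G2) tt)
    (tcons (@rn_term LG _ _ (@vinr _ G1 G2) _ u2 : @term LG (G1 ++ G2) tt) tnil))), (tcat r1 r2) => M x /=.
  by rewrite evalE !tmap_tcons tmap0 !eval_rn asg_tcat trename_inl trename_inr E1 E2.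
- exists (G1 ++ G2), (@App LG _ Mul
    (tcons (@rn_term LG _ _ (@vinl _ G1 G2) _ u1 : @term LG (G1 ++ G2) tt)
    (tcons (@rn_term LG _ _ (@vinr _ G1 G2) _ u2 : @term LG (G1 ++ G2) tt) tnil))), (tcat r1 r2) => M x /=.
  by rewrite evalE !tmap_tcons tmap0 !eval_rn asg_tcat trename_inl trename_inr E1 E2.
Qed.

Section Definable.
Variable V : Type.
Implicit Types P Q : relation_on V.

Lemma definable_ext P Q : (forall M x, P M x <-> Q M x) -> definable P -> definable Q.
Proof. by move=> PQ [G [phi [r E]]]; exists G, phi, r => M x; rewrite -PQ. Qed.

Lemma definable_eq (t u : tm V) : definable (fun M x => teval x t = teval x u).
Proof.
have [G1 [u1 [r1 E1]]] := tdefinable_tm t.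
have [G2 [u2 [r2 E2]]] := tdefinable_tm u.
exists (G1 ++ G2), (FEq (@rn_term LG _ _ (@vinl _ G1 G2) _ u1) (@rn_term LG _ _ (@vinr _ G1 G2) _ u2)).
exists (tcat r1 r2) => M x /=.
by rewrite !eval_rn asg_tcat trename_inl trename_inr E1 E2.
Qed.

Lemma definable_G (t : tm V) : definable (fun M x => mG (teval x t)).
Proof.
have [G [u [r E]]] := tdefinable_tm t.
exists G, (@FRel LG G tt (tcons (u : @term LG G tt) tnil)), r => M x /=.
rewrite E /mG.
have -> // : @tcons _ M tt _ (eval (asg r x) u) (@tnil _ M) =
  (fun s v => eval (asg r x) (@tcons _ (@term LG G) tt _ u tnil s v)).
apply: tup_consP => // s v; refine (var_nilP (fun s v => _ = _) v).
Qed.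

Lemma definable_bot : definable (fun (M : structure LG) (x : V -> M tt) => False).
Proof. by exists [::], (FBot _), tnil. Qed.

Lemma definable_imp P Q : definable P -> definable Q ->
  definable (fun M x => P M x -> Q M x).
Proof.
move=> [G1 [p1 [r1 E1]]] [G2 [p2 [r2 E2]]].
exists (G1 ++ G2), (FImp (@rn_formula LG _ p1 _ (@vinl _ G1 G2)) (@rn_formula LG _ p2 _ (@vinr _ G1 G2))).
exists (tcat r1 r2) => M x /=.
by rewrite !sat_rn asg_tcat trename_inl trename_inr E1 E2.
Qed.

Lemma definable_all v P : definable P ->
  definable (fun M x => forall y, P M (upd x v y)).
Proof.
move=> [G [p [r E]]].
(* Several positions of the context may carry the name [v]; all of them are sent to the bound
   variable. *)
pose q : tup (var (tt :: G)) G := fun s =>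
  match s return var G s -> var (tt :: G) s with
  | tt => fun w => if pselect (r tt w = v) then VZ else VS w end.
exists G, (@FAll LG G tt (@rn_formula LG _ p _ q)), r => M x /=.
have e y : trename q (tcons y (asg r x)) = asg r (upd x v y).
  apply: tup_ext => -[] w.
  by rewrite /trename /= /upd; case: pselect.
by split=> H y; move: (H y); rewrite sat_rn E e.
Qed.

Lemma definable_form (G : seq unit) (p : @formula LG G) (r : tup (fun=> V) G) :
  definable (fun M x => sat p (asg r x)).
Proof. by exists G, p, r. Qed.

Lemma definable_not P : definable P -> definable (fun M x => ~ P M x).
Proof. by move=> dP; apply: definable_imp => //; apply: definable_bot. Qed.

Lemma definable_true : definable (fun (M : structure LG) (x : V -> M tt) => True).
Proof.
by exists [::], (FImp (FBot _) (FBot _)), tnil => M x; split=> // _ [].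
Qed.

Lemma definable_and P Q : definable P -> definable Q ->
  definable (fun M x => P M x /\ Q M x).
Proof.
move=> dP dQ.
apply: definable_ext (definable_not (definable_imp dP (definable_not dQ))) => M x.
split=> [H|[p q] H]; last exact: H.
by split; apply: contrapT => n; apply: H.
Qed.

Lemma definable_or P Q : definable P -> definable Q ->
  definable (fun M x => P M x \/ Q M x).
Proof.
move=> dP dQ; apply: definable_ext (definable_imp (definable_not dP) dQ) => M x.
split=> [H|[p|q] np] //.
by have [p|/H q] := pselect (P M x); [left|right].
Qed.

Lemma definable_ex v P : definable P ->
  definable (fun M x => exists y, P M (upd x v y)).
Proof.
move=> dP; apply: definable_ext (definable_not (definable_all v (definable_not dP))) => M x.
split=> [H|[y Py] /(_ y)] //.
by apply: contrapT => H'; apply: H => y Py; apply: H'; exists y.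
Qed.

Lemma definable_seq_all (T : Type) (s : seq T) (R : T -> relation_on V) :
  (forall a, definable (R a)) ->
  definable (fun M x => foldr (fun a (Q : Prop) => R a M x /\ Q) True s).
Proof.
move=> dR; elim: s => [|a s IHs] /=; first exact: definable_true.
exact: definable_and.
Qed.

Lemma definable_seq_has (T : Type) (s : seq T) (R : T -> relation_on V) :
  (forall a, definable (R a)) ->
  definable (fun M x => foldr (fun a (Q : Prop) => R a M x \/ Q) False s).
Proof.
move=> dR; elim: s => [|a s IHs] /=; first exact: definable_bot.
exact: definable_or.
Qed.

End Definable.

Lemma definable_rename (V W : Type) (f : V -> W) (P : relation_on V) :
  definable P -> definable (fun M (x : W -> M tt) => P M (x \o f)).
Proof.
move=> [G [p [r E]]]; exists G, p, (fun s v => f (r s v)) => M x.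
by rewrite asg_comp E.
Qed.

Lemma definable_ex_seq (V : Type) (s : seq V) (P : relation_on V) : definable P ->
  definable (fun M x => exists y, (forall v, ~ List.In v s -> y v = x v) /\ P M y).
Proof.
elim: s P => [|v s IHs] P dP.
  apply: definable_ext dP => M x; split=> [Px|[y [yx]]]; first by exists x.
  by congr (P M _); apply/funext => w; rewrite yx.
apply: definable_ext (definable_ex v (IHs _ dP)) => M x.
split=> [[z [y [yz Py]]]|[y [yx Py]]].
  exists y; split=> // w /= nw; rewrite yz ?upd_neq //; first by move=> e; apply: nw; left.
  by move=> ws; apply: nw; right.
exists (y v), y; split=> // w nws.
have [->|wv] := pselect (w = v); first by rewrite updE.
by rewrite upd_neq // yx //= => -[/esym|].
Qed.

Lemma definable_elementary (M N : structure LG) (h : forall s, M s -> N s) V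
    (P : relation_on V) (x : V -> M tt) :
  elementary h -> definable P -> P M x <-> P N (h tt \o x).
Proof.
by move=> hE [G [p [r E]]]; rewrite !E (hE _ p) tmap_asg.
Qed.

Fixpoint nidx (m : nat) : tup (fun _ : unit => nat) (nseq m tt) :=
  match m return tup (fun _ : unit => nat) (nseq m tt) with
  | 0 => (tnil : tup (fun _ : unit => nat) [::])
  | m'.+1 => (@tcons _ (fun _ : unit => nat) tt (nseq m' tt) 0%N
      (fun s v => (nidx v).+1) : tup _ (tt :: nseq m' tt))
  end.

Arguments nidx : clear implicits.

Fixpoint nvar (m : nat) (i : nat) : var (nseq m.+1 tt) tt :=
  match m return var (nseq m.+1 tt) tt with
  | 0 => (VZ : var [:: tt] tt)
  | m'.+1 => if i is i'.+1 then (VS (nvar m' i') : var (tt :: nseq m'.+1 tt) tt)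
             else (VZ : var (tt :: nseq m'.+1 tt) tt)
  end.

Lemma nidxK m i : (i <= m)%N -> nidx m.+1 tt (nvar m i) = i.
Proof. by elim: m i => [|m IHm] [|i] //= im; congr _.+1; apply: IHm. Qed.

Lemma asg_nidx_surj (M : structure LG) m (a : tup M (nseq m tt)) (y : M tt) :
  exists x, a = asg (nidx m) x.
Proof.
elim: m a => [|m IHm] a; first by exists (fun=> y); apply: tup_nil.
have [x e] := IHm (ttail a).
exists (fun i => if i is i'.+1 then x i' else a tt VZ).
apply: tup_consP => //= s v; rewrite -[LHS]/(ttail a v) e.
by case: s v.
Qed.

(** Only finitely many names matter, so the relation becomes a formula in an initial context, which
    can then be closed to a sentence. *)
Lemma definable_nat (P : relation_on nat) : definable P ->
  exists m, forall k, (m <= k)%N -> exists phi : @formula LG (nseq k.+1 tt),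
    forall M x, P M x <-> sat phi (asg (nidx k.+1) x).
Proof.
move=> [G [p [r E]]].
have [m mP] : exists m, forall s v, (r s v <= m)%N.
  elim: G r {p E} => [|t G IHG] r; first by exists 0%N; apply: var_nilP.
  have [m mP] := IHG (ttail r); exists (maxn (r t VZ) m).
  apply: var_consP => [|s v]; first exact: leq_maxl.
  by rewrite (leq_trans (mP s v)) ?leq_maxr.
exists m => k mk.
pose q : tup (var (nseq k.+1 tt)) G := fun s =>
  match s return var G s -> var (nseq k.+1 tt) s with
  | tt => fun v => nvar k (r tt v) end.
exists (@rn_formula LG _ p _ q) => M x; rewrite E sat_rn asg_trename.
rewrite (_ : trename q (nidx k.+1) = r) //.
apply: tup_ext => -[] v.
by rewrite /trename nidxK // (leq_trans (mP _ _)).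
Qed.

Fixpoint closure (G : seq unit) : @formula LG G -> @formula LG [::] :=
  match G with
  | [::] => id
  | t :: G' => fun phi => closure (@FAll LG G' t phi)
  end.

Lemma sat_closure (M : structure LG) G (phi : @formula LG G) :
  sat (closure phi) (@tnil _ M) <-> forall a : tup M G, sat phi a.
Proof.
elim: G phi => [|t G IHG] phi /=.
  by split=> [H a|]; [rewrite (tup_nil a tnil)|apply].
rewrite IHG /=; split=> [H a|H a x]; last exact: H.
by rewrite (tcons_eta a).
Qed.

(** An abstract model of the theory is not known to be a field with a subgroup; a universal fact
    reaches it through its closure, which is one of the sentences collected in the theory. *)
Lemma models_definable (p : nat) (M : structure LG) (P : relation_on nat) :
  definable P -> models (ACF_subgroup_theory p) M ->
  (forall (K : closedFieldType) (G : zmodClosed K), p \in [pchar K] ->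
     forall x : nat -> K, P (KG G) x) ->
  forall x, P M x.
Proof.
move=> /definable_nat[m /(_ m (leqnn m))[phi E]] MT PT x.
have /MT/sat_closure H : ACF_subgroup_theory p (closure phi).
  move=> K G pK; apply/sat_closure => a.
  by have [y ->] := asg_nidx_surj a (0 : K); apply/E/PT.
exact/E/H.
Qed.

(** * Fields with a subgroup *)

Section RingTerms.
Variables (V : Type) (R : pzRingType).

Fixpoint tev (x : V -> R) (t : tm V) : R :=
  match t with
  | TVar v => x v
  | T0 => 0
  | T1 => 1
  | TOpp t => - tev x t
  | TAdd t u => tev x t + tev x u
  | TMul t u => tev x t * tev x u
  end.

Definition tpow (t : tm V) n := iter n (TMul t) (T1 V).
Definition tsum (F : nat -> tm V) n := foldr (fun k s => TAdd (F k) s) (T0 V) (iota 0 n).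

Lemma tev_pow x t n : tev x (tpow t n) = tev x t ^+ n.
Proof. by elim: n => [|n IHn] //; rewrite exprS -IHn. Qed.

Lemma tev_sum x F n : tev x (tsum F n) = \sum_(k < n) tev x (F k).
Proof.
rewrite -(big_mkord xpredT (fun k => tev x (F k))) /index_iota subn0 /tsum.
by elim: (iota 0 n) => [|k s IHs] /=; rewrite ?big_nil // big_cons IHs.
Qed.

End RingTerms.

Lemma tevalKG (K : fieldType) (G : zmodClosed K) V (x : V -> K) (t : tm V) :
  @teval (KG G) V x t = tev x t.
Proof.
elim: t => [//|//|//|t IHt|t IHt u IHu|t IHt u IHu] /=.
- by rewrite -IHt.
- by rewrite -IHt -IHu.
- by rewrite -IHt -IHu.
Qed.

Section Embedding.
Variables (M N : structure LG) (h : forall s, M s -> N s).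
Hypothesis hE : embedding (@h).

Lemma emb_inj : injective (@h tt). Proof. by case: hE. Qed.

Lemma emb_teval V (x : V -> M tt) (t : tm V) : @h tt (teval x t) = teval (@h tt \o x) t.
Proof.
case: hE => _ hf _.
have t0 : tmap (@h) (@tnil _ M) = @tnil _ N by exact: tup_nil.
elim: t => [//|||t IHt|t IHt u IHu|t IHt u IHu] /=.
- by rewrite [LHS](hf Zero) t0.
- by rewrite [LHS](hf One) t0.
- by rewrite [LHS](hf Opp) tmap_tcons t0 -IHt.
- by rewrite [LHS](hf Add) !tmap_tcons t0 -IHt -IHu.
- by rewrite [LHS](hf Mul) !tmap_tcons t0 -IHt -IHu.
Qed.

Lemma emb_G (x : M tt) : mG x <-> mG (@h tt x).
Proof.
case: hE => _ _ hr; rewrite /mG (hr tt) tmap_tcons.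
by rewrite (_ : tmap (@h) (@tnil _ M) = @tnil _ N) //; apply: tup_nil.
Qed.

End Embedding.

Lemma emb_comp (M N O : structure LG) (h : forall s, M s -> N s) (g : forall s, N s -> O s) :
  embedding h -> embedding g -> embedding (fun s => g s \o h s).
Proof.
case=> [hi hf hr] [gi gf gr]; split.
- by move=> s x y /= /gi /hi.
- by move=> f a /=; rewrite hf gf.
- by move=> r a; rewrite hr gr.
Qed.

Lemma iso_elementary (M N : structure LG) (h : forall s, M s -> N s) :
  embedding h -> (forall s y, exists x, h s x = y) -> elementary h.
Proof.
move=> [hi hf hr] hs.
have hev G (a : tup M G) s (t : term G s) : h s (eval a t) = eval (tmap h a) t.
  elim: t => [//|f ts IHt] /=; rewrite hf; congr fint.
  by apply: tup_ext => s' v; apply: IHt.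
move=> G p; elim: p => {G} [G|G s t u|G q ts|G p1 IH1 p2 IH2|G s p1 IH1] a //=.
- by rewrite -!hev; split=> [->|/hi].
- rewrite hr (_ : tmap h (fun s v => eval a (ts s v)) = (fun s v => eval (tmap h a) (ts s v))) //.
  apply: tup_ext => s v.
  exact: hev.
- by rewrite IH1 IH2.
- split=> H x; last by rewrite IH1 tmap_tcons.
  by have [y <-] := hs s x; rewrite -tmap_tcons -IH1.
Qed.

Lemma elementary_models (M N : structure LG) (h : forall s, M s -> N s) (T : theory LG) :
  elementary h -> models T M <-> models T N.
Proof.
move=> hE; have e : tmap h (@tnil _ M) = @tnil _ N by exact: tup_nil.
by split=> H phi /H; rewrite (hE _ phi) e.
Qed.

Record gfield := Gfield { gcar :> closedFieldType; gsub : zmodClosed gcar }.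
Definition str (M : gfield) : structure LG := KG (gsub M).

Definition gemb (M N : gfield) (h : M -> N) := forall x, h x \in gsub N <-> x \in gsub M.

(** Elementarity with arbitrary types of names, so that a relation may be tested on the family of
    all elements of [M] together with extra variables. *)
Definition elem_map (M N : gfield) (h : M -> N) := forall V (P : relation_on V) x,
  definable P -> P (str M) x <-> P (str N) (h \o x).

Lemma gemb_comp (M N O : gfield) (h : M -> N) (g : N -> O) :
  gemb h -> gemb g -> gemb (g \o h).
Proof. by move=> hE gE x /=; rewrite gE hE. Qed.

Lemma gemb_embedding (M N : gfield) (h : {rmorphism M -> N}) :
  gemb h -> @embedding LG (str M) (str N) (fun _ => h).
Proof.
move=> hG; split.
- by move=> s; apply: fmorph_inj.
- case=> a /=; rewrite /= ?rmorph0 ?rmorph1 ?rmorphN ?rmorphD ?rmorphM //.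
- by move=> r a /=; rewrite hG.
Qed.

Lemma elem_map_rmorphism (M N : gfield) (h : M -> N) : elem_map h ->
  exists g : {rmorphism M -> N}, g =1 h /\ gemb g.
Proof.
move=> hE.
have hev (t u : tm nat) x : tev x t = tev x u -> tev (h \o x) t = tev (h \o x) u.
  have := hE _ _ x (definable_eq t u).
  by rewrite !tevalKG => -[].
pose x3 (x y z : M) := nth x [:: x; y; z].
have h1 : h 1 = 1 by apply: (hev (TVar 0%N) (T1 _) (fun=> 1)).
have hB x y : h (x - y) = h x - h y.
  exact: (hev (TVar 2) (TAdd (TVar 0%N) (TOpp (TVar 1%N))) (x3 x y (x - y))).
have hM x y : h (x * y) = h x * h y.
  exact: (hev (TVar 2) (TMul (TVar 0%N) (TVar 1%N)) (x3 x y (x * y))).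
have [g gE] := build_rmorphism h1 hB hM.
exists g; split=> // x; rewrite gE.
by have := hE _ _ (fun=> x) (definable_G (TVar 0%N)) => /= <-.
Qed.

Section Los.
Variables (I : Type) (U : set (set I)) (M : gfield) (O : closedFieldType).
Variables (cls : (I -> M) -> O).
Hypotheses (UU : ultra U) (UP : ultrapower U cls).

Lemma ultraproduct_subgroup : exists H : zmodClosed O,
  forall g, cls g \in H <-> U [set i | g i \in gsub M].
Proof.
have [H HP] : exists H : zmodClosed O, forall x, x \in H <->
    exists g, x = cls g /\ U [set i | g i \in gsub M].
  apply: build_zmodClosed.
    exists (fun=> 0); rewrite (cls0 UP); split=> //.
    by apply: (ultraT UU) => i /=; rewrite rpred0.
  move=> _ _ [g [-> Ug]] [g' [-> Ug']]; exists (fun i => g i - g' i).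
  rewrite (clsB UP); split=> //.
  by apply: (ultraS UU) (ultraI UU Ug Ug') => i /= [gi g'i]; rewrite rpredB.
exists H => g; rewrite HP; split=> [[g' [/(cls_eq UP) gg' Ug']]|]; last by exists g.
by apply: (ultraS UU) (ultraI UU gg' Ug') => i /= [->].
Qed.

Variable H : zmodClosed O.
Hypothesis HP : forall g, cls g \in H <-> U [set i | g i \in gsub M].

Lemma Los (Gam : seq unit) (phi : @formula LG Gam) (a : I -> tup (str M) Gam) :
  sat phi ((fun s v => cls (fun i => a i s v)) : tup (KG H) Gam) <->
  U [set i | sat phi (a i)].
Proof.
have evE (G : seq unit) (b : I -> tup (str M) G) s (t : @term LG G s) :
    eval ((fun s v => cls (fun i => b i s v)) : tup (KG H) G) t =
    cls (fun i => eval (b i) t).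
  elim: t => [//|[] ts IHt] /=.
  - by rewrite (cls0 UP).
  - by rewrite (cls1 UP).
  - by rewrite IHt -(clsN UP).
  - by rewrite !IHt -(clsD UP).
  - by rewrite !IHt -(clsM UP).
elim: phi a => {Gam} [G|G s t u|G q ts|G p1 IH1 p2 IH2|G s p1 IH1] a /=.
- by split=> // /(ultra_ex UU)[].
- by rewrite !evE (cls_eq UP).
- by rewrite evE HP.
- by rewrite IH1 IH2 (ultra_imp UU).
have consE (g : I -> M) : @tcons _ (KG H) s G (cls g) (fun s v => cls (fun i => a i s v)) =
    (fun s' v => cls (fun i => @tcons _ (str M) s G (g i) (a i) s' v)).
  exact: tup_consP.
split=> [Hx|Ux x].
  (* A counterexample is chosen in every coordinate that has one; the class of these choices is the
     instance at which the hypothesis is used. *)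
  have wit i : exists x, (exists y, ~ sat p1 (@tcons _ (str M) s G y (a i))) ->
      ~ sat p1 (@tcons _ (str M) s G x (a i)).
    by have [[y ny]|?] := pselect (exists y, ~ sat p1 (@tcons _ (str M) s G y (a i)));
      [exists y|exists 0].
  have [g gP] := choice wit.
  have := Hx (cls g); rewrite consE IH1.
  apply: (ultraS UU) => i Hi y; apply: contrapT => ny.
  by apply: gP Hi; exists y.
have [g <-] := cls_surj UP x; rewrite consE IH1.
by apply: (ultraS UU) Ux => i; apply.
Qed.

Lemma Los_definable V (P : relation_on V) (x : V -> I -> M) : definable P ->
  P (KG H) (fun v => cls (x v)) <-> U [set i | P (str M) (fun v => x v i)].
Proof.
move=> [G [p [r E]]]; rewrite E.
have -> : asg r (fun v => cls (x v) : KG H tt) =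
    (fun s v => cls (fun i => @asg (str M) V G r (fun v => x v i) s v)).
  by apply: functional_extensionality_dep => -[].
rewrite Los; split; apply: (ultraS UU) => i /=; by rewrite E.
Qed.

End Los.

(* Ultrapowers of [M] are presented by the class map [cls]: every uniformly
   definable relation holds in [N] iff it holds almost everywhere. *)
Lemma ultrapower_gfield (I : Type) (U : set (set I)) (M : gfield) : ultra U ->
  exists (N : gfield) (cls : (I -> M) -> N),
    ultrapower U cls /\
    forall V (P : relation_on V) (x : V -> I -> M), definable P ->
      P (str N) (fun v => cls (x v)) <-> U [set i | P (str M) (fun v => x v i)].
Proof.
move=> UU; have [O [cls UP]] := ultrapower_exists M UU.
have [H HP] := ultraproduct_subgroup UU UP.
by exists (Gfield H), cls; split=> // V P x; apply: Los_definable.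
Qed.

Section Companion.
Variables (p : nat) (ACFG : theory LG).
Hypothesis ACFG_companion : model_companion (ACF_subgroup_theory p) ACFG.

Definition acfg (M : gfield) := models ACFG (str M).

Lemma elem_map_embedding (M N : gfield) (h : {rmorphism M -> N}) :
  acfg M -> acfg N -> gemb h -> elem_map h.
Proof.
move=> MA NA hG V P x; apply: (@definable_elementary (str M) (str N) (fun _ => h)).
by case: ACFG_companion => _ _; apply => //; apply: gemb_embedding.
Qed.

Lemma elem_map_acfg (M N : gfield) (h : M -> N) : elem_map h -> acfg M -> acfg N.
Proof.
move=> hE MA phi /MA Mphi.
pose r := tnil : tup (fun _ : unit => unit) [::].
have e (M' : structure LG) (x : unit -> M' tt) : asg r x = @tnil _ M' by exact: tup_nil.
by have := hE _ _ (fun=> 0) (definable_form phi r); rewrite !e => -[+ _]; apply.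
Qed.

(** A model of the companion embeds in a model of the original theory, where [p = 0] holds, and an
    equation between closed terms descends along an embedding. *)
Lemma acfg_pchar (p_prime : prime p) (M : gfield) : acfg M -> p \in [pchar M].
Proof.
case: ACFG_companion => _ emb _ /emb[N [h [NT hE]]].
pose t := tsum (fun=> T1 nat) p.
have tE (R : pzRingType) (x : nat -> R) : tev x t = p%:R.
  by rewrite tev_sum /= sumr_const card_ord.
rewrite inE p_prime /=; apply/eqP/(emb_inj hE).
rewrite -(tE M (fun=> 0)) -(tevalKG (gsub M)) (emb_teval hE).
rewrite -[0 in RHS]/(@teval (str M) nat (fun=> 0) (T0 nat)) (emb_teval hE).
apply: (models_definable (definable_eq t (T0 nat)) NT) => K G pK x.
by rewrite tevalKG tE; apply: pcharf0.
Qed.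

Lemma models_T (M : gfield) : p \in [pchar M] -> models (ACF_subgroup_theory p) (str M).
Proof. by move=> pM phi; apply. Qed.

(** The model [N] given by the companion is a bare structure and has to be recognized as an
    algebraically closed field with a subgroup. It is placed in a chain [N], [N1], [N2] with [N1] a
    model of the original theory and [N2] of the companion. Universal facts descend from [N1] to
    [N]; solutions of equations found in [N1] exist in [N2], hence in [N], which is elementary in
    [N2]. *)
Lemma embeds_acfg (M : gfield) : p \in [pchar M] ->
  exists (N : gfield) (h : {rmorphism M -> N}), acfg N /\ gemb h.
Proof.
case: ACFG_companion => TA AT mc /models_T/TA[N [h [NA hE]]].
have [N1 [h1 [N1T h1E]]] := AT _ NA.
have [N2 [h2 [N2A h2E]]] := TA _ N1T.
have eE := mc _ _ _ NA N2A (emb_comp h1E h2E).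
pose x3 (x y z : N tt) i := if i is i'.+1 then if i' is _.+1 then z else y else x.
have N_eq (t u : tm nat) : (forall (K : closedFieldType) (x : nat -> K), tev x t = tev x u) ->
    forall x : nat -> N tt, teval x t = teval x u.
  move=> tu x; apply: (emb_inj h1E); rewrite !(emb_teval h1E).
  apply: (models_definable (definable_eq t u) N1T) => K G _ y.
  by rewrite !tevalKG; apply: tu.
have N_ex v (t0 u0 t u : tm nat) : (forall (K : closedFieldType) (x : nat -> K),
      tev x t0 <> tev x u0 -> exists y, tev (upd x v y) t = tev (upd x v y) u) ->
    forall x : nat -> N tt, teval x t0 <> teval x u0 ->
      exists y, teval (upd x v y) t = teval (upd x v y) u.
  move=> tu x ne.
  have dP := definable_ex v (definable_eq t u).
  have dQ := definable_imp (definable_not (definable_eq t0 u0)) dP.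
  have [||y Py] := models_definable dQ N1T _ (@h1 tt \o x).
  - by move=> K G _ z; rewrite !tevalKG => /tu[y yP]; exists y; rewrite !tevalKG.
  - by rewrite -!(emb_teval h1E) => /(emb_inj h1E).
  apply/(definable_elementary x eE dP); exists (@h2 tt y).
  have -> : upd ((fun s => @h2 s \o @h1 s) tt \o x) v (@h2 tt y) = @h2 tt \o upd (@h1 tt \o x) v y.
    by apply/funext => w; rewrite /upd /=; case: pselect.
  by rewrite -!(emb_teval h2E) Py.
have laws : field_laws (m0 N) (m1 N) (@mopp N) (@madd N) (@mmul N).
  split.
  - move=> x y z; apply: (N_eq (TAdd (TVar 0%N) (TAdd (TVar 1%N) (TVar 2)))
      (TAdd (TAdd (TVar 0%N) (TVar 1%N)) (TVar 2)) _ (x3 x y z)) => K k; exact: addrA.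
  - move=> x y; apply: (N_eq (TAdd (TVar 0%N) (TVar 1%N))
      (TAdd (TVar 1%N) (TVar 0%N)) _ (x3 x y y)) => K k; exact: addrC.
  - move=> x; apply: (N_eq (TAdd (T0 _) (TVar 0%N)) (TVar 0%N) _ (x3 x x x)) => K k; exact: add0r.
  - move=> x; apply: (N_eq (TAdd (TOpp (TVar 0%N)) (TVar 0%N)) (T0 _) _ (x3 x x x)) => K k.
    exact: addNr.
  - move=> x y z; apply: (N_eq (TMul (TVar 0%N) (TMul (TVar 1%N) (TVar 2)))
      (TMul (TMul (TVar 0%N) (TVar 1%N)) (TVar 2)) _ (x3 x y z)) => K k; exact: mulrA.
  - move=> x y; apply: (N_eq (TMul (TVar 0%N) (TVar 1%N))
      (TMul (TVar 1%N) (TVar 0%N)) _ (x3 x y y)) => K k; exact: mulrC.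
  - move=> x; apply: (N_eq (TMul (T1 _) (TVar 0%N)) (TVar 0%N) _ (x3 x x x)) => K k; exact: mul1r.
  - move=> x y z; apply: (N_eq (TMul (TAdd (TVar 0%N) (TVar 1%N)) (TVar 2))
      (TAdd (TMul (TVar 0%N) (TVar 2)) (TMul (TVar 1%N) (TVar 2))) _ (x3 x y z)) => K k; exact: mulrDl.
  - move=> /(congr1 (@h1 tt)).
    rewrite -[m1 N]/(teval (fun=> m0 N) (T1 nat)) -[X in _ = @h1 tt X]/(teval (fun=> m0 N) (T0 nat)).
    rewrite !(emb_teval h1E).
    apply: (models_definable (definable_not (definable_eq (T1 nat) (T0 nat))) N1T) => K G _ x.
    by rewrite !tevalKG; apply/eqP/oner_neq0.
  - move=> x x0; have [||y yP] := N_ex 1%N (TVar 0%N) (T0 _) (TMul (TVar 1%N) (TVar 0%N)) (T1 _)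
        _ (x3 x x x); last 1 first.
    + by exists y; move: yP => /=; rewrite updE upd_neq.
    + move=> K k /eqP k0; exists (k 0%N)^-1; rewrite /= updE upd_neq // mulVf //.
    + exact: x0.
have [F [f [fbij f0 f1 [fN fD fM]]]] := build_field laws.
have [f' fK f'K] := fbij.
have fev V (x : V -> N tt) (t : tm V) : f (teval x t) = tev (f \o x) t.
  by elim: t => //= [t <-|t <- u <-|t <- u <-].
have Fcl : GRing.closed_field_axiom F.
  move=> n P n0.
  (* Name 0 is the unknown and name [k.+1] the coefficient of degree [k]. The guard of [N_ex] is
     here the inequation between 0 and 1. *)
  pose t := tpow (TVar 0%N) n.
  pose u := tsum (fun k => TMul (TVar k.+1) (tpow (TVar 0%N) k)) n.
  have tE (R : pzRingType) (x : nat -> R) : tev x t = x 0%N ^+ n by rewrite tev_pow.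
  have uE (R : pzRingType) (x : nat -> R) : tev x u = \sum_(k < n) x k.+1 * x 0%N ^+ k.
    by rewrite tev_sum; apply: eq_bigr => k _ /=; rewrite tev_pow.
  have [||y yP] := N_ex 0%N (T0 _) (T1 _) t u _ (fun i => f' (P i.-1)).
  - move=> K k _; have [y yP] := solve_monicpoly (fun i => k i.+1) n0.
    exists y; rewrite tE uE updE yP; apply: eq_bigr => i _.
    by rewrite upd_neq.
  - by move=> /(congr1 f); rewrite /= f0 f1 => /eqP; rewrite eq_sym oner_eq0.
  exists (f y); move/(congr1 f): yP; rewrite !fev tE uE /= updE => ->.
  by apply: eq_bigr => i _; rewrite upd_neq //= f'K.
have [O [g gbij]] := build_closedField Fcl.
pose c x := g (f x).
have cev V (x : V -> N tt) (t : tm V) : c (teval x t) = tev (c \o x) t.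
  rewrite /c fev; elim: t => //= [||t <-|t <- u <-|t <- u <-].
  by rewrite rmorph0. by rewrite rmorph1. by rewrite rmorphN. by rewrite rmorphD.
  by rewrite rmorphM.
have [g' gK g'K] := gbij.
pose c' x := f' (g' x).
have c'K x : c (c' x) = x by rewrite /c /c' f'K g'K.
have cK x : c' (c x) = x by rewrite /c /c' gK fK.
have [H HP] : exists H : zmodClosed O, forall x, x \in H <-> mG (c' x).
  apply: build_zmodClosed.
    have -> : c' 0 = teval (fun=> m0 N) (T0 nat) by rewrite -[LHS](cK) c'K -[RHS]cK cev.
    apply/(emb_G h1E); rewrite (emb_teval h1E).
    apply: (models_definable (definable_G (T0 nat)) N1T) => K G _ x.
    exact: rpred0.
  move=> x y; set a := c' x; set b := c' y.
  have -> : c' (x - y) = teval (x3 a b b) (TAdd (TVar 0%N) (TOpp (TVar 1%N))).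
    by rewrite -[RHS]cK cev /= /a /b !c'K.
  move=> /(emb_G h1E) Ga /(emb_G h1E) Gb; apply/(emb_G h1E); rewrite (emb_teval h1E).
  apply: (models_definable (definable_imp (definable_G (TVar 0%N))
    (definable_imp (definable_G (TVar 1%N)) (definable_G (TAdd (TVar 0%N) (TOpp (TVar 1%N)))))) N1T) => //.
  by move=> K G _ z; apply: rpredB.
pose cc : forall s, N s -> (KG H) s := fun s => match s return N s -> KG H s with tt => c end.
have tup1 (a : tup N [:: tt]) : a = @tcons _ N tt _ (a tt VZ) (@tnil _ N).
  by rewrite {1}(tcons_eta a); congr tcons; apply: tup_nil.
have tup2 (a : tup N [:: tt; tt]) :
    a = @tcons _ N tt _ (a tt VZ) (@tcons _ N tt _ (a tt (VS VZ)) (@tnil _ N)).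
  by rewrite {1}(tcons_eta a) {1}(tup1 (ttail a)).
have ccE : embedding cc.
  split.
  - by case=> x y /(congr1 c') /=; rewrite !cK.
  - case=> a /=.
    + by rewrite (tup_nil a (@tnil _ N)); apply: (cev _ (fun=> m0 N) (T0 nat)).
    + by rewrite (tup_nil a (@tnil _ N)); apply: (cev _ (fun=> m0 N) (T1 nat)).
    + by rewrite {1}(tup1 a); apply: (cev _ (fun=> a tt VZ) (TOpp (TVar 0%N))).
    + rewrite {1}(tup2 a).
      exact: (cev _ (x3 (a tt VZ) (a tt (VS VZ)) (m0 N)) (TAdd (TVar 0%N) (TVar 1%N))).
    + rewrite {1}(tup2 a).
      exact: (cev _ (x3 (a tt VZ) (a tt (VS VZ)) (m0 N)) (TMul (TVar 0%N) (TVar 1%N))).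
  - by case=> a /=; rewrite HP cK {1}(tup1 a).
have ccEl : elementary cc.
  by apply: iso_elementary => // -[] y; exists (c' y); rewrite /= c'K.
have NO : acfg (Gfield H) by apply/(elementary_models _ ccEl).
have hev V (x : V -> M) (t : tm V) : c (@h tt (tev x t)) = tev (fun v => c (@h tt (x v))) t.
  by rewrite -(tevalKG (gsub M)) (emb_teval hE) cev.
have [k kE] : exists k : {rmorphism M -> O}, forall x, k x = c (@h tt x).
  apply: build_rmorphism => [|x y|x y].
  - exact: (hev _ (fun=> 0) (T1 nat)).
  - exact: (hev _ (fun b : bool => if b then x else y) (TAdd (TVar true) (TOpp (TVar false)))).
  - exact: (hev _ (fun b : bool => if b then x else y) (TMul (TVar true) (TVar false))).
exists (Gfield H), k; split=> // x; rewrite kE HP cK.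
exact: (iff_sym (emb_G hE x)).
Qed.

End Companion.

(** * Extension of homomorphisms *)

(** The function is total and its values outside [B] carry no information, so restricting a morphism
    requires no change of type. *)
Definition hom_on (K A : nzRingType) (B : {pred K}) (f : K -> A) : Prop :=
  [/\ f 1 = 1, {in B &, forall x y, f (x - y) = f x - f y} &
      {in B &, forall x y, f (x * y) = f x * f y}].

Section HomOn.
Variables (K A : fieldType) (B : subringClosed K) (f : K -> A).
Hypothesis fB : hom_on B f.

Lemma hom_on0 : f 0 = 0.
Proof. by case: fB => _ fs _; rewrite -(subrr (0 : K)) fs ?rpred0 // subrr. Qed.

Lemma hom_onN : {in B, forall x, f (- x) = - f x}.
Proof.
by case: fB => _ fs _ x xB; rewrite -[- x]sub0r fs ?rpred0 // hom_on0 sub0r.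
Qed.

Lemma hom_onD : {in B &, forall x y, f (x + y) = f x + f y}.
Proof.
case: fB => _ fs _ x y xB yB.
by rewrite -[y in LHS]opprK fs ?rpredN // hom_onN // opprK.
Qed.

Lemma hom_on_sum n (x : 'I_n -> K) : (forall i, x i \in B) ->
  f (\sum_i x i) = \sum_i f (x i).
Proof.
elim: n x => [|n IHn] x xB; first by rewrite !big_ord0 hom_on0.
by rewrite !big_ord_recl hom_onD ?IHn ?rpred_sum.
Qed.

Lemma hom_onX n : {in B, forall x, f (x ^+ n) = f x ^+ n}.
Proof.
case: fB => f1 _ fM x xB; elim: n => [|n IHn]; first exact: f1.
by rewrite !exprS fM ?rpredX // IHn.
Qed.

Lemma coef_hom (P : {poly K}) i : (map_poly f P)`_i = f P`_i.
Proof. by rewrite coef_map_id0 // hom_on0. Qed.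

Lemma map_polyB_hom (P Q : {poly K}) : P \is a polyOver B -> Q \is a polyOver B ->
  map_poly f (P - Q) = map_poly f P - map_poly f Q.
Proof.
case: fB => _ fs _ /polyOverP PB /polyOverP QB; apply/polyP => i.
by rewrite coef_hom !coefB fs // !coef_hom.
Qed.

Lemma map_polyM_hom (P Q : {poly K}) : P \is a polyOver B -> Q \is a polyOver B ->
  map_poly f (P * Q) = map_poly f P * map_poly f Q.
Proof.
case: fB => _ _ fM /polyOverP PB /polyOverP QB; apply/polyP => i.
rewrite coef_hom !coefM hom_on_sum => [|j]; last by rewrite rpredM.
by apply: eq_bigr => j _; rewrite fM // !coef_hom.
Qed.

Lemma map_polyC_hom c : map_poly f c%:P = (f c)%:P.
Proof. by apply/polyP => i; rewrite coef_hom !coefC; case: eqP => // _; apply: hom_on0. Qed.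

Lemma horner_hom (P : {poly K}) (y : A) : (map_poly f P).[y] = \sum_(i < size P) f P`_i * y ^+ i.
Proof.
rewrite (@horner_coef_wide _ (size P)); last exact: size_poly.
by apply: eq_bigr => i _; rewrite coef_hom.
Qed.

End HomOn.

Section PseudoDivision.
Variables (K : fieldType) (B : subringClosed K).

(** Over a subring the leading coefficient of [G] need not be invertible, so the dividend is
    multiplied by a power of it. *)
Lemma pseudo_division (G P : {poly K}) : G != 0 -> G \is a polyOver B ->
  P \is a polyOver B -> exists k (Q R : {poly K}),
  [/\ Q \is a polyOver B, R \is a polyOver B,
      lead_coef G ^+ k *: P = Q * G + R & (size R < size G)%N].
Proof.
move=> G0 GB; have [n] := ubnP (size P); elim: n P => // n IHn P.
rewrite ltnS => Pn PB; have [PG|GP] := ltnP (size P) (size G).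
  exists 0%N, 0, P; split=> //; first exact: rpred0.
  by rewrite expr0 scale1r mul0r add0r.
have lB (S : {poly K}) : S \is a polyOver B -> lead_coef S \in B.
  by move=> /polyOverP SB; rewrite lead_coefE.
pose d := (size P - size G)%N.
pose S := (lead_coef P)%:P * 'X^d.
have SB : S \is a polyOver B by rewrite rpredM ?polyOverC ?lB // rpredX // polyOverX.
pose P' := lead_coef G *: P - S * G.
have P'B : P' \is a polyOver B.
  by apply: rpredB; [rewrite -mul_polyC|]; rewrite rpredM // polyOverC lB.
have P0 : P != 0 by rewrite -size_poly_gt0 (leq_trans _ GP) // size_poly_gt0.
have sG : (size G > 0)%N by rewrite size_poly_gt0.
have sP' : (size P' < n)%N.
  rewrite (leq_trans _ Pn) // -[size P]prednK ?size_poly_gt0 // ltnS.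
  apply/leq_sizeP => j; rewrite leq_eqVlt => /predU1P[<-|Pj]; rewrite coefB coefZ /S -mulrA coefCM coefXnM.
    rewrite ltnNge (_ : (d <= (size P).-1)%N) /=; last first.
      by rewrite /d -subn1 leq_sub2l.
    rewrite (_ : ((size P).-1 - d = (size G).-1)%N); last first.
      by rewrite /d -!subn1 subnAC subKn.
    by rewrite -!lead_coefE mulrC subrr.
  rewrite prednK ?size_poly_gt0 // in Pj.
  rewrite [P`_j]nth_default // mulr0 sub0r.
  case: ltnP => dj; first by rewrite mulr0 oppr0.
  rewrite [G`_ _]nth_default ?mulr0 ?oppr0 //.
  by rewrite leq_subRL // /d subnK.
have [k [Q [R [QB RB e sR]]]] := IHn P' sP' P'B.
exists k.+1, ((lead_coef G ^+ k) *: S + Q), R; split=> //.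
  by rewrite rpredD // -mul_polyC rpredM // polyOverC rpredX // lB.
rewrite exprSr -scalerA mulrDl -addrA -e /P' scalerBr addrC.
by rewrite -scalerAl subrK.
Qed.

End PseudoDivision.

Section Extension.
Variables (K : fieldType) (A : closedFieldType) (B : subringClosed K) (y : K).

Lemma adjoin_subring : exists B' : subringClosed K,
  forall x, x \in B' <-> exists2 Q, Q \is a polyOver B & x = Q.[y].
Proof.
apply: build_subringClosed.
- by exists 1; rewrite ?hornerC // rpred1.
- move=> _ _ [P PB ->] [Q QB ->]; exists (P - Q); first exact: rpredB.
  by rewrite hornerD hornerN.
- move=> _ _ [P PB ->] [Q QB ->]; exists (P * Q); first exact: rpredM.
  by rewrite hornerM.
Qed.

Variable B' : subringClosed K.
Hypothesis B'P : forall x, x \in B' <-> exists2 Q, Q \is a polyOver B & x = Q.[y].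

Lemma extend_hom (f : K -> A) (w : A) : hom_on B f ->
  (forall Q, Q \is a polyOver B -> Q.[y] = 0 -> (map_poly f Q).[w] = 0) ->
  exists f', [/\ hom_on B' f', {in B, f' =1 f} &
    forall Q, Q \is a polyOver B -> f' Q.[y] = (map_poly f Q).[w]].
Proof.
move=> fB wd.
have wit z : exists Q : {poly K}, z \in B' -> Q \is a polyOver B /\ z = Q.[y].
  have [/B'P[Q QB e]|nz] := pselect (z \in B'); first by exists Q.
  by exists 0.
have [q qP] := choice wit.
pose f' z := (map_poly f (q z)).[w].
have f'E Q : Q \is a polyOver B -> f' Q.[y] = (map_poly f Q).[w].
  move=> QB; have [|qB qE] := qP Q.[y]; first by apply/B'P; exists Q.
  apply/eqP; rewrite -subr_eq0 -hornerN -hornerD -(map_polyB_hom fB) //.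
  by apply/eqP/wd; rewrite ?rpredB // hornerD hornerN -qE subrr.
exists f'; split=> //.
  split.
  - rewrite -(hornerC 1 y) f'E ?rpred1 // (map_polyC_hom fB) hornerC.
    by case: fB.
  - move=> _ _ /B'P[P PB ->] /B'P[Q QB ->].
    rewrite -hornerN -hornerD !f'E ?rpredB // (map_polyB_hom fB) //.
    by rewrite hornerD hornerN.
  - move=> _ _ /B'P[P PB ->] /B'P[Q QB ->].
    by rewrite -hornerM !f'E ?rpredM // (map_polyM_hom fB) // hornerM.
move=> x xB; rewrite -{1}(hornerC x y) f'E ?polyOverC //.
by rewrite (map_polyC_hom fB) hornerC.
Qed.

Variable F : set (K -> A).
Hypotheses (F_hom : forall f, F f -> hom_on B f)
  (F_sep : forall b : K, b \in B -> b != 0 -> exists2 f, F f & f b != 0).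

(** The inductive step of the Nullstellensatz. If [y] is transcendental over [B], it may be sent to
    any non-root of the image of [P]. If it is algebraic, it must go to a root of the image of a
    polynomial [m] of least size killing it, and the value at [b] is controlled by a nonzero
    multiple of [b] lying in [B]. *)
Lemma extend_separating : forall b, b \in B' -> b != 0 ->
  exists f f', [/\ F f, hom_on B' f', {in B, f' =1 f} & f' b != 0].
Proof.
move=> _ /B'P[P PB ->] Py0.
have lB (S : {poly K}) : S \is a polyOver B -> lead_coef S \in B.
  by move=> /polyOverP SB; rewrite lead_coefE.
have P0 : P != 0 by apply: contraNneq Py0 => ->; rewrite horner0.
have [[m0 [m0B m00 m0y]]|tr] := pselect (exists m, [/\ m \is a polyOver B, m != 0 & m.[y] = 0]); last first.
  have [|f fF fl] := @F_sep (lead_coef P) (lB _ PB); first by rewrite lead_coef_eq0.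
  have fB := F_hom fF.
  have : map_poly f P != 0.
    apply: contraNneq fl => e; rewrite lead_coefE -(coef_hom fB) e coef0 eqxx //.
  move=> /closed_nonrootP[w wP].
  have [Q QB Qy|f' [f'B f'f f'E]] := extend_hom (w := w) fB.
    suff -> : Q = 0 by rewrite map_poly0 horner0.
    by apply/eqP; apply: contrapT => /negP Q0; apply: tr; exists Q.
  by exists f, f'; split=> //; rewrite f'E.
pose Pm n := `[< exists m : {poly K}, [/\ m \is a polyOver B, m != 0, m.[y] = 0 & size m = n] >].
have exm : exists n, Pm n by exists (size m0); apply/asboolP; exists m0.
have [n /asboolP[m [mB m0' my sm]] nmin] := ex_minnP exm.
have mmin (Q : {poly K}) : Q \is a polyOver B -> Q.[y] = 0 -> (size Q < size m)%N -> Q = 0.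
  move=> QB Qy; rewrite sm ltnNge => /negP H; apply/eqP; apply: contrapT => /negP Q0.
  by apply: H; apply: nmin; apply/asboolP; exists Q.
have l0 : lead_coef m != 0 by rewrite lead_coef_eq0.
(* A substitute for the inverse of [Q.[y]]: a multiple of it that is a nonzero element of [B]. It
   comes from a Euclidean descent in which [m] is divided by the current remainder. *)
have unit_claim (Q : {poly K}) : Q \is a polyOver B -> Q.[y] != 0 ->
    exists U c, [/\ U \is a polyOver B, c \in B, c != 0 & U.[y] * Q.[y] = c].
  have small (R : {poly K}) : (size R < size m)%N -> R \is a polyOver B -> R.[y] != 0 ->
      exists U c, [/\ U \is a polyOver B, c \in B, c != 0 & U.[y] * R.[y] = c].
    have [k] := ubnP (size R); elim: k R => // k IHk R; rewrite ltnS => Rk Rm RB Ry.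
    have R0 : R != 0 by apply: contraNneq Ry => ->; rewrite horner0.
    have [R1|R1] := leqP (size R) 1.
      exists 1, R`_0; rewrite rpred1 hornerC mul1r.
      have RE : R.[y] = R`_0 by rewrite {1}(size1_polyC R1) hornerC.
      by rewrite -{2}RE (polyOverP RB).
    have [j [q [S [qB SB e sS]]]] := pseudo_division R0 RB mB.
    have := congr1 (fun p => p.[y]) e; rewrite hornerZ my mulr0 hornerD hornerM.
    move=> /esym/eqP; rewrite addr_eq0 => /eqP qS.
    have Sy : S.[y] != 0.
      apply/eqP => Sy; have S0 : S = 0 by apply: mmin => //; apply: ltn_trans Rm.
      move: qS; rewrite Sy oppr0 => /eqP; rewrite mulf_eq0 (negPf Ry) orbF.
      move: e; rewrite S0 addr0 => e /eqP qy.
      have q0 : q != 0.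
        apply: contraTneq m0' => q0; move: e; rewrite q0 mul0r => /eqP.
        by rewrite scaler_eq0 expf_eq0 lead_coef_eq0 (negPf R0) andbF /= negbK.
      have sqm : size m = (size q + size R).-1.
        by rewrite -size_mul // -e size_scale // expf_neq0 // lead_coef_eq0.
      move: q0; apply/negP; rewrite negbK; apply/eqP/mmin => //.
      rewrite sqm; case: (size R) R1 => [|[|r]] // _.
      by rewrite !addnS /= ltnS leq_addr.
    have [||||U [c [UB cB c0 Uc]]] := IHk S => //.
      by apply: leq_trans Rk. by apply: ltn_trans Rm.
    exists (- U * q), c; split=> //; first by rewrite rpredM // rpredN.
    by rewrite hornerM hornerN -mulrA qS mulrNN.
  move=> QB Qy.
  have [j [q [S [qB SB e sS]]]] := pseudo_division m0' mB QB.
  have := congr1 (fun p => p.[y]) e; rewrite hornerZ hornerD hornerM my mulr0 add0r => eS.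
  have [|U [c [UB cB c0 Uc]]] := small S sS SB.
    by rewrite -eS mulf_neq0 // expf_neq0.
  exists ((lead_coef m ^+ j)%:P * U), c; split=> //.
    by rewrite rpredM // polyOverC rpredX // lB.
  by rewrite hornerM hornerC mulrAC eS mulrC.
have [U [c [UB cB c0 Uc]]] := unit_claim P PB Py0.
(* Keeping [c] alive keeps the value at [b] nonzero; keeping the leading coefficient alive preserves
   the size of [m], and thus provides a root. *)
have [||f fF fcl] := F_sep (b := c * lead_coef m); first by rewrite rpredM // lB.
  by rewrite mulf_neq0.
have fB := F_hom fF; have [f1 fs fM] := fB.
move: fcl; rewrite fM ?lB // mulf_eq0 negb_or => /andP[fc fl].
have sfm : size (map_poly f m) = size m by rewrite size_poly_eq // -lead_coefE.
have [w wm] : exists w, root (map_poly f m) w.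
  apply/closed_rootP; rewrite sfm; apply: contraNneq m0' => m1.
  have mE : m = (m`_0)%:P by apply: size1_polyC; rewrite m1.
  have c0' : m`_0 = 0 by rewrite -[LHS](hornerC _ y) -mE.
  by rewrite mE c0'.
have [Q QB Qy|f' [f'B f'f f'E]] := extend_hom (w := w) fB.
  (* The pseudo-remainder of [Q] by [m] vanishes at [y], so it is 0 by minimality of [m]; the image
     of [Q] then vanishes at [w] up to a nonzero factor. *)
  have [j [q [S [qB SB e sS]]]] := pseudo_division m0' mB QB.
  have S0 : S = 0.
    apply: mmin => //.
    by have := congr1 (fun p => p.[y]) e; rewrite hornerZ hornerD hornerM my Qy !mulr0 add0r.
  have := congr1 (fun p => (map_poly f p).[w]) e.
  rewrite S0 addr0 -mul_polyC !(map_polyM_hom fB) ?polyOverC ?rpredX ?lB //.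
  rewrite !hornerM (rootP wm) mulr0 (map_polyC_hom fB) hornerC (hom_onX fB) ?lB //.
  by move=> /eqP; rewrite mulf_eq0 expf_eq0 (negPf fl) andbF /= => /eqP.
exists f, f'; split=> //.
have UB' : U.[y] \in B' by apply/B'P; exists U.
have PB' : P.[y] \in B' by apply/B'P; exists P.
apply: contraNneq fc => f'P0; rewrite -(f'f c cB) -Uc.
by case: f'B => _ _ ->; rewrite // f'P0 mulr0.
Qed.

End Extension.

Lemma extend_separating_seq (K : fieldType) (A : closedFieldType) (B : subringClosed K)
    (F : set (K -> A)) (ys : seq K) :
  (forall f, F f -> hom_on B f) ->
  (forall b, b \in B -> b != 0 -> exists2 f, F f & f b != 0) ->
  exists B' : subringClosed K, [/\ {subset B <= B'}, {subset ys <= B'} &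
    forall b, b \in B' -> b != 0 ->
      exists f f', [/\ F f, hom_on B' f', {in B, f' =1 f} & f' b != 0]].
Proof.
elim: ys B F => [|y ys IHys] B F F_hom F_sep.
  exists B; split=> // b bB b0; have [f Ff fb] := F_sep b bB b0.
  by exists f, f; split=> //; apply: F_hom.
have [B1 B1P] := adjoin_subring B y.
have BB1 : {subset B <= B1}.
  by move=> x xB; apply/B1P; exists x%:P; rewrite ?polyOverC // hornerC.
pose F1 : set (K -> A) := [set f' | hom_on B1 f' /\ exists2 f, F f & {in B, f' =1 f}].
have [||B' [B1B' ysB' B'P]] := IHys B1 F1; first by move=> f' [].
  move=> b bB b0; have [f [f' [Ff f'B f'f f'b]]] := extend_separating B1P F_hom F_sep bB b0.
  by exists f' => //; split=> //; exists f.
exists B'; split.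
- by move=> x /BB1 /B1B'.
- move=> x; rewrite inE => /predU1P[->|/ysB' //]; apply/B1B'/B1P.
  by exists 'X; rewrite ?polyOverX // hornerX.
- move=> b bB' b0; have [f' [f'' [[_ [f Ff f'f]] f''B f''f' f''b]]] := B'P b bB' b0.
  by exists f, f''; split=> // x xB; rewrite f''f' ?BB1 // f'f.
Qed.

(** * Subfields, algebraic closures and linear independence *)

Lemma build_subfield (N : fieldType) (P : N -> Prop) :
  P 1 -> (forall x y, P x -> P y -> P (x - y)) -> (forall x y, P x -> P y -> P (x * y)) ->
  (forall x, P x -> P x^-1) ->
  exists (F : fieldType) (j : {rmorphism F -> N}), forall x, P x <-> exists d, x = j d.
Proof.
move=> P1 PB PM PV.
have P0 : P 0 by rewrite -(subrr (1 : N)); apply: PB.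
have PN x : P x -> P (- x) by move=> Px; rewrite -sub0r; apply: PB.
have PD x y : P x -> P y -> P (x + y) by move=> Px Py; rewrite -[y]opprK; apply/PB/PN.
pose T := {x | P x}.
pose v (x : T) : N := proj1_sig x.
have vP (x : T) : P (v x) := proj2_sig x.
have vI : injective v by move=> [x ?] [y ?] ?; apply: eq_exist.
pose zero : T := exist _ 0 P0; pose one : T := exist _ 1 P1.
pose opp (x : T) : T := exist _ (- v x) (PN _ (vP x)).
pose add (x y : T) : T := exist _ (v x + v y) (PD _ _ (vP x) (vP y)).
pose mul (x y : T) : T := exist _ (v x * v y) (PM _ _ (vP x) (vP y)).
have laws : field_laws zero one opp add mul.
  split.
  - by move=> x y z; apply: vI; apply: addrA.
  - by move=> x y; apply: vI; apply: addrC.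
  - by move=> x; apply: vI; apply: add0r.
  - by move=> x; apply: vI; apply: addNr.
  - by move=> x y z; apply: vI; apply: mulrA.
  - by move=> x y; apply: vI; apply: mulrC.
  - by move=> x; apply: vI; apply: mul1r.
  - by move=> x y z; apply: vI; apply: mulrDl.
  - by move/(congr1 v) => /= /eqP; rewrite oner_eq0.
  - move=> x x0; exists (exist _ (v x)^-1 (PV _ (vP x))); apply: (vI _ _) => /=.
    by rewrite mulVf //; apply/eqP => e; apply: x0; apply: vI.
have [F [f [[g fK gK] f0 f1 [fN fD fM]]]] := build_field laws.
have gE x y : g x = y <-> x = f y by split=> [<-|->].
have [j jE] : exists j : {rmorphism F -> N}, forall x, j x = v (g x).
  apply: build_rmorphism => [|x y|x y].
  - by rewrite -f1 fK.
  - by rewrite -{1}(gK x) -{1}(gK y) -fN -fD fK.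
  - by rewrite -{1}(gK x) -{1}(gK y) -fM fK.
exists F, j => x; split=> [Px|[d ->]]; last by rewrite jE.
by exists (f (exist _ x Px)); rewrite jE fK.
Qed.

Lemma build_closed_subfield (N : closedFieldType) (P : N -> Prop) :
  P 1 -> (forall x y, P x -> P y -> P (x - y)) -> (forall x y, P x -> P y -> P (x * y)) ->
  (forall x, P x -> P x^-1) ->
  (forall n (c : nat -> N) x, (0 < n)%N -> (forall i, P (c i)) ->
     x ^+ n = \sum_(i < n) c i * x ^+ i -> P x) ->
  exists (F : closedFieldType) (j : {rmorphism F -> N}), forall x, P x <-> exists d, x = j d.
Proof.
move=> P1 PB PM PV Proot; have [D0 [j0 j0P]] := build_subfield P1 PB PM PV.
have D0cl : GRing.closed_field_axiom D0.
  move=> n c n0; have [x xP] := solve_monicpoly (fun i => j0 (c i)) n0.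
  have /j0P[d dE] : P x.
    by apply: Proot xP => // i; apply/j0P; exists (c i).
  exists d; apply: (fmorph_inj j0); rewrite rmorphXn -dE xP rmorph_sum.
  by apply: eq_bigr => i _; rewrite rmorphM rmorphXn -dE.
have [D [g gbij]] := build_closedField D0cl.
have [g' gK g'K] := gbij.
have [g1 g1E] : exists g1 : {rmorphism D -> D0}, forall x, g1 x = g' x.
  apply: build_rmorphism => [|x y|x y].
  - by rewrite -(rmorph1 g) gK.
  - by rewrite -{1}(g'K x) -{1}(g'K y) -rmorphB gK.
  - by rewrite -{1}(g'K x) -{1}(g'K y) -rmorphM gK.
exists D, (j0 \o g1) => w; rewrite j0P; split=> [[d ->]|[d ->]].
  by exists (g d); rewrite /= g1E gK.
by exists (g1 d).
Qed.

Definition alg_over (N : fieldType) (R : {pred N}) (w : N) :=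
  exists P : {poly N}, [/\ P \is a polyOver R, P != 0 & P.[w] = 0].

Lemma closed_root_image (A L : closedFieldType) (g : {rmorphism A -> L}) (P : {poly A}) w :
  P != 0 -> (map_poly g P).[w] = 0 -> exists a, w = g a.
Proof.
move=> P0; have [r ->] := closed_field_poly_normal P.
rewrite map_polyZ hornerZ => /eqP; rewrite mulf_eq0 fmorph_eq0 lead_coef_eq0 (negPf P0) /=.
rewrite rmorph_prod; elim: r => [|a r IHr]; first by rewrite big_nil hornerC oner_eq0.
rewrite big_cons hornerM mulf_eq0 => /orP[|/IHr //].
rewrite rmorphB /= map_polyX map_polyC hornerXsubC subr_eq0 => /eqP ->; by exists a.
Qed.

(** Algebraic elements are handled over the fraction field [F] of [R]; clearing denominators
    identifies the two notions. The subfield they form is closed, since a root of a monic polynomial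
    with algebraic coefficients is algebraic. *)
Lemma alg_closure (N : closedFieldType) (R : subringClosed N) :
  exists (D : closedFieldType) (j : {rmorphism D -> N}),
    forall w, alg_over R w <-> exists d, w = j d.
Proof.
have [F [h hP]] : exists (F : fieldType) (j : {rmorphism F -> N}),
    forall x, (exists u v, [/\ u \in R, v \in R, v != 0 & x = u / v]) <-> exists d, x = j d.
  apply: build_subfield.
  - by exists 1, 1; rewrite rpred1 oner_neq0 divr1.
  - move=> _ _ [u [v [uR vR v0 ->]]] [s [t [sR tR t0 ->]]].
    exists (u * t - s * v), (v * t); split; rewrite ?mulf_neq0 ?rpredB ?rpredM //.
    by rewrite -[- (s / t)]mulNr addf_div // mulNr.
  - move=> _ _ [u [v [uR vR v0 ->]]] [s [t [sR tR t0 ->]]].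
    by exists (u * s), (v * t); rewrite mulf_neq0 ?rpredM // mulf_div.
  - move=> _ [u [v [uR vR v0 ->]]]; have [->|u0] := eqVneq u 0.
      by exists 0, 1; rewrite rpred0 rpred1 oner_neq0 mul0r invr0 mul0r.
    by exists v, u; rewrite invf_div.
have algE w : alg_over R w <-> algebraicOver h w.
  split=> [[P [PR P0 Pw]]|[P P0 Pw]].
    have hR x : x \in R -> exists d, x = h d.
      by move=> xR; apply/hP; exists x, 1; rewrite rpred1 oner_neq0 divr1.
    have wit i : exists d, P`_i = h d by apply: hR; apply: (polyOverP PR).
    have [c cP] := choice wit.
    have e : P = map_poly h (\poly_(i < size P) c i).
      apply/polyP => i; rewrite coef_map coef_poly cP.
      by case: ltnP => // Pi; rewrite -cP nth_default // raddf0.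
    exists (\poly_(i < size P) c i); last by rewrite -e; apply/rootP.
    by rewrite -(map_poly_eq0 h) -e.
  have wit i : exists uv : N * N, [/\ uv.1 \in R, uv.2 \in R, uv.2 != 0 & h P`_i = uv.1 / uv.2].
    by have [_ /(_ (ex_intro _ P`_i erefl))[u [v []]]] := hP (h P`_i); exists (u, v).
  have [c cP] := choice wit.
  pose d := \prod_(i < size P) (c i).2.
  have d0 : d != 0 by apply/prodf_neq0 => i _; case: (cP i).
  exists (d *: map_poly h P); split.
  - apply/polyOverP => i; rewrite coefZ coef_map.
    have [iP|Pi] := ltnP i (size P); last by rewrite nth_default // raddf0 mulr0 rpred0.
    rewrite /d (bigD1 (Ordinal iP)) //=; have [uR vR v0 ->] := cP i.
    rewrite mulrAC mulrCA mulfV // mulr1 rpredM // rpred_prod // => k _.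
    by case: (cP k).
  - by rewrite scale_poly_eq0 negb_or d0 map_poly_eq0.
  - by rewrite hornerZ (rootP Pw) mulr0.
have [||||n c x n0 cP xE|D [j jP]] :=
    @build_closed_subfield N (fun w => algebraicOver h w).
- exact: algebraic1.
- exact: algebraic_sub.
- exact: algebraic_mul.
- exact: algebraic_inv.
- apply/integral_algebraic; pose Q : {poly N} := 'X^n - \poly_(i < n) c i.
  have sQ : (size (\poly_(i < n) c i) < size ('X^n : {poly N}))%N.
    by rewrite size_polyXn ltnS size_poly.
  have mQ : Q \is monic by rewrite monicE lead_coefDl ?lead_coefXn // size_polyN.
  apply: (integral_root_monic mQ).
    by rewrite rootE !hornerE horner_poly xE subrr.
  apply/integral_poly => i; rewrite coefB coefXn coef_poly.
  apply: integral_sub; first exact: integral_nat.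
  case: ltnP => _; last exact: integral0.
  exact/integral_algebraic.
by exists D, j => w; rewrite algE.
Qed.

Definition ind (C K : fieldType) (phi : C -> K) r (k : 'I_r -> K) :=
  forall c : 'I_r -> C, \sum_j k j * phi (c j) = 0 -> forall j, c j = 0.

(** The basis is selected among the [k i] themselves; [free_intersection] relies on its members
    having the form of the given elements. *)
Lemma basis_exists (C K : fieldType) (phi : {rmorphism C -> K}) m (k : 'I_m -> K) :
  exists r (b : 'I_r -> K) (c : 'I_m -> 'I_r -> C),
    [/\ ind phi b, forall j, exists i, b j = k i &
        forall i, k i = \sum_j b j * phi (c i j)].
Proof.
elim: m k => [|m IHm] k.
  by exists 0%N, k, (fun _ _ => 0); split=> [? ? []||[]] // [].
have [r [b [c [bi bk kb]]]] := IHm (fun i => k (lift ord0 i)).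
have [[d dE]|nd] := pselect (exists d : 'I_r -> C, k ord0 = \sum_j b j * phi (d j)).
  exists r, b, (fun i => if unlift ord0 i is Some i' then c i' else d); split=> //.
    by move=> j; have [i ->] := bk j; exists (lift ord0 i).
  by move=> i; case: unliftP => [i'|] ->.
pose b' (j : 'I_r.+1) := if unlift ord0 j is Some j' then b j' else k ord0.
have b'0 : b' ord0 = k ord0 by rewrite /b' unlift_none.
have b'S j : b' (lift ord0 j) = b j by rewrite /b' liftK.
exists r.+1, b', (fun i j => if unlift ord0 i is Some i' then
  (if unlift ord0 j is Some j' then c i' j' else 0) else (j == ord0)%:R); split.
- move=> d; rewrite big_ord_recl b'0 => e.
  have d0 : d ord0 = 0.
    apply: contrapT => /eqP d0; apply: nd.
    exists (fun j => - d (lift ord0 j) / d ord0).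
    apply: (mulIf (_ : phi (d ord0) != 0)); first by rewrite fmorph_eq0.
    move/eqP: e; rewrite addr_eq0 => /eqP ->; rewrite mulr_suml -sumrN.
    apply: eq_bigr => j _; rewrite b'S rmorphM rmorphN fmorphV -mulrA mulrVK ?mulrN //.
    by rewrite unitfE fmorph_eq0.
  move: e; rewrite d0 rmorph0 mulr0 add0r => e j.
  case: (unliftP ord0 j) => [j'|] -> //; apply: (bi (fun j => d (lift ord0 j))).
  by rewrite -[RHS]e; apply: eq_bigr => i _; rewrite b'S.
- move=> j; case: (unliftP ord0 j) => [j'|] ->; last by exists ord0.
  by rewrite b'S; have [i ->] := bk j'; exists (lift ord0 i).
- move=> i; rewrite big_ord_recl b'0; case: unliftP => [i'|] ->.
    rewrite unlift_none rmorph0 mulr0 add0r kb; apply: eq_bigr => j _.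
    by rewrite b'S liftK.
  rewrite eqxx rmorph1 mulr1 big1 ?addr0 // => j _.
  by rewrite eq_sym (negPf (neq_lift _ _)) rmorph0 mulr0.
Qed.

Section LinearCombinations.
Variables (F N : fieldType) (phi : {rmorphism F -> N}) (n : nat) (b : 'I_n -> N).

(** Such lists are formal expressions for the elements of the ring generated by the image of [F] and
    the tuple [b]. Keeping the expression apart from its value lets the same expression be evaluated
    along another embedding or at another tuple. *)
Definition lc (l : seq (F * tm 'I_n)) : N := \sum_(q <- l) phi q.1 * tev b q.2.

Definition lsub (l1 l2 : seq (F * tm 'I_n)) := l1 ++ [seq (- q.1, q.2) | q <- l2].
Definition lmul (l1 l2 : seq (F * tm 'I_n)) :=
  [seq (q1.1 * q2.1, TMul q1.2 q2.2) | q1 <- l1, q2 <- l2].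

Lemma lcB l1 l2 : lc (lsub l1 l2) = lc l1 - lc l2.
Proof.
rewrite /lc big_cat big_map /= -sumrN; congr (_ + _).
by apply: eq_bigr => q _; rewrite rmorphN mulNr.
Qed.

Lemma lcM l1 l2 : lc (lmul l1 l2) = lc l1 * lc l2.
Proof.
rewrite /lc big_allpairs_dep mulr_suml; apply: eq_bigr => q1 _.
rewrite mulr_sumr; apply: eq_bigr => q2 _.
by rewrite rmorphM mulrACA.
Qed.

Lemma lc_ring : exists R : subringClosed N, forall x, x \in R <-> exists l, x = lc l.
Proof.
apply: build_subringClosed.
- by exists [:: (1, T1 _)]; rewrite /lc big_seq1 rmorph1 mulr1.
- by move=> _ _ [l1 ->] [l2 ->]; exists (lsub l1 l2); rewrite lcB.
- by move=> _ _ [l1 ->] [l2 ->]; exists (lmul l1 l2); rewrite lcM.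
Qed.

Lemma lc_const c : phi c = lc [:: (c, T1 _)].
Proof. by rewrite /lc big_seq1 mulr1. Qed.

Lemma lc_tev t : tev b t = lc [:: (1, t)].
Proof. by rewrite /lc big_seq1 rmorph1 mul1r. Qed.

End LinearCombinations.

(* Over the subfield [C], elements of [A[b]] are expanded in a common
   [C]-independent family with coefficients in [C[b]]. *)
Lemma lc_decomposition (C A N : fieldType) (jc : {rmorphism C -> A}) (phi : {rmorphism A -> N})
    n (b : 'I_n -> N) m (l : 'I_m -> seq (A * tm 'I_n)) :
  exists r (k : 'I_r -> A) (d : 'I_m -> 'I_r -> seq (C * tm 'I_n)),
    ind jc k /\ forall (L : fieldType) (psi : {rmorphism A -> L}) (x : 'I_n -> L) i,
      lc psi x (l i) = \sum_j psi (k j) * lc (psi \o jc) x (d i j).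
Proof.
pose s := flatten [seq [seq (i, q) | q <- l i] | i <- enum 'I_m].
pose w (t : 'I_(size s)) := tnth (in_tuple s) t.
have [r [k [c [ki _ kc]]]] := basis_exists jc (fun t => (w t).2.1).
exists r, k, (fun i j => [seq (c t j, (w t).2.2) | t <- enum 'I_(size s) & (w t).1 == i]).
split=> // L psi x i.
have -> : lc psi x (l i) = \sum_(t | (w t).1 == i) psi (w t).2.1 * tev x (w t).2.2.
  rewrite -(big_tnth _ _ s (fun u => u.1 == i) (fun u => psi u.2.1 * tev x u.2.2)).
  rewrite /s big_flatten big_map big_enum /= (bigD1 i) //= big_map.
  rewrite [X in _ + X]big1 ?addr0 => [|i' /negPf i'i].
    by rewrite (eq_bigl xpredT) //= => q; rewrite eqxx.
  by rewrite big_map big1 // => q; rewrite /= i'i.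
transitivity (\sum_(t | (w t).1 == i) \sum_j psi (k j) * (psi (jc (c t j)) * tev x (w t).2.2)).
  apply: eq_bigr => t _; rewrite kc rmorph_sum mulr_suml; apply: eq_bigr => j _.
  by rewrite rmorphM mulrA.
rewrite exchange_big; apply: eq_bigr => j _.
by rewrite /lc big_map big_filter big_enum_cond /= mulr_sumr.
Qed.

(* [f] behaves on the finite set [Y] as a retraction of [i]. *)
Definition good_map (D A : closedFieldType) (i : A -> D) (C : set A) (E : set D) (Y : seq D)
    (f : D -> A) :=
  [/\ {in Y &, forall y z, f (y + z) = f y + f z},
      {in Y &, forall y z, f (y * z) = f y * f z},
      forall a, f (i a) = a,
      {in Y, forall y, y != 0 -> f y != 0} &
      {in Y, forall y, C (f y) <-> E y}].

(** In model-theoretic terms, [D] is finitely satisfiable in [A] as far as the field operations and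
    membership in [E] are concerned. Ultraproducts of these maps produce the amalgams. *)
Definition free_maps (D A : closedFieldType) (i : A -> D) (C : set A) (E : set D) :=
  forall Y : seq D, exists f : D -> A, good_map i C E Y f.

Lemma prod_seq_neq0 (N : fieldType) (A : fieldType) (B : subringClosed N) (f : N -> A)
    (Y : seq N) : hom_on B f -> {subset Y <= B} -> f (\prod_(y <- Y) y) != 0 ->
  {in Y, forall y, f y != 0}.
Proof.
move=> fB YB fp y yY; have [_ _ fM] := fB; apply: contraNneq fp => fy.
have sE : \prod_(y <- Y) y = y * \prod_(z <- rem y Y) z by rewrite (big_rem y).
rewrite sE fM ?fy ?mul0r //; first exact: YB.
by rewrite big_seq_cond rpred_prod // => z /andP[/mem_rem zY _]; apply: YB.
Qed.

(** A form of the Nullstellensatz: a finitely generated domain over an algebraically closed field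
    has enough points in that field to separate its nonzero elements from 0. *)
Lemma closed_separating (A D : closedFieldType) (i : {rmorphism A -> D}) (Y : seq D) :
  exists B : subringClosed D, [/\ forall a, i a \in B, {subset Y <= B} &
    forall s, s \in B -> s != 0 -> exists f : D -> A,
      [/\ hom_on B f, forall a, f (i a) = a & f s != 0]].
Proof.
have [B BP] : exists B : subringClosed D, forall x, x \in B <-> exists a, x = i a.
  apply: build_subringClosed.
  - by exists 1; rewrite rmorph1.
  - by move=> _ _ [x ->] [y ->]; exists (x - y); rewrite rmorphB.
  - by move=> _ _ [x ->] [y ->]; exists (x * y); rewrite rmorphM.
pose F : set (D -> A) := [set f | forall a, f (i a) = a].
have F_hom f : F f -> hom_on B f.
  move=> Ff; split.
  - by rewrite -(rmorph1 i) Ff.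
  - by move=> _ _ /BP[x ->] /BP[y ->]; rewrite -rmorphB !Ff.
  - by move=> _ _ /BP[x ->] /BP[y ->]; rewrite -rmorphM !Ff.
have wit y : exists a, forall x, y = i x -> a = x.
  have [[x ->]|ny] := pselect (exists x, y = i x).
    by exists x => z /fmorph_inj.
  by exists 0 => x e; case: ny; exists x.
have [f0 f0P] := choice wit.
have [|B' [BB' YB' B'P]] := extend_separating_seq (F := F) Y F_hom.
  move=> _ /BP[x ->] x0; exists f0; first by move=> a; apply: f0P.
  by rewrite (f0P (i x) x erefl) -(fmorph_eq0 i).
have iB a : i a \in B by apply/BP; exists a.
exists B'; split=> // [a|s sB s0]; first exact: BB'.
have [f [f' [Ff f'B f'f f's]]] := B'P s sB s0.
by exists f'; split=> // a; rewrite f'f ?Ff.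
Qed.

Lemma free_maps_closed (A D : closedFieldType) (i : {rmorphism A -> D}) :
  free_maps i setT setT.
Proof.
move=> Y; pose Y' := [seq y <- Y | y != 0].
have [B [iB YB BP]] := closed_separating i Y.
have Y'B : {subset Y' <= B} by move=> y; rewrite mem_filter => /andP[_ /YB].
(* A morphism that does not kill the product of the nonzero elements of [Y] kills none of them. *)
have [||f [fB fi fs]] := BP (\prod_(y <- Y') y).
- by rewrite big_seq_cond rpred_prod // => y /andP[/Y'B].
- by rewrite prodf_seq_neq0; apply/allP => y; rewrite mem_filter => /andP[].
have [f1 _ fM] := fB.
exists f; split=> //.
- by move=> y z yY zY; apply: (hom_onD fB); apply: YB.
- by move=> y z yY zY; apply: fM; apply: YB.
- by move=> y yY y0; apply: (prod_seq_neq0 fB Y'B) => //; rewrite mem_filter y0.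
Qed.

Lemma hom_horner (K A : fieldType) (B : subringClosed K) (f : K -> A) (P : {poly K}) y :
  hom_on B f -> P \is a polyOver B -> y \in B -> f P.[y] = (map_poly f P).[f y].
Proof.
move=> fB /polyOverP PB yB; have [_ _ fM] := fB.
rewrite (horner_hom fB) horner_coef (hom_on_sum fB) => [|i]; last by rewrite rpredM ?rpredX.
by apply: eq_bigr => i _; rewrite fM ?rpredX // (hom_onX fB).
Qed.

Lemma tev_hom (K A : fieldType) (B : subringClosed K) (f : K -> A) n (b : 'I_n -> K) t :
  hom_on B f -> (forall i, b i \in B) -> tev b t \in B /\ f (tev b t) = tev (f \o b) t.
Proof.
move=> fB bB; have [f1 _ fM] := fB.
elim: t => /= [v|||t [tB <-]|t [tB <-] u [uB <-]|t [tB <-] u [uB <-]].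
- by [].
- by rewrite rpred0 (hom_on0 fB).
- by rewrite rpred1.
- by rewrite rpredN tB (hom_onN fB).
- by rewrite rpredD // (hom_onD fB).
- by rewrite rpredM // fM.
Qed.

Lemma lc_hom (F K A : fieldType) (B : subringClosed K) (f : K -> A) n (b : 'I_n -> K)
    (phi : {rmorphism F -> K}) (psi : {rmorphism F -> A}) l :
  hom_on B f -> (forall i, b i \in B) -> (forall c, phi c \in B) ->
  (forall c, f (phi c) = psi c) ->
  lc phi b l \in B /\ f (lc phi b l) = lc psi (f \o b) l.
Proof.
move=> fB bB pB fp; have [_ _ fM] := fB.
elim: l => [|q l [IHB IHl]]; first by rewrite /lc !big_nil rpred0 (hom_on0 fB).
have [tB tE] := tev_hom q.2 fB bB.
rewrite /lc !big_cons -/(lc phi b l) -/(lc psi (f \o b) l).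
by rewrite rpredD ?rpredM // (hom_onD fB) ?rpredM // fM // fp tE IHl.
Qed.

(** * Extensions generated by a tuple that is free over a subfield *)

Section FreeExtension.
Variables (C A N D : closedFieldType).
Variables (jc : {rmorphism C -> A}) (io : {rmorphism A -> N}) (n : nat) (b : 'I_n -> N).
Variables (Rc Ra : subringClosed N).
Hypothesis RcP : forall x, x \in Rc <-> exists l, x = lc (io \o jc) b l.
Hypothesis RaP : forall x, x \in Ra <-> exists l, x = lc io b l.
Hypothesis LD : forall r (k : 'I_r -> A), ind jc k -> forall d,
  \sum_j io (k j) * lc (io \o jc) b (d j) = 0 -> forall j, lc (io \o jc) b (d j) = 0.
Variables (jD : {rmorphism D -> N}) (i : {rmorphism A -> D}).
Hypothesis DP : forall w, alg_over Ra w <-> exists d, w = jD d.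
Hypothesis iE : forall a, jD (i a) = io a.

Lemma io_Ra a : io a \in Ra. Proof. by apply/RaP; exists [:: (a, T1 _)]; apply: lc_const. Qed.

Lemma b_Rc j : b j \in Rc.
Proof. by apply/RcP; exists [:: (1, TVar j)]; rewrite -(lc_tev (io \o jc) b (TVar j)). Qed.

Lemma Rc_Ra x : x \in Rc -> x \in Ra.
Proof.
move=> /RcP[l ->]; apply/RaP; exists [seq (jc q.1, q.2) | q <- l].
by rewrite /lc big_map.
Qed.

Lemma separating_C d : d \in Rc -> d != 0 -> exists f : N -> C,
  [/\ hom_on Rc f, forall c, f (io (jc c)) = c & f d != 0].
Proof.
move=> dR d0.
have [B [iB YB BP]] := closed_separating (io \o jc) [seq b j | j <- enum 'I_n].
have bB j : b j \in B by apply: YB; apply/mapP; exists j; rewrite ?mem_enum.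
have RcB x : x \in Rc -> x \in B.
  move=> /RcP[l ->].
  by have [] := @lc_hom _ _ _ B idfun _ b (io \o jc) (io \o jc) l.
have [f [[f1 fs fM] fi fd]] := BP d (RcB d dR) d0.
exists f; split=> //; split=> // x y xR yR; [apply: fs|apply: fM]; exact: RcB.
Qed.

(** By linear disjointness [A[b]] is the tensor product of [A] and [C[b]] over [C], so a [C]-point
    of [C[b]] extends linearly to an [A]-point of [A[b]]. To keep [s] alive, it is expanded in a
    [C]-independent family of [A], and the [C]-point is chosen nonzero on a nonzero coefficient. *)
Lemma separating_A s : s \in Ra -> s != 0 -> exists f : N -> A,
  [/\ hom_on Ra f, forall a, f (io a) = a, forall x, x \in Rc -> exists c, f x = jc c & f s != 0].
Proof.
have ext (f0 : N -> C) : hom_on Rc f0 -> (forall c, f0 (io (jc c)) = c) ->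
  exists f : N -> A, hom_on Ra f /\
    forall l, f (lc io b l) = lc (idfun : {rmorphism A -> A}) (fun j => jc (f0 (b j))) l.
  move=> f0R f0c; set x := fun j => jc (f0 (b j)); set id' := (idfun : {rmorphism A -> A}).
  have [f01 f0s f0M] := f0R.
  have jf0R : hom_on Rc (jc \o f0).
    by split=> [|y z yR zR|y z yR zR] /=; rewrite ?f01 ?rmorph1 // ?f0s ?f0M ?rmorphB ?rmorphM.
  have ijR c : (io \o jc) c \in Rc by apply/RcP; exists [:: (c, T1 _)]; apply: lc_const.
  have dE l : lc (id' \o jc) x l = jc (f0 (lc (io \o jc) b l)).
    have [|_ <-] // := lc_hom (psi := (id' \o jc)) l jf0R b_Rc ijR.
    by move=> c /=; rewrite f0c.
  have wd l : lc io b l = 0 -> lc id' x l = 0.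
    move=> l0; have [r [k [d [ki kE]]]] := lc_decomposition jc io b (fun _ : 'I_1 => l).
    move: l0; rewrite (kE _ io b ord0) (kE _ id' x ord0) => /(LD ki) d0.
    by rewrite big1 // => j _; rewrite dE d0 (hom_on0 f0R) rmorph0 mulr0.
  have wit z : exists l, z \in Ra -> z = lc io b l.
    by have [/RaP[l ->]|] := pselect (z \in Ra); [exists l|exists [::]].
  have [L LP] := choice wit.
  have fE l : lc id' x (L (lc io b l)) = lc id' x l.
    apply/eqP; rewrite -subr_eq0 -lcB; apply/eqP/wd.
    by rewrite lcB -LP ?subrr //; apply/RaP; exists l.
  exists (fun z => lc id' x (L z)); split=> //; split.
  - by rewrite -(rmorph1 io) (lc_const io b) fE -lc_const.
  - by move=> _ _ /RaP[l1 ->] /RaP[l2 ->]; rewrite -lcB !fE lcB.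
  - by move=> _ _ /RaP[l1 ->] /RaP[l2 ->]; rewrite -lcM !fE lcM.
move=> /RaP[l ->]; have [r [k [d [ki kE]]]] := lc_decomposition jc io b (fun _ : 'I_1 => l).
rewrite (kE _ io b ord0) => s0.
have [j dj] : exists j, lc (io \o jc) b (d ord0 j) != 0.
  apply: contrapT => nj; move/eqP: s0; apply; rewrite big1 // => j _.
  have [->|dj] := eqVneq (lc (io \o jc) b (d ord0 j)) 0; first by rewrite mulr0.
  by case: nj; exists j.
have [|f0 [f0R f0c f0d]] := separating_C _ dj; first by apply/RcP; exists (d ord0 j).
have [f [fR fE]] := ext f0 f0R f0c.
have fRc l' : f (lc (io \o jc) b l') = jc (f0 (lc (io \o jc) b l')).
  have e : lc (io \o jc) b l' = lc io b [seq (jc q.1, q.2) | q <- l'].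
    by rewrite /lc big_map.
  have [f01 f0s f0M] := f0R.
  have jf0R : hom_on Rc (jc \o f0).
    by split=> [|y z yR zR|y z yR zR] /=; rewrite ?f01 ?rmorph1 // ?f0s ?f0M ?rmorphB ?rmorphM.
  have ijR c : (io \o jc) c \in Rc by apply/RcP; exists [:: (c, T1 _)]; apply: lc_const.
  have [|_ /= ->] // := lc_hom (psi := jc) l' jf0R b_Rc ijR.
    by move=> c /=; rewrite f0c.
  by rewrite e fE /lc big_map.
exists f; split=> //.
- by move=> a; rewrite (lc_const io b) fE -lc_const.
- by move=> _ /RcP[l' ->]; exists (f0 (lc (io \o jc) b l')).
rewrite -(kE _ io b ord0) fE (kE _ (idfun : {rmorphism A -> A}) _ ord0).
apply: contra_neq f0d => sum0; apply/eqP; rewrite -(fmorph_eq0 jc) -fRc.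
have := ki (fun j => f0 (lc (io \o jc) b (d ord0 j))) _ j.
rewrite fRc => ->; rewrite ?rmorph0 //.
rewrite -[RHS]sum0; apply: eq_bigr => j' _ /=; congr (_ * _).
rewrite -fRc (_ : lc (io \o jc) b (d ord0 j') = lc io b [seq (jc q.1, q.2) | q <- d ord0 j']); last first.
  by rewrite /lc big_map.
by rewrite fE /lc big_map.
Qed.

(** If a nonzero polynomial over [C[b]] kills [y], [w] is its leading coefficient: the image of [y]
    is then a root of a nonzero polynomial over the closed field [C]. Otherwise a polynomial over
    [A[b]] killing [y] is split along a [C]-independent family of [A], and [w] is the value at [y]
    of a nonzero component. *)
Lemma witness (y : D) : exists w, w != 0 /\ forall B : subringClosed N,
  {subset Ra <= B} -> jD y \in B -> w \in B /\ forall f : N -> A, hom_on B f ->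
    (forall a, f (io a) = a) -> (forall x, x \in Rc -> exists c, f x = jc c) -> f w != 0 ->
    (exists c, f (jD y) = jc c) <-> alg_over Rc (jD y).
Proof.
have [[Q [QR Q0 Qy]]|nE] := pselect (alg_over Rc (jD y)).
  have lR : lead_coef Q \in Rc by rewrite lead_coefE (polyOverP QR).
  exists (lead_coef Q); rewrite lead_coef_eq0; split=> // B RB yB; split.
    exact/RB/Rc_Ra.
  move=> f fB fa fR fl; split=> // _; first by exists Q.
  have wit k : exists c, f Q`_k = jc c by apply/fR/(polyOverP QR).
  have [c cP] := choice wit.
  pose Q1 := \poly_(k < size Q) c k.
  have Q1E : map_poly jc Q1 = map_poly f Q.
    apply/polyP => k; rewrite coef_map coef_poly (coef_hom fB) cP.
    by case: ltnP => // Qk; rewrite -cP nth_default // raddf0 (hom_on0 fB).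
  have QB : Q \is a polyOver B by apply/polyOverP => k; apply/RB/Rc_Ra/(polyOverP QR).
  apply: (@closed_root_image _ _ jc Q1).
    by rewrite -(map_poly_eq0 jc) Q1E; apply: contraNneq fl => e; rewrite lead_coefE -(coef_hom fB) e coef0.
  by rewrite Q1E -(hom_horner fB) // Qy (hom_on0 fB).
have /DP[P [PR P0 Py]] : exists d, jD y = jD d by exists y.
have wit (k : 'I_(size P)) : exists l, P`_k = lc io b l by apply/RaP/(polyOverP PR).
have [l lP] := choice wit.
have [r [k [d [ki kE]]]] := lc_decomposition jc io b l.
pose e m j := lc (io \o jc) b (d m j).
have eR m j : e m j \in Rc by apply/RcP; exists (d m j).
pose Q j := \sum_(m < size P) (e m j)%:P * 'X^m.
have QR j : Q j \is a polyOver Rc.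
  by apply: rpred_sum => m _; rewrite rpredM ?polyOverC // rpredX // polyOverX.
have PE : P = \sum_j (io (k j))%:P * Q j.
  rewrite -[LHS]coefK poly_def.
  transitivity (\sum_(m < size P) \sum_j (io (k j))%:P * ((e m j)%:P * 'X^m)).
    apply: eq_bigr => m _; rewrite lP (kE _ io b) -mul_polyC rmorph_sum mulr_suml.
    by apply: eq_bigr => j _; rewrite rmorphM -mulrA.
  by rewrite exchange_big; apply: eq_bigr => j _; rewrite mulr_sumr.
have [j Qj] : exists j, Q j != 0.
  apply: contrapT => nj; move/eqP: P0; apply; rewrite PE big1 // => j _.
  have [->|Qj] := eqVneq (Q j) 0; first by rewrite mulr0.
  by case: nj; exists j.
exists (Q j).[jD y]; split.
  by apply/eqP => Qy; apply: nE; exists (Q j).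
move=> B RB yB.
have QB j' : Q j' \is a polyOver B by apply/polyOverP => m; apply/RB/Rc_Ra/(polyOverP (QR j')).
have QyB j' : (Q j').[jD y] \in B by apply: rpred_horner.
split=> // f fB fa fR fw; split=> // -[c cE]; exfalso.
have [f1 fs fM] := fB.
(* If [y] were sent into [C], so would be the values of all components; their combination with
   [C]-independent coefficients is the image of [P.[jD y] = 0], so they would all vanish. *)
have wit' j' : exists g, f (Q j').[jD y] = jc g.
  have : forall m, exists g, f (e m j') = jc g by move=> m; apply: fR.
  move=> /choice[g gP]; exists (\sum_(m < size P) g m * c ^+ m).
  rewrite horner_sum (hom_on_sum fB) => [|m].
    rewrite rmorph_sum; apply: eq_bigr => m _.
    rewrite hornerCM hornerXn fM ?rpredX //; last exact/RB/Rc_Ra.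
    by rewrite (hom_onX fB) // cE gP rmorphM rmorphXn.
  by rewrite hornerCM hornerXn rpredM ?rpredX //; apply/RB/Rc_Ra.
have [g gP] := choice wit'.
move/negP: fw; apply; rewrite gP (ki g) ?rmorph0 //.
have := congr1 (fun P : {poly N} => f P.[jD y]) PE; rewrite Py (hom_on0 fB) horner_sum.
rewrite (hom_on_sum fB) => [e0|j']; last by rewrite hornerCM rpredM //; apply/RB/io_Ra.
rewrite [RHS]e0; apply: eq_bigr => j' _; rewrite hornerCM fM // ?fa ?gP //.
exact/RB/io_Ra.
Qed.

Lemma free_maps_alg : free_maps i [set a | exists c, a = jc c] [set y | alg_over Rc (jD y)].
Proof.
move=> Y; have [w wP] := choice witness.
pose F : set (N -> A) := [set f | [/\ hom_on Ra f, forall a, f (io a) = a &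
  forall x, x \in Rc -> exists c, f x = jc c]].
have [||B [RB YB BP]] := @extend_separating_seq _ _ Ra F [seq jD y | y <- Y].
- by move=> f [].
- by move=> s sR s0; have [f [fR fa fc fs]] := separating_A sR s0; exists f.
(* All nonvanishing conditions go into one product: the nonzero elements of [Y], and for each
   element its witness. *)
pose Y' := [seq jD y | y <- Y & y != 0] ++ [seq w y | y <- Y].
have YB' y : y \in Y -> jD y \in B by move=> yY; apply: YB; apply: map_f.
have Y'B : {subset Y' <= B}.
  move=> z; rewrite mem_cat => /orP[] /mapP[y]; last first.
    by move=> yY ->; have [_ /(_ B RB (YB' y yY))[]] := wP y.
  by rewrite mem_filter => /andP[_ yY] ->; apply: YB'.
have [||f [f' [[fR fa fc] f'B f'f fs]]] := BP (\prod_(y <- Y') y).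
- by rewrite big_seq_cond rpred_prod // => y /andP[/Y'B].
- rewrite prodf_seq_neq0; apply/allP => z; rewrite mem_cat => /orP[] /mapP[y].
    by rewrite mem_filter => /andP[y0 _] ->; rewrite fmorph_eq0.
  by move=> _ ->; have [] := wP y.
have Y'0 := prod_seq_neq0 f'B Y'B fs.
have [_ _ f'M] := f'B.
have f'a a : f' (io a) = a by rewrite f'f ?fa //; apply: io_Ra.
exists (f' \o jD); split=> /=.
- by move=> y z yY zY; rewrite rmorphD (hom_onD f'B) //; apply: YB'.
- by move=> y z yY zY; rewrite rmorphM f'M //; apply: YB'.
- by move=> a; rewrite iE.
- move=> y yY y0; apply: Y'0; rewrite mem_cat; apply/orP; left; apply: map_f.
  by rewrite mem_filter y0.
- move=> y yY; have [_ /(_ B RB (YB' y yY))[_ H]] := wP y.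
  have {}H := H f' f'B f'a; rewrite -H; first by split=> -[c e]; exists c.
    by move=> x xR; have [c cE] := fc x xR; exists c; rewrite f'f //; apply: Rc_Ra.
  by apply: Y'0; rewrite mem_cat map_f ?orbT.
Qed.

End FreeExtension.

(** * Amalgams *)

Section FreeUltra.
Variables (D A : closedFieldType) (i : {rmorphism A -> D}) (C : set A) (E : set D).

Lemma good_mapS (Y Y' : seq D) f : {subset Y <= Y'} -> good_map i C E Y' f -> good_map i C E Y f.
Proof.
move=> YY' [fD fM fi f0 fC]; split=> //.
- by move=> y z /YY' yY /YY' zY; apply: fD.
- by move=> y z /YY' yY /YY' zY; apply: fM.
- by move=> y /YY' yY; apply: f0.
- by move=> y /YY' yY; apply: fC.
Qed.

Lemma free_ultra : free_maps i C E ->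
  exists U : set (set (D -> A)), ultra U /\ forall Y, U [set f | good_map i C E Y f].
Proof.
move=> free.
have [s sF|U [UU FU]] := @ultra_extension (D -> A) [set S | exists Y, S = [set f | good_map i C E Y f]].
  have [Y YP] : exists Y, forall S f, S \in s -> good_map i C E Y f -> S f.
    elim: s sF => [|S s IHs] sF; first by exists [::].
    have [|Y YP] := IHs; first by move=> S' S's; apply: sF; rewrite inE S's orbT.
    have [Y' S'E] := sF S (mem_head _ _); exists (Y' ++ Y) => S' f.
    rewrite in_cons => /predU1P[->|S's] fg.
      by rewrite S'E; apply: good_mapS fg => y; rewrite mem_cat => ->.
    by apply: YP => //; apply: good_mapS fg => y; rewrite mem_cat orbC => ->.
  by have [f fP] := free Y; exists f => S Ss; apply: YP fP.
by exists U; split=> // Y; apply: FU; exists Y.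
Qed.

End FreeUltra.

(* Given [f : D -> A] approximating a retraction, [tau] turns the ultraproduct
   of the [tau \o f] into an embedding of [D] extending [tau]. *)
Lemma ultra_sigma (D A N O : closedFieldType) (i : {rmorphism A -> D}) (C : set A) (E : set D)
    (U : set (set (D -> A))) (cls : ((D -> A) -> N) -> O) (tau : {rmorphism A -> N}) :
  ultra U -> (forall Y, U [set f | good_map i C E Y f]) -> ultrapower U cls ->
  exists s : {rmorphism D -> O}, forall y, s y = cls (fun f => tau (f y)).
Proof.
move=> UU Ug UP; apply: build_rmorphism => [|x y|x y].
- rewrite -(cls1 UP); apply/(cls_eq UP); apply: (ultraS UU) (Ug [::]) => f [_ _ fi _ _] /=.
  by rewrite -(rmorph1 i) fi rmorph1.
- rewrite -(clsB UP); apply/(cls_eq UP).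
  apply: (ultraS UU) (Ug [:: x - y; y]) => f [fD _ _ _ _] /=.
  have /= := fD _ _ (mem_head _ _) (mem_last _ _); rewrite subrK => ->.
  by rewrite rmorphD addrK.
- rewrite -(clsM UP); apply/(cls_eq UP).
  apply: (ultraS UU) (Ug [:: x; y]) => f [_ fM _ _ _] /=.
  by have /= -> := fM _ _ (mem_head _ _) (mem_last _ _); rewrite rmorphM.
Qed.

(** The ultrapower of [N] is indexed by the maps [D -> A]; [N] embeds diagonally, and [y] in [D]
    goes to the class of the values [tau (f y)]. Linear disjointness is checked at a single [f] that
    keeps a given nonzero coefficient nonzero. *)
Lemma field_amalgam (A N D : closedFieldType) (tau : {rmorphism A -> N}) (i : {rmorphism A -> D}) :
  exists (O : closedFieldType) (h : {rmorphism N -> O}) (s : {rmorphism D -> O}),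
    [/\ forall a, s (i a) = h (tau a),
        forall r (k : 'I_r -> N) (d : 'I_r -> D), ind tau k ->
          \sum_j h (k j) * s (d j) = 0 -> forall j, d j = 0 &
        forall k y, h k = s y -> exists a, k = tau a /\ y = i a].
Proof.
have [U [UU Ug]] := free_ultra (free_maps_closed i).
have [O [cls UP]] := ultrapower_exists N UU.
have [h hE] := diag_exists UP.
have [s sE] := ultra_sigma tau UU Ug UP.
have si a : s (i a) = h (tau a).
  rewrite sE hE; apply/(cls_eq UP); apply: (ultraS UU) (Ug [::]) => f [_ _ fi _ _] /=.
  by rewrite fi.
have lin r (k : 'I_r -> N) (d : 'I_r -> D) : ind tau k ->
    \sum_j h (k j) * s (d j) = 0 -> forall j, d j = 0.
  move=> ki e j; apply/eqP; apply: contrapT => /negP dj.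
  have : cls (fun f => \sum_j k j * tau (f (d j))) = cls (fun=> 0).
    rewrite (cls_sum UP) (cls0 UP) -[RHS]e; apply: eq_bigr => j' _.
    by rewrite (clsM UP) hE sE.
  move=> /(cls_eq UP) Ue.
  have [f [/= fe [_ _ _ f0 _]]] := ultra_ex UU (ultraI UU Ue (Ug [:: d j])).
  by have /eqP := f0 _ (mem_head _ _) dj; apply; apply: (ki (fun j => f (d j))).
exists O, h, s; split=> // k y e.
have [[a ka]|nk] := pselect (exists a, k = tau a).
  by exists a; split=> //; apply: (fmorph_inj s); rewrite si -ka.
(* An element [k] outside the image of [A] is independent from 1, so the relation
   [h k * s 1 - h 1 * s y = 0] contradicts linear disjointness. *)
pose kk (j : 'I_2) := if j == ord0 then k else 1.
pose dd (j : 'I_2) := if j == ord0 then 1 else - y.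
have kki : ind tau kk.
  move=> c; rewrite !big_ord_recl big_ord0 addr0 /kk /= mul1r => ec.
  have c0 : c ord0 = 0.
    apply/eqP; apply: contrapT => /negP c0; apply: nk.
    exists (- c (lift ord0 ord0) / c ord0).
    apply: (mulIf (_ : tau (c ord0) != 0)); first by rewrite fmorph_eq0.
    rewrite -rmorphM mulrVK ?unitfE // rmorphN.
    by apply/eqP; rewrite -addr_eq0; apply/eqP.
  move: ec; rewrite c0 rmorph0 mulr0 add0r => /eqP; rewrite fmorph_eq0 => /eqP c1 j.
  by case: (unliftP ord0 j) => [j'|] -> //; rewrite (ord1 j').
have : dd ord0 = 0.
  apply: (lin _ kk dd kki); rewrite !big_ord_recl big_ord0 addr0 /kk /dd /=.
  by rewrite rmorph1 rmorph1 rmorphN mul1r mulr1 e subrr.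
by move/eqP; rewrite /dd /= oner_eq0.
Qed.

(** The sum of the two subgroups adds nothing on either side, since what the two sides share comes
    from [A], where the traces agree. *)
Lemma free_amalgam (A : closedFieldType) (N D : gfield) (tau : {rmorphism A -> N})
    (i : {rmorphism A -> D}) : (forall a, tau a \in gsub N <-> i a \in gsub D) ->
  exists (O : gfield) (h : {rmorphism N -> O}) (s : {rmorphism D -> O}),
    [/\ gemb h, gemb s, forall a, s (i a) = h (tau a) &
    [/\ forall r (k : 'I_r -> N) (d : 'I_r -> D), ind tau k ->
          \sum_j h (k j) * s (d j) = 0 -> forall j, d j = 0,
        forall k y, h k = s y -> exists a, k = tau a /\ y = i a &
        forall x, x \in gsub O <->
          exists g u, [/\ g \in gsub N, u \in gsub D & x = h g + s u]]].
Proof.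
move=> ti; have [O [h [s [si lin dis]]]] := field_amalgam tau i.
have [H HP] : exists H : zmodClosed O, forall x, x \in H <->
    exists g u, [/\ g \in gsub N, u \in gsub D & x = h g + s u].
  apply: build_zmodClosed.
    by exists 0, 0; rewrite !rpred0 !rmorph0 addr0.
  move=> _ _ [g [u [gG uG ->]]] [g' [u' [g'G u'G ->]]].
  by exists (g - g'), (u - u'); rewrite !rpredB // !rmorphB opprD addrACA.
exists (Gfield H), h, s; split=> //=.
- move=> k; rewrite /= HP; split=> [[g [u [gG uG e]]]|kG]; last first.
    by exists k, 0; rewrite kG rpred0 rmorph0 addr0.
  have [|a [ka ua]] := dis (k - g) u; first by rewrite rmorphB e addrC addKr.
  by rewrite -(subrK g k) rpredD // ka ti -ua.
- move=> y; rewrite /= HP; split=> [[g [u [gG uG e]]]|yG]; last first.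
    by exists 0, y; rewrite yG rpred0 rmorph0 add0r.
  have [|a [ga ya]] := dis g (y - u); first by rewrite rmorphB e addrK.
  by rewrite -(subrK u y) rpredD // ya -ti -ga.
Qed.

(** Adding the differences [g2 t - g1 t] puts both copies of [t] in one coset. The trace on either
    copy is unchanged: the copies meet only in [C], so in any relation the two occurrences of [t]
    cancel. *)
Lemma twisted_amalgam (M : gfield) (C : closedFieldType) (c : {rmorphism C -> M}) (Gam : M -> Prop) :
  Gam 0 -> (forall x y, Gam x -> Gam y -> Gam (x - y)) ->
  exists (O : gfield) (g1 g2 : {rmorphism M -> O}),
    [/\ gemb g1, gemb g2, forall a, g1 (c a) = g2 (c a),
        forall x y, g1 x = g2 y -> exists a, x = c a /\ y = c a &
        forall x, Gam x -> g2 x - g1 x \in gsub O].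
Proof.
move=> G0 GB; have [O [g1 [g2 [ge _ dis]]]] := field_amalgam c c.
have [H HP] : exists H : zmodClosed O, forall x, x \in H <->
    exists g u t, [/\ g \in gsub M, u \in gsub M, Gam t & x = g1 g + g2 u + (g2 t - g1 t)].
  apply: build_zmodClosed.
    by exists 0, 0, 0; rewrite !rpred0 !rmorph0 subr0 !addr0.
  move=> _ _ [g [u [t [gG uG tG ->]]]] [g' [u' [t' [g'G u'G t'G ->]]]].
  exists (g - g'), (u - u'), (t - t'); rewrite !rpredB //; split=> //; first exact: GB.
  by rewrite !rmorphB; ring.
exists (Gfield H), g1, g2; split=> //=.
- move=> k; rewrite /= HP; split=> [[g [u [t [gG uG tG e]]]]|kG]; last first.
    by exists k, 0, 0; rewrite kG !rpred0 !rmorph0 subr0 !addr0.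
  have [|a [ka ua]] := dis (k - g + t) (u + t).
    by rewrite !(rmorphB, rmorphD) e; ring.
  have <- // : u + g = k.
    have -> : u = k - g by apply: (addIr t); rewrite ka ua.
    by rewrite subrK.
  by rewrite rpredD.
- move=> k; rewrite /= HP; split=> [[g [u [t [gG uG tG e]]]]|kG]; last first.
    by exists 0, k, 0; rewrite kG !rpred0 !rmorph0 subr0 add0r !addr0.
  have [|a [ka ua]] := dis (g - t) (k - u - t).
    by rewrite !(rmorphB, rmorphD) e; ring.
  have <- // : u + g = k.
    have -> : g = k - u by apply: (addIr (- t)); rewrite ka ua.
    by rewrite addrC subrK.
  by rewrite rpredD.
- move=> x Gx; rewrite /= HP; exists 0, 0, x.
  by rewrite !rpred0 !rmorph0 !add0r.
Qed.

(** Both copies of [D] use the same maps [f : D -> A], followed by [t1] and by [t2]; they agree on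
    [E] because [f] sends it into [C]. The last hypothesis is what makes the sum of the three
    subgroups induce the given one on each piece. *)
Lemma independent_amalgam (A : closedFieldType) (N D : gfield) (i : {rmorphism A -> D})
    (C : set A) (E : set D) (t1 t2 : {rmorphism A -> N}) :
  free_maps i C E -> C 0 -> (forall a b, C a -> C b -> C (a - b)) ->
  (forall a, t1 a \in gsub N <-> i a \in gsub D) ->
  (forall a, t2 a \in gsub N <-> i a \in gsub D) ->
  (forall a b, t1 a = t2 b -> a = b /\ C a) -> (forall a, C a -> t1 a = t2 a) ->
  (forall a y, E y -> i a - y \in gsub D -> t1 a - t2 a \in gsub N) ->
  exists (O : gfield) (h : {rmorphism N -> O}) (s1 s2 : {rmorphism D -> O}),
    [/\ gemb h, gemb s1, gemb s2 &
    [/\ forall a, s1 (i a) = h (t1 a), forall a, s2 (i a) = h (t2 a) &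
        forall y, E y -> s1 y = s2 y]].
Proof.
move=> free C0 CB t1G t2G t12 tC tE.
have [U [UU Ug]] := free_ultra free.
have [O [cls UP]] := ultrapower_exists N UU.
have [h hE] := diag_exists UP.
have [s1 s1E] := ultra_sigma t1 UU Ug UP.
have [s2 s2E] := ultra_sigma t2 UU Ug UP.
(* Additive relations between the three pieces come from [A] up to an element of [E]. They are found
   by freezing one map [f0] and comparing it with a second map [f]. *)
have key w v k : s1 w + s2 v = h k -> exists a a' y,
    [/\ E y, E (- y), w = i a - y, v = i a' + y & k = t1 a + t2 a'].
  rewrite s1E s2E hE -(clsD UP) => /(cls_eq UP) /= Ue.
  have [f0 /= f0e] := ultra_ex UU Ue.
  exists (f0 w), (f0 v), (i (f0 w) - w).
  set a := f0 w; set a' := f0 v; set y := i a - w; set z := v - (i a' + y).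
  pose Y := [:: y; - y; w; z; i a' + y; i a'].
  have [f [/= fe [fD _ fi fn fC]]] := ultra_ex UU (ultraI UU Ue (Ug Y)).
  have fy : f w = a - f y.
    apply/eqP; rewrite eq_sym subr_eq addrC -fD ?inE ?eqxx ?orbT //.
    by rewrite /y subrK fi.
  have fNy : f (- y) = - f y.
    apply/eqP; rewrite -addr_eq0 addrC -fD ?inE ?eqxx ?orbT //.
    by rewrite subrr -(rmorph0 i) fi.
  have fv : f v = f z + (a' + f y).
    rewrite -{1}(subrK (i a' + y) v) -/z fD ?inE ?eqxx ?orbT //; congr (_ + _).
    by rewrite fD ?inE ?eqxx ?orbT // fi.
  (* Subtracting the relation at [f] from the relation at [f0] equates a value of [t1] with a value
     of [t2]; hence [f y] lies in [C] and [f z] vanishes. *)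
  have [|yz Cy] := t12 (f y) (f z + f y).
    apply/eqP; rewrite -subr_eq0; apply/eqP.
    transitivity (t1 a + t2 a' - (t1 (f w) + t2 (f v))); last by rewrite fe f0e subrr.
    by rewrite fy fv !(rmorphB, rmorphD); ring.
  have z0 : z = 0.
    apply/eqP; apply: contrapT => /negP /fn; rewrite !inE eqxx !orbT => /(_ isT)/eqP; apply.
    by apply: (addIr (f y)); rewrite add0r.
  split=> //.
  - by apply/fC; rewrite ?inE ?eqxx.
  - by apply/fC; rewrite ?inE ?eqxx ?orbT // fNy -sub0r; apply: CB.
  - by rewrite opprB addrC subrK.
  - by apply/eqP; rewrite -subr_eq0 -/z z0.
have keyG w v k : s1 w + s2 v = h k ->
  [/\ w \in gsub D -> v \in gsub D -> k \in gsub N,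
      v \in gsub D -> k \in gsub N -> w \in gsub D &
      w \in gsub D -> k \in gsub N -> v \in gsub D].
  move=> /key[a [a' [y [Ey ENy wE vE kE]]]].
  have kE1 : k = (t1 a - t2 a) + t2 (a + a') by rewrite rmorphD kE; ring.
  have kE2 : t1 (a + a') = k + (t1 a' - t2 a') by rewrite rmorphD kE; ring.
  have wv : i (a + a') = w + v by rewrite rmorphD wE vE; ring.
  have wG : w \in gsub D -> t1 a - t2 a \in gsub N by rewrite wE; apply: tE.
  have vG : v \in gsub D -> t1 a' - t2 a' \in gsub N.
    by rewrite vE -[y in i a' + y]opprK; apply: tE.
  split=> [wD vD|vD kN|wD kN].
  - by rewrite kE1 rpredD ?wG // t2G wv rpredD.
  - have : w + v \in gsub D by rewrite -wv -t1G kE2 rpredD ?vG.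
    by move=> wvD; rewrite -(addrK v w) rpredB.
  - have : w + v \in gsub D.
      rewrite -wv -t2G (_ : t2 _ = k - (t1 a - t2 a)); last by rewrite kE1; ring.
      by rewrite rpredB // wG.
    by move=> wvD; rewrite -(addKr w v) addrC rpredB.
have [H HP] : exists H : zmodClosed O, forall x, x \in H <->
    exists g u v, [/\ g \in gsub N, u \in gsub D, v \in gsub D & x = h g + s1 u + s2 v].
  apply: build_zmodClosed.
    by exists 0, 0, 0; rewrite !rpred0 !rmorph0 !addr0.
  move=> _ _ [g [u [v [gG uG vG ->]]]] [g' [u' [v' [g'G u'G v'G ->]]]].
  exists (g - g'), (u - u'), (v - v'); rewrite !rpredB //; split=> //.
  by rewrite !rmorphB; ring.
have si (s : {rmorphism D -> O}) (t : {rmorphism A -> N}) :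
    (forall y, s y = cls (fun f => t (f y))) -> forall a, s (i a) = h (t a).
  move=> sE a; rewrite sE hE; apply/(cls_eq UP).
  by apply: (ultraS UU) (Ug [::]) => f [_ _ fi _ _] /=; rewrite fi.
exists (Gfield H), h, s1, s2; split=> //=.
- move=> k; rewrite /= HP; split=> [[g [u [v [gG uG vG e]]]]|kG]; last first.
    by exists k, 0, 0; rewrite kG rpred0 !rmorph0 !addr0.
  have [|kG _ _] := keyG u v (k - g); first by rewrite rmorphB e; ring.
  by rewrite -(subrK g k) rpredD // kG.
- move=> w; rewrite /= HP; split=> [[g [u [v [gG uG vG e]]]]|kG]; last first.
    by exists 0, w, 0; rewrite kG !rpred0 !rmorph0 addr0 add0r.
  have [|_ wG _] := keyG (w - u) (- v) g; first by rewrite rmorphB rmorphN e; ring.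
  by rewrite -(subrK u w) rpredD // wG // rpredN.
- move=> w; rewrite /= HP; split=> [[g [u [v [gG uG vG e]]]]|kG]; last first.
    by exists 0, 0, w; rewrite kG !rpred0 !rmorph0 !add0r.
  have [|_ _ wG] := keyG (- u) (w - v) g; first by rewrite rmorphB rmorphN e; ring.
  by rewrite -(subrK v w) rpredD // wG // rpredN.
- split; [exact: si|exact: si|] => y Ey; rewrite s1E s2E; apply/(cls_eq UP).
  apply: (ultraS UU) (Ug [:: y]) => f [_ _ _ _ fC] /=.
  by apply/tC/fC; rewrite ?mem_head.
Qed.

Fixpoint tren (V W : Type) (f : V -> W) (t : tm V) : tm W :=
  match t with
  | TVar v => TVar (f v)
  | T0 => T0 W
  | T1 => T1 W
  | TOpp t => TOpp (tren f t)
  | TAdd t u => TAdd (tren f t) (tren f u)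
  | TMul t u => TMul (tren f t) (tren f u)
  end.

(** * Realizations with few relations *)

Lemma tev_ren (R : pzRingType) (V W : Type) (f : V -> W) (x : W -> R) (t : tm V) :
  tev x (tren f t) = tev (x \o f) t.
Proof. by elim: t => //= [t ->|t -> u ->|t -> u ->]. Qed.

Lemma tev_rmorph (R S : pzRingType) (h : {rmorphism R -> S}) V (x : V -> R) (t : tm V) :
  h (tev x t) = tev (h \o x) t.
Proof.
elim: t => //= [||t <-|t <- u <-|t <- u <-].
- by rewrite rmorph0.
- by rewrite rmorph1.
- by rewrite rmorphN.
- by rewrite rmorphD.
- by rewrite rmorphM.
Qed.

(** The coefficients are terms in [x], so which of them vanish depends on [x]; the polynomial is
    only required to be nonzero. *)
Definition polyalg (R : pzRingType) (V : Type) (q : seq (tm V)) (x : V -> R) (w : R) :=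
  \sum_(k < size q) tev x (nth (T0 V) q k) * w ^+ k = 0 /\
  exists2 k, (k < size q)%N & tev x (nth (T0 V) q k) <> 0.

Lemma definable_all_seq (V : Type) (s : seq V) (P : relation_on V) : definable P ->
  definable (fun M x => forall y, (forall v, ~ List.In v s -> y v = x v) -> P M y).
Proof.
move=> dP; apply: definable_ext (definable_not (definable_ex_seq s (definable_not dP))) => M x.
split=> [H y yx|H [y [yx]]]; last by apply; apply: H.
by apply: contrapT => ny; apply: H; exists y.
Qed.

Lemma definable_teq (V : Type) (t u : tm V) : exists P : relation_on V,
  definable P /\ forall (M : gfield) (x : V -> M), P (str M) x <-> tev x t = tev x u.
Proof.
exists (fun M x => teval x t = teval x u); split; first exact: definable_eq.
by move=> M x; rewrite !tevalKG.
Qed.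

Lemma definable_tG (V : Type) (t : tm V) : exists P : relation_on V,
  definable P /\ forall (M : gfield) (x : V -> M), P (str M) x <-> tev x t \in gsub M.
Proof.
exists (fun M x => mG (teval x t)); split; first exact: definable_G.
by move=> M x; rewrite tevalKG.
Qed.

Lemma definable_polyalg (V : Type) (q : seq (tm V)) (v : V) : exists P : relation_on V,
  definable P /\ forall (M : gfield) (x : V -> M), P (str M) x <-> polyalg q x (x v).
Proof.
pose t := tsum (fun k => TMul (nth (T0 V) q k) (tpow (TVar v) k)) (size q).
have [P1 [dP1 P1E]] := definable_teq t (T0 V).
have H k := definable_teq (nth (T0 V) q k) (T0 V).
have [P2 P2E] := choice H.
exists (fun M x => P1 M x /\
  foldr (fun k (Q : Prop) => ~ P2 k M x \/ Q) False (iota 0 (size q))); split.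
  apply: definable_and => //.
  apply: (@definable_seq_has _ _ _ (fun k M x => ~ P2 k M x)) => k.
  by apply: definable_not; case: (P2E k).
move=> M x; rewrite P1E tev_sum /polyalg.
have -> : \sum_(k < size q) tev x (TMul (nth (T0 V) q k) (tpow (TVar v) k)) =
    \sum_(k < size q) tev x (nth (T0 V) q k) * x v ^+ k.
  by apply: eq_bigr => k _ /=; rewrite tev_pow.
suff -> : foldr (fun k (Q : Prop) => ~ P2 k (str M) x \/ Q) False (iota 0 (size q)) <->
    exists2 k, (k < size q)%N & tev x (nth (T0 V) q k) <> 0 by [].
have E (s : seq nat) : foldr (fun k (Q : Prop) => ~ P2 k (str M) x \/ Q) False s <->
    exists2 k, k \in s & tev x (nth (T0 V) q k) <> 0.
  elim: s => [|k s IHs] /=; first by split=> // -[].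
  have [_ P2k] := P2E k; rewrite IHs P2k; split=> [[H0|[k' ks k'0]]|[k']].
  - by exists k; rewrite ?mem_head.
  - by exists k'; rewrite // inE ks orbT.
  - rewrite inE => /predU1P[->|ks] k0; first by left.
    by right; exists k'.
by rewrite E; split=> -[k]; [rewrite mem_iota|move=> kq]; exists k; rewrite ?mem_iota.
Qed.

Lemma polyalg_rmorph (K L : fieldType) (h : {rmorphism K -> L}) V (q : seq (tm V)) (x : V -> K) w :
  polyalg q (h \o x) (h w) <-> polyalg q x w.
Proof.
rewrite /polyalg; have e : \sum_(k < size q) tev (h \o x) (nth (T0 V) q k) * h w ^+ k =
    h (\sum_(k < size q) tev x (nth (T0 V) q k) * w ^+ k).
  by rewrite rmorph_sum; apply: eq_bigr => k _; rewrite rmorphM rmorphXn tev_rmorph.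
rewrite e; split=> -[s0 [k kq k0]]; split; try (exists k => //).
- by apply/eqP; rewrite -(fmorph_eq0 h) s0.
- by move=> e0; apply: k0; rewrite -tev_rmorph e0 rmorph0.
- by rewrite s0 rmorph0.
- by rewrite -tev_rmorph => /eqP; rewrite fmorph_eq0 => /eqP.
Qed.

(** A nonzero polynomial over an algebraically closed field acquires no root in an extension, so one
    finite list serves all of them. *)
Lemma polyalg_root (K : closedFieldType) V (q : seq (tm V)) (x : V -> K) :
  exists r : seq K, forall (L : closedFieldType) (h : {rmorphism K -> L}) w,
    polyalg q (h \o x) w -> exists2 w0, w0 \in r & w = h w0.
Proof.
pose P := \poly_(k < size q) tev x (nth (T0 V) q k).
have [r rP] := closed_field_poly_normal P.
exists r => L h w [s0 [k kq k0]].
have P0 : lead_coef P != 0.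
  rewrite lead_coef_eq0; apply/eqP => /(congr1 (fun P : {poly K} => P`_k)).
  by rewrite coef_poly kq coef0 => e; apply: k0; rewrite -tev_rmorph e rmorph0.
have : (map_poly h P).[w] = 0.
  rewrite (@horner_coef_wide _ (size q)); last first.
    by rewrite size_map_poly size_poly.
  rewrite -[RHS]s0; apply: eq_bigr => m _; rewrite coef_map coef_poly ltn_ord.
  by rewrite /= tev_rmorph.
rewrite rP map_polyZ hornerZ => /eqP; rewrite mulf_eq0 fmorph_eq0 (negPf P0) /=.
rewrite rmorph_prod; elim: r {rP} => [|a r IHr]; first by rewrite big_nil hornerC oner_eq0.
rewrite big_cons hornerM mulf_eq0 rmorphB /= map_polyX map_polyC hornerXsubC subr_eq0.
case/orP=> [/eqP ->|/IHr[w0 wr ->]]; first by exists a; rewrite ?mem_head.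
by exists w0; rewrite // inE wr orbT.
Qed.

Definition spair (V W T : Type) (x : V -> T) (y : W -> T) : V + W -> T :=
  fun v => match v with inl v => x v | inr w => y w end.

Lemma spair_comp (V W T T' : Type) (x : V -> T) (y : W -> T) (h : T -> T') :
  h \o spair x y = spair (h \o x) (h \o y).
Proof. by apply/funext => -[]. Qed.

Section ModelTheory.
Variables (p : nat) (ACFG : theory LG).
Hypotheses (p_prime : prime p)
  (ACFG_companion : model_companion (ACF_subgroup_theory p) ACFG).
Local Notation acfg := (acfg ACFG).

Lemma rmorph_char (M N : gfield) (h : {rmorphism M -> N}) : acfg M -> p \in [pchar N].
Proof.
by move=> MA; apply: (rmorph_pchar h); apply: (acfg_pchar ACFG_companion p_prime MA).
Qed.

Lemma embeds_in_acfg (M N : gfield) (h : {rmorphism M -> N}) : acfg M ->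
  exists (O : gfield) (g : {rmorphism N -> O}), acfg O /\ gemb g.
Proof. by move=> /(rmorph_char h); apply: embeds_acfg. Qed.

Lemma elem_acfg (M N : gfield) (h : {rmorphism M -> N}) :
  acfg M -> acfg N -> gemb h -> elem_map h.
Proof. exact: (elem_map_embedding ACFG_companion). Qed.

(* Types over algebraically closed subfields are determined by the trace of G. *)
Lemma types_over_closed (A : closedFieldType) (N1 N2 : gfield) (t : {rmorphism A -> N1})
    (i : {rmorphism A -> N2}) : acfg N1 -> acfg N2 ->
  (forall a, t a \in gsub N1 <-> i a \in gsub N2) ->
  forall V (P : relation_on V) (x : V -> A), definable P ->
    P (str N1) (t \o x) <-> P (str N2) (i \o x).
Proof.
move=> A1 A2 ti V P x dP.
have [O [h [s [hG sG si _]]]] := free_amalgam ti.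
have [M [g [MA gG]]] := embeds_in_acfg h A1.
have e1 := elem_acfg (h := g \o h) A1 MA (gemb_comp hG gG).
have e2 := elem_acfg (h := g \o s) A2 MA (gemb_comp sG gG).
rewrite (e1 _ _ _ dP) (e2 _ _ _ dP) (_ : _ \o (t \o x) = (g \o s) \o (i \o x)) //.
by apply/funext => v /=; rewrite si.
Qed.

(** Zorn's lemma gives a maximal set of relations that can be avoided finitely many at a time, and
    an ultrapower avoids the whole set. A realization with strictly fewer relations would avoid a
    larger set, which by elementarity could also be avoided finitely many at a time in [K]. *)
Lemma minimal_realization (K : gfield) n (T : Type) (R : T -> relation_on (K + 'I_n))
    (Q : relation_on (K + 'I_n)) (x0 : 'I_n -> K) :
  (forall r, definable (R r)) -> definable Q -> Q (str K) (spair id x0) ->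
  exists (N : gfield) (j : K -> N) (b : 'I_n -> N),
    [/\ elem_map j, Q (str N) (spair j b) &
    forall (N' : gfield) (j' : K -> N') (b' : 'I_n -> N'),
      elem_map j' -> Q (str N') (spair j' b') ->
      (forall r, R r (str N') (spair j' b') -> R r (str N) (spair j b)) ->
      (forall r, R r (str N) (spair j b) -> R r (str N') (spair j' b'))].
Proof.
move=> dR dQ Qx0.
pose fs (S : set T) := forall s : seq T, (forall r, List.In r s -> S r) ->
  exists x : 'I_n -> K, Q (str K) (spair id x) /\
    forall r, List.In r s -> ~ R r (str K) (spair id x).
have [F FP Ftot|S [fsS Smax]] := @Zorn_bigcup T fs.
  move=> s sF.
  have [s0|[X FX Xs]] : s = [::] \/ exists2 X, F X & forall r, List.In r s -> X r.
    elim: s sF => [|r s IHs] sF; [by left|right].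
    have [X FX Xr] : exists2 X, F X & X r by have [X] := sF r (or_introl erefl); exists X.
    case: IHs => [r' r's|s0|[Y FY Ys]]; first by apply: sF; right.
      by exists X => // r' [<-|] //; rewrite s0.
    have [XY|YX] := Ftot X Y FX FY.
      by exists Y => // r' [<-|/Ys] //; apply: XY.
    by exists X => // r' [<-|/Ys/YX].
  - by rewrite s0; exists x0.
  - exact: FP Xs.
have [s sF|U [UU FU]] := @ultra_extension ('I_n -> K) [set A |
    A = [set x | Q (str K) (spair id x)] \/
    exists2 r, S r & A = [set x | ~ R r (str K) (spair id x)]].
  have [u uS uP] : exists2 u, (forall r, List.In r u -> S r) & forall x,
      Q (str K) (spair id x) -> (forall r, List.In r u -> ~ R r (str K) (spair id x)) ->
      forall A, A \in s -> A x.
    elim: s sF => [|A s IHs] sF; first by exists [::].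
    have [B Bs|u uS uP] := IHs; first by apply: sF; rewrite inE Bs orbT.
    have [->|[r Sr ->]] := sF A (mem_head _ _).
      exists u => // x Qx ux B; rewrite inE => /predU1P[->|] //; exact: uP.
    exists (r :: u) => [r' [<-|/uS]|x Qx ux B] //.
    rewrite inE => /predU1P[->|]; first by apply: ux; left.
    by apply: uP => // r' r'u; apply: ux; right.
  by have [x [Qx xu]] := fsS u uS; exists x; apply: uP.
have [N [cls [UP los]]] := ultrapower_gfield K UU.
pose j (k : K) : N := cls (fun=> k).
pose b i : N := cls (fun x => x i).
have losE (P : relation_on (K + 'I_n)) : definable P ->
    P (str N) (spair j b) <-> U [set x | P (str K) (spair id x)].
  move=> dP; have := los _ P (fun v x => spair id x v) dP.
  rewrite (_ : (fun v => cls _) = spair j b) //.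
  by apply/funext => -[].
have jE : elem_map j.
  move=> V P x dP; rewrite (los _ P (fun v _ => x v) dP).
  by rewrite (ultra_const UU).
exists N, j, b; split=> //.
  by apply/losE => //; apply: FU; left.
move=> N' j' b' j'E Qb' sub r Rr; apply: contrapT => nR'.
have nS : S r -> False.
  move=> Sr; have : U [set x | ~ R r (str K) (spair id x)] by apply: FU; right; exists r.
  by move/(ultra_not UU); apply; apply/losE.
pose S' : set T := [set r | ~ R r (str N') (spair j' b')].
have SS' : S `<=` S'.
  move=> r' Sr' /sub /losE => /(_ (dR r')).
  by apply/(ultra_not UU)/FU; right; exists r'.
apply: (Smax S'); first by split=> // H; apply/nS/H.
move=> s sS'.
have dall : definable (fun M (x : K + 'I_n -> M tt) =>
    Q M x /\ foldr (fun r (A : Prop) => ~ R r M x /\ A) True s).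
  apply: definable_and => //.
  by apply: (@definable_seq_all _ _ _ (fun r M x => ~ R r M x)) => r'; apply/definable_not.
have foldE (M : structure LG) (x : K + 'I_n -> M tt) : foldr (fun r (A : Prop) => ~ R r M x /\ A) True s <->
    forall r, List.In r s -> ~ R r M x.
  elim: (s) => [|r' s' IH] /=; first by split.
  rewrite IH; split=> [[H1 H2] r'' [<-|] //|H]; first exact: H2.
  by split=> [|r'' r's]; apply: H; [left|right].
pose xs : seq (K + 'I_n) := [seq inr i | i <- enum 'I_n].
have inrP v : ~ List.In v xs -> exists k, v = inl k.
  case: v => [k|i] ni; first by exists k.
  case: ni; rewrite /xs.
  have : i \in enum 'I_n by rewrite mem_enum.
  elim: (enum 'I_n) => //= i' e IH; rewrite inE => /predU1P[->|/IH]; first by left.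
  by right.
(* Quantifying the tuple away leaves a statement about [K] alone; [x0] only fills the quantified
   names. *)
have := j'E _ _ (spair id x0) (definable_ex_seq xs dall) => -[_ /(_ _)[]].
  exists (spair j' b'); split; last by split=> //; apply/foldE.
  by move=> v /inrP[k ->].
move=> y [yid [Qy /foldE sy]]; exists (y \o inr).
rewrite (_ : spair id (y \o inr) = y) //.
apply/funext => -[k|i] //=; rewrite yid //.
rewrite /xs; elim: (enum 'I_n) => //= i e IH -[|] //.
Qed.

End ModelTheory.

(** * Congruences, and the freeness of a tuple with few relations *)

(** The flag lets elements of [K] and cosets of [G] go through the same arguments. *)
Definition near (M : gfield) (fl : bool) (x y : M) : Prop :=
  if fl then (x - y \in gsub M : Prop) else x = y.

Lemma near_refl (M : gfield) fl (x : M) : near fl x x.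
Proof. by case: fl => //=; rewrite subrr rpred0. Qed.

Lemma near_sym (M : gfield) fl (x y : M) : near fl x y -> near fl y x.
Proof. by case: fl => //= xy; rewrite -opprB rpredN. Qed.

Lemma near_trans (M : gfield) fl (x y z : M) : near fl x y -> near fl y z -> near fl x z.
Proof.
case: fl => /= [xy yz|-> //].
by rewrite -(subrK y x) -addrA rpredD.
Qed.

Lemma near_map (M N : gfield) (h : {rmorphism M -> N}) fl (x y : M) : gemb h ->
  near fl (h x) (h y) <-> near fl x y.
Proof.
move=> hG; case: fl => /=; first by rewrite -rmorphB hG.
by split=> [/fmorph_inj|->].
Qed.

Lemma definable_near (V : Type) fl (v w : V) : exists P : relation_on V,
  definable P /\ forall (M : gfield) (x : V -> M), P (str M) x <-> near fl (x v) (x w).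
Proof.
case: fl.
  by have [P [dP PE]] := definable_tG (TAdd (TVar v) (TOpp (TVar w))); exists P.
by have [P [dP PE]] := definable_teq (TVar v) (TVar w); exists P.
Qed.

Lemma polyalg_ren (R : pzRingType) (V W : Type) (f : V -> W) (q : seq (tm V)) (x : W -> R) w :
  polyalg [seq tren f t | t <- q] x w <-> polyalg q (x \o f) w.
Proof.
have nE k : tev x (nth (T0 W) [seq tren f t | t <- q] k) = tev (x \o f) (nth (T0 V) q k).
  have [kq|qk] := ltnP k (size q); first by rewrite (nth_map (T0 V)) // tev_ren.
  by rewrite !nth_default ?size_map.
by rewrite /polyalg size_map; split=> -[s0 [k kq k0]]; split;
  try (by exists k => //; move: k0; rewrite nE);
  rewrite -[RHS]s0; apply: eq_bigr => m _; rewrite nE.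
Qed.

Lemma definable_polyalg_near (V : Type) (q : seq (tm V)) fl (v : V) : exists P : relation_on V,
  definable P /\ forall (M : gfield) (x : V -> M),
    P (str M) x <-> exists w, polyalg q x w /\ near fl w (x v).
Proof.
have [P1 [dP1 P1E]] := definable_polyalg [seq tren Some t | t <- q] None.
have [P2 [dP2 P2E]] := definable_near fl None (Some v).
pose r (o : option V) := if o is Some u then u else v.
exists (fun M x => exists y, P1 M (upd (x \o r) None y) /\ P2 M (upd (x \o r) None y)).
split.
  by apply: (definable_rename r (definable_ex None (definable_and dP1 dP2))).
have uE (M : gfield) (x : V -> M) y : upd (x \o r) None y \o Some = x.
  by apply/funext => u /=; rewrite upd_neq.
move=> M x; split=> -[w].
  rewrite P1E polyalg_ren P2E updE upd_neq // => -[qw wv]; exists w; split=> //.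
  by move: qw; rewrite uE.
move=> [qw wv]; exists w; rewrite P1E polyalg_ren P2E updE upd_neq //; split=> //.
by rewrite uE.
Qed.

(** Coefficients become names, so that a polynomial relation with parameters in a model is a
    parameter-free relation in [F + 'I_n]. *)
Definition lct (F : Type) n (l : seq (F * tm 'I_n)) : tm (F + 'I_n) :=
  foldr (fun q s => TAdd (TMul (TVar (inl q.1)) (tren inr q.2)) s) (T0 _) l.

Lemma tev_lct (F N : fieldType) (phi : {rmorphism F -> N}) n (b : 'I_n -> N) l :
  tev (spair phi b) (lct l) = lc phi b l.
Proof.
elim: l => [|q l IHl] /=; first by rewrite /lc big_nil.
by rewrite IHl /lc big_cons tev_ren.
Qed.

Definition lmap (F F' : Type) (f : F -> F') n (l : seq (F * tm 'I_n)) := [seq (f q.1, q.2) | q <- l].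

Lemma lc_lmap (F F' N : fieldType) (f : {rmorphism F -> F'}) (phi : {rmorphism F' -> N})
    n (b : 'I_n -> N) l : lc phi b (lmap f l) = lc (phi \o f) b l.
Proof. by rewrite /lc big_map. Qed.

Lemma lc_rmorph (F N O : fieldType) (phi : {rmorphism F -> N}) (s : {rmorphism N -> O})
    n (b : 'I_n -> N) l : s (lc phi b l) = lc (s \o phi) (s \o b) l.
Proof.
rewrite /lc rmorph_sum; apply: eq_bigr => q _.
by rewrite rmorphM tev_rmorph.
Qed.

Lemma lc_eq (F N : fieldType) (phi psi : {rmorphism F -> N}) n (b : 'I_n -> N) l :
  phi =1 psi -> lc phi b l = lc psi b l.
Proof. by move=> e; rewrite /lc; apply: eq_bigr => q _; rewrite e. Qed.

(* The relations to be minimized: a polynomial relation of the tuple over [K]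
   ([inl]), or the fact that some element algebraic over [C] and the tuple lies in
   the coset of [k] ([inr]). *)
Definition rel_data (K C : Type) n := (seq (K * tm 'I_n) + (seq (seq (C * tm 'I_n)) * K))%type.

Definition rel_holds (K C : Type) (c : C -> K) n (N : gfield) (u : K + 'I_n -> N)
    (r : rel_data K C n) : Prop :=
  match r with
  | inl l => tev u (lct l) = 0
  | inr (q, k) => exists w, polyalg [seq lct (lmap c l) | l <- q] u w /\ near true w (u (inl k))
  end.

Lemma definable_rel (K C : Type) (c : C -> K) n (r : rel_data K C n) :
  exists P : relation_on (K + 'I_n), definable P /\
    forall (N : gfield) (u : K + 'I_n -> N), P (str N) u <-> rel_holds c u r.
Proof.
case: r => [l|[q k]]; last exact: definable_polyalg_near.
by have [P [dP PE]] := definable_teq (lct l) (T0 _); exists P.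
Qed.

Section Freeness.
Variables (p : nat) (ACFG : theory LG).
Hypotheses (p_prime : prime p)
  (ACFG_companion : model_companion (ACF_subgroup_theory p) ACFG).
Local Notation acfg := (acfg ACFG).

(* A tuple [b] with as few relations as possible over [K] among the points of
   the fibre [EE( . , x0)] is free from [K] over every [A] containing [x0]:
   compare it with its copy in the free amalgam of [K] and [N] over [A]. *)
Lemma minimal_free (K N : gfield) (A C : closedFieldType) (t : {rmorphism A -> K})
    (cA : {rmorphism C -> A}) n (EE : relation_on ('I_n + 'I_n)) (x0 : 'I_n -> A)
    (j : {rmorphism K -> N}) (b : 'I_n -> N) :
  acfg K -> acfg N -> gemb j -> definable EE ->
  EE (str N) (spair b (j \o t \o x0)) ->
  (forall (N' : gfield) (j' : K -> N') (b' : 'I_n -> N'), elem_map j' ->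
      EE (str N') (spair b' (j' \o t \o x0)) ->
      (forall r, rel_holds (t \o cA) (spair j' b') r -> rel_holds (t \o cA) (spair j b) r) ->
      (forall r, rel_holds (t \o cA) (spair j b) r -> rel_holds (t \o cA) (spair j' b') r)) ->
  (forall r (k : 'I_r -> K) (d : 'I_r -> seq (A * tm 'I_n)), ind t k ->
      \sum_i j (k i) * lc (j \o t) b (d i) = 0 -> forall i, lc (j \o t) b (d i) = 0) /\
  (forall (q : seq (seq (C * tm 'I_n))) k w,
      polyalg [seq lct (lmap (t \o cA) l) | l <- q] (spair j b) w -> near true w (j k) ->
      exists a, near true k (t a)).
Proof.
move=> KA NA jG dEE EEb min.
(* [N] is an extension of [A] through [j \o t]. The competitor of [b] is its image from this factor,
   while [K] is embedded through the other factor. *)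
have [|O [h [s [hG sG si [lin dis HP]]]]] := @free_amalgam A K N t (j \o t).
  by move=> a; rewrite /= jG.
have [N' [g [N'A gG]]] := embeds_in_acfg p_prime ACFG_companion h KA.
have ghE := elem_acfg ACFG_companion (h := g \o h) KA N'A (gemb_comp hG gG).
have gsE := elem_acfg ACFG_companion (h := g \o s) NA N'A (gemb_comp sG gG).
pose b' := g \o s \o b.
have EEb' : EE (str N') (spair b' ((g \o h) \o t \o x0)).
  have := (gsE _ _ _ dEE).1 EEb; rewrite spair_comp.
  rewrite (_ : (g \o s) \o (j \o t \o x0) = (g \o h) \o t \o x0) //.
  by apply/funext => i /=; rewrite si.
have uE : spair (g \o h) b' = g \o spair h (s \o b).
  by apply/funext => -[].
have lcE l : lc (h \o t) (s \o b) l = s (lc (j \o t) b l).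
  by rewrite lc_rmorph; apply: lc_eq => a /=; rewrite -si.
(* The coefficients lie in the closed field [N], so a root found in the amalgam already comes from
   [N]. *)
have root_pull q w : polyalg [seq lct (lmap (t \o cA) l) | l <- q] (spair (g \o h) b') w ->
    exists2 w0, w = g (s w0) & polyalg [seq lct (lmap (t \o cA) l) | l <- q] (spair j b) w0.
  move=> qw; pose q' := [seq lct (lmap cA l) | l <- q].
  have qE (L : closedFieldType) (f : {rmorphism K -> L}) (y : 'I_n -> L) v :
      polyalg [seq lct (lmap (t \o cA) l) | l <- q] (spair f y) v <->
      polyalg q' (spair (f \o t) y) v.
    have nE m : tev (spair f y) (nth (T0 _) [seq lct (lmap (t \o cA) l) | l <- q] m) =
        tev (spair (f \o t) y) (nth (T0 _) q' m).
      have [mq|qm] := ltnP m (size q); last by rewrite !nth_default ?size_map.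
      by rewrite !(nth_map [::]) // !tev_lct !lc_lmap.
    rewrite /polyalg !size_map; split=> -[s0 [m mq m0]]; split;
      try (by exists m => //; move: m0; rewrite nE);
      by rewrite -[RHS]s0; apply: eq_bigr => m' _; rewrite nE.
  move: qw; rewrite (qE _ (g \o h)).
  have -> : spair ((g \o h) \o t) b' = (g \o s) \o spair (j \o t) b.
    by apply/funext => -[a|i] //=; rewrite si.
  have [r rP] := polyalg_root q' (spair (j \o t) b).
  move=> qw; have [w0 _ wE] := rP _ (g \o s) w qw; exists w0; first exact: wE.
  by apply/qE; move: qw; rewrite wE (polyalg_rmorph (g \o s)).
(* Membership in the sum of the two subgroups splits the difference; what both sides then share
   comes from [A]. *)
have near_pull w0 k : near true (g (s w0)) (g (h k)) -> exists a,
    near true k (t a) /\ near true w0 (j k).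
  rewrite /= -rmorphB gG => /HP[g0 [u [g0G uG e]]].
  have [|a [ka wa]] := dis (k + g0) (w0 - u).
    have e' : s w0 = h g0 + s u + h k by rewrite -e subrK.
    by rewrite rmorphD rmorphB e'; ring.
  exists a; split.
    by rewrite -ka opprD addNKr rpredN.
  rewrite (_ : w0 - j k = u + j g0); first by rewrite rpredD // jG.
  by rewrite -(subrK u w0) wa /= -ka rmorphD; ring.
have sub r : rel_holds (t \o cA) (spair (g \o h) b') r -> rel_holds (t \o cA) (spair j b) r.
  case: r => [l|[q k]] /=.
    rewrite uE -tev_rmorph => /eqP; rewrite fmorph_eq0 => /eqP; rewrite !tev_lct.
    have [r [k [d [ki kE]]]] := lc_decomposition t j b (fun _ : 'I_1 => l).
    rewrite (kE _ h _ ord0) (kE _ j _ ord0) => e.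
    rewrite big1 // => i _; rewrite (lin _ _ (fun i => lc (j \o t) b (d ord0 i)) ki) ?mulr0 //.
    by rewrite -[RHS]e; apply: eq_bigr => i' _; rewrite lcE.
  move=> [w [/root_pull[w0 -> qw0] wk]].
  by have [a [_ w0k]] := near_pull _ _ wk; exists w0.
(* By minimality every relation of [b] is one of its copy, and the amalgam allows the copy only
   relations explained by [A]. *)
have sup := min N' (g \o h) b' ghE EEb' sub.
split=> [r k d ki e i|q k w qw wk].
  pose l := flatten [seq [seq (k i * t m.1, m.2) | m <- d i] | i <- enum 'I_r].
  have lE (L : closedFieldType) (f : {rmorphism K -> L}) (y : 'I_n -> L) :
      lc f y l = \sum_i f (k i) * lc (f \o t) y (d i).
    rewrite /lc /l big_flatten big_map big_enum; apply: eq_bigr => i' _.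
    rewrite big_map mulr_sumr; apply: eq_bigr => m _ /=.
    by rewrite rmorphM mulrA.
  have := sup (inl l); rewrite /= uE -tev_rmorph !tev_lct lE e => /(_ erefl) /eqP.
  rewrite fmorph_eq0 lE => /eqP e'.
  apply: (lin _ k (fun i => lc (j \o t) b (d i)) ki).
  by rewrite -[RHS]e'; apply: eq_bigr => i' _; rewrite lcE.
have [|w1 [/root_pull[w0 -> _] /near_pull[a [ka _]]]] := sup (inr (q, k)); first by exists w.
by exists a.
Qed.

End Freeness.

(** * Linear disjointness over an intersection of subfields *)

Definition lin_disjoint (A K N : fieldType) (t : {rmorphism A -> K}) (j : {rmorphism K -> N})
    n (b : 'I_n -> N) :=
  forall r (k : 'I_r -> K) (d : 'I_r -> seq (A * tm 'I_n)), ind t k ->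
    \sum_i j (k i) * lc (j \o t) b (d i) = 0 -> forall i, lc (j \o t) b (d i) = 0.

(** The coefficients are expanded in an [A]-independent family, and linear disjointness turns each
    coordinate into a relation over [A]. Some coordinate has a nonzero first coefficient; by
    independence over [K] it is proportional to the given relation. *)
Lemma lin_disjoint_coef (A K N : fieldType) (t : {rmorphism A -> K}) (j : {rmorphism K -> N})
    n (b : 'I_n -> N) m (L : 'I_m.+1 -> seq (A * tm 'I_n)) (nu : 'I_m -> K) :
  lin_disjoint t j b ->
  ind j (fun l => lc (j \o t) b (L (lift ord0 l))) ->
  lc (j \o t) b (L ord0) = \sum_l lc (j \o t) b (L (lift ord0 l)) * j (nu l) ->
  forall l, exists a, nu l = t a.
Proof.
move=> ld; set e := fun l => lc (j \o t) b (L l) => ei e0.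
pose k (i : 'I_m.+1) := if unlift ord0 i is Some l then - nu l else 1.
have k0 : k ord0 = 1 by rewrite /k unlift_none.
have kS l : k (lift ord0 l) = - nu l by rewrite /k liftK.
have [r [bt [al [bti _ kE]]]] := basis_exists t k.
pose d s := flatten [seq [seq (al i s * q.1, q.2) | q <- L i] | i <- enum 'I_m.+1].
have dE s : lc (j \o t) b (d s) = \sum_i j (t (al i s)) * e i.
  rewrite /lc /d big_flatten big_map big_enum; apply: eq_bigr => i _.
  rewrite big_map mulr_sumr; apply: eq_bigr => q _.
  by rewrite rmorphM mulrA.
have ke : \sum_i j (k i) * e i = 0.
  rewrite big_ord_recl k0 rmorph1 mul1r [e ord0]e0 -big_split big1 // => l _ /=.
  by rewrite kS rmorphN mulNr mulrC subrr.
have d0 : forall s, lc (j \o t) b (d s) = 0.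
  apply: (ld _ bt d bti); rewrite -[RHS]ke.
  transitivity (\sum_s \sum_i j (bt s) * (j (t (al i s)) * e i)).
    by apply: eq_bigr => s _; rewrite dE mulr_sumr.
  rewrite exchange_big; apply: eq_bigr => i _.
  rewrite kE rmorph_sum mulr_suml; apply: eq_bigr => s _.
  by rewrite rmorphM mulrA.
have [s als] : exists s, al ord0 s != 0.
  apply: contrapT => ns; have := k0; rewrite kE big1 => [/eqP|s _].
    by rewrite eq_sym oner_eq0.
  have [->|als] := eqVneq (al ord0 s) 0; first by rewrite rmorph0 mulr0.
  by case: ns; exists s.
move=> l; exists (- (al (lift ord0 l) s / al ord0 s)).
apply/eqP; rewrite -subr_eq0; apply/eqP.
apply: (ei (fun l => nu l - t (- (al (lift ord0 l) s / al ord0 s)))).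
have ja : j (t (al ord0 s)) != 0 by rewrite !fmorph_eq0.
apply: (mulIf ja); rewrite mul0r -[RHS](d0 s) dE big_ord_recl [e ord0]e0.
rewrite mulr_suml mulr_sumr -big_split; apply: eq_bigr => l' _ /=.
rewrite -/(e _) -mulrA.
have -> : j (nu l' - t (- (al (lift ord0 l') s / al ord0 s))) * j (t (al ord0 s)) =
    j (nu l') * j (t (al ord0 s)) + j (t (al (lift ord0 l') s)).
  rewrite -!rmorphM -rmorphD; congr (j _).
  by rewrite rmorphN opprK mulrDl -rmorphM divfK.
by ring.
Qed.

(** A field of definition argument. When an element of [C[b]] is a combination over [K] of others
    independent over [K], its coefficients are unique; they lie in [A0] and in [A1], hence in [C].
    So elements of [C[b]] independent over [C] remain independent over [K]. *)
Lemma free_intersection (C A0 A1 K N : fieldType) (c0 : {rmorphism C -> A0})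
    (c1 : {rmorphism C -> A1}) (t0 : {rmorphism A0 -> K}) (t1 : {rmorphism A1 -> K})
    (j : {rmorphism K -> N}) n (b : 'I_n -> N) :
  (forall x, t0 (c0 x) = t1 (c1 x)) ->
  (forall a a', t0 a = t1 a' -> exists x, a = c0 x) ->
  lin_disjoint t0 j b -> lin_disjoint t1 j b -> lin_disjoint (t0 \o c0) j b.
Proof.
move=> tc dis ld0 ld1.
pose e (l : seq (C * tm 'I_n)) := lc (j \o (t0 \o c0)) b l.
have e0 l : lc (j \o t0) b (lmap c0 l) = e l by rewrite lc_lmap.
have e1 l : lc (j \o t1) b (lmap c1 l) = e l.
  by rewrite lc_lmap; apply: lc_eq => x /=; rewrite -tc.
have ext m (L : 'I_m -> seq (C * tm 'I_n)) :
    ind (j \o (t0 \o c0)) (fun l => e (L l)) -> ind j (fun l => e (L l)).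
  elim: m L => [|m IHm] L Li; first by move=> ? ? [].
  have Li' : ind (j \o (t0 \o c0)) (fun l => e (L (lift ord0 l))).
    move=> x x0 l.
    have := Li (fun i => if unlift ord0 i is Some l then x l else 0) _ (lift ord0 l).
    rewrite liftK; apply; rewrite big_ord_recl unlift_none rmorph0 mulr0 add0r -[RHS]x0.
    by apply: eq_bigr => l' _; rewrite liftK.
  have IH := IHm _ Li'.
  move=> mu mue; have [mu0|mu0] := eqVneq (mu ord0) 0.
    move=> i; case: (unliftP ord0 i) => [l|] -> //.
    apply: (IH (fun l => mu (lift ord0 l))); rewrite -[RHS]mue big_ord_recl mu0.
    by rewrite rmorph0 mulr0 add0r.
  pose nu l := - mu (lift ord0 l) / mu ord0.
  have eE : e (L ord0) = \sum_l e (L (lift ord0 l)) * j (nu l).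
    have jm : j (mu ord0) != 0 by rewrite fmorph_eq0.
    apply: (mulIf jm); move/eqP: mue; rewrite big_ord_recl addr_eq0 => /eqP ->.
    rewrite mulr_suml -sumrN; apply: eq_bigr => l _.
    by rewrite /nu rmorphM rmorphN fmorphV -!mulrA mulVf // mulr1 mulrN.
  have nu0 : forall l, exists a, nu l = t0 a.
    apply: (lin_disjoint_coef (L := fun i => lmap c0 (L i)) ld0).
      by move=> x x0; apply: IH; rewrite -[RHS]x0; apply: eq_bigr => l _; rewrite e0.
    by rewrite e0 eE; apply: eq_bigr => l _; rewrite e0.
  have nu1 : forall l, exists a, nu l = t1 a.
    apply: (lin_disjoint_coef (L := fun i => lmap c1 (L i)) ld1).
      by move=> x x0; apply: IH; rewrite -[RHS]x0; apply: eq_bigr => l _; rewrite e1.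
    by rewrite e1 eE; apply: eq_bigr => l _; rewrite e1.
  have nuC l : exists x, nu l = t0 (c0 x).
    have [a0 a0E] := nu0 l; have [a1 a1E] := nu1 l.
    have [|x ax] := dis a0 a1; first by rewrite -a0E.
    by exists x; rewrite a0E ax.
  have [x xE] := choice nuC.
  exfalso.
  have := Li (fun i => if unlift ord0 i is Some l then - x l else 1) _ ord0.
  rewrite unlift_none => H; suff /H/eqP : \sum_i e (L i) * (j \o (t0 \o c0))
      (if unlift ord0 i is Some l then - x l else 1) = 0 by rewrite oner_eq0.
  rewrite big_ord_recl unlift_none rmorph1 mulr1 eE -big_split big1 // => l _ /=.
  by rewrite liftK !rmorphN mulrN xE subrr.
move=> r k d ki ke i.
(* Linear disjointness is symmetric: the [d i] are expanded in a [C]-basis, which stays independent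
   over [K], and the coordinates give relations over [C] between the [k i]. *)
have [m [dl [g [dli dlE gE]]]] := basis_exists (j \o (t0 \o c0)) (fun i => e (d i)).
have [s sE] := choice dlE.
have dlj : ind j dl.
  have dE : dl = (fun l => e (d (s l))) by apply/funext.
  by rewrite dE; apply: ext; rewrite -dE.
have kg l : \sum_i k i * (t0 \o c0) (g i l) = 0.
  apply: (dlj (fun l => \sum_i k i * (t0 \o c0) (g i l))).
  rewrite -[RHS]ke; transitivity (\sum_l \sum_i j (k i) * (dl l * j (t0 (c0 (g i l))))).
    apply: eq_bigr => l' _; rewrite rmorph_sum mulr_sumr; apply: eq_bigr => i' _.
    by rewrite rmorphM /=; ring.
  rewrite exchange_big; apply: eq_bigr => i' _.
  by rewrite -/(e (d i')) gE mulr_sumr.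
rewrite -/(e (d i)) gE big1 // => l _.
by rewrite (ki (fun i => g i l) (kg l)) rmorph0 mulr0.
Qed.

(** * Generic members of a class *)

Lemma In_map (T U : Type) (f : T -> U) s v :
  List.In v (map f s) <-> exists2 x, List.In x s & v = f x.
Proof.
elim: s => [|y s IHs] /=; first by split=> // -[].
rewrite IHs; split=> [[<-|[x xs ->]]|[x [->|xs] ->]].
- by exists y; [left|].
- by exists x; [right|].
- by left.
- by right; exists x.
Qed.

Lemma In_cat (T : Type) (x : T) s1 s2 : List.In x (s1 ++ s2) <-> List.In x s1 \/ List.In x s2.
Proof.
elim: s1 => /= [|y s1 ->]; first by split=> [|[]] //; right.
by rewrite or_assoc.
Qed.

Lemma In_mem (T : eqType) (s : seq T) x : List.In x s <-> x \in s.
Proof.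
elim: s => //= y s IHs; rewrite inE IHs; split=> [[->|->]|/predU1P[->|]].
- by rewrite eqxx.
- by rewrite orbT.
- by left.
- by right.
Qed.

Section HittingSets.
Variables (T : Type) (Z : eqType) (nr : Z -> Z -> Prop) (S : T -> Z -> Prop).
Hypotheses (nr_sym : forall x y, nr x y -> nr y x)
  (S_nr : forall x b w, S x b -> nr b w -> S x w).

Definition hits (B : seq Z) (Y : T -> Prop) := forall x, Y x -> exists2 b, b \in B & S x b.

(* Membership in an irredundant hitting set of a given size has finitely many
   solutions up to [nr], so such elements are algebraic over the family [Y]. *)
Definition essential r (Y : T -> Prop) z :=
  exists B, [/\ size B = r, hits (z :: B) Y & ~ hits B Y].

(** Fix [x1] in [Y]. Either [z] hits it, which leaves finitely many possibilities, or another member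
    of the hitting set does. That member is one of finitely many up to [nr], and removing it leaves
    [z] essential, with a smaller size, for the points it does not hit. *)
Lemma essential_finite r (Y : T -> Prop) :
  (forall x, Y x -> exists l : seq Z, forall b, S x b -> exists2 b', b' \in l & nr b b') ->
  exists l : seq Z, forall z, essential r Y z -> exists2 z', z' \in l & nr z z'.
Proof.
elim: r Y => [|r IHr] Y fin.
all: have [[x1 Yx1]|nY] := pselect (exists x, Y x); last first.
all: try by exists [::] => z [B [_ _]]; case=> x Yx; case: nY; exists x.
  have [l lP] := fin x1 Yx1; exists l => z [B [/size0nil -> + _]] => /(_ x1 Yx1)[b].
  by rewrite inE => /eqP ->; apply: lP.
have [l1 l1P] := fin x1 Yx1.
have step w : exists l : seq Z, forall z, essential r (fun x => Y x /\ ~ S x w) z ->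
    exists2 z', z' \in l & nr z z'.
  by apply: IHr => x [Yx _]; apply: fin.
have [L LP] := choice step.
exists (l1 ++ flatten (map L l1)) => z [B [sB hB nB]].
have [b] := hB x1 Yx1; rewrite inE => /predU1P[->|bB] Sb.
  by have [b' b'l zb'] := l1P _ Sb; exists b'; rewrite // mem_cat b'l.
have [w wl bw] := l1P _ Sb.
have pB := perm_to_rem bB.
have mB y : y \in B = (y == b) || (y \in rem b B) by rewrite (perm_mem pB) inE.
have [|z' z'L zz'] := LP w z.
  exists (rem b B); split.
  - by rewrite size_rem // sB.
  - move=> x [Yx nSw]; have [y] := hB x Yx; rewrite !inE mB => yB Sy.
    case/or3P: yB => [yz|/eqP yb|yr].
    + by exists y; rewrite // inE yz.
    + by case: nSw; apply: (S_nr (b := b)) bw; rewrite -yb.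
    + by exists y; rewrite // inE yr orbT.
  - move=> hr; apply: nB => x Yx; have [Sw|nSw] := pselect (S x w).
      by exists b => //; apply: (S_nr Sw); apply: nr_sym.
    by have [|y yr Sy] := hr x; [|exists y; rewrite // mB yr orbT].
exists z' => //; rewrite mem_cat; apply/orP; right.
by apply/flattenP; exists (L w) => //; apply: map_f.
Qed.

Lemma hits_essential (Y : T -> Prop) B : (exists x, Y x) -> hits B Y ->
  exists r z, z \in B /\ essential r Y z.
Proof.
move=> [x Yx]; elim: B => [|z B IHB] hB; first by have [] := hB x Yx.
have [/IHB[r [z' [z'B e]]]|nB] := pselect (hits B Y).
  by exists r, z'; rewrite inE z'B orbT.
by exists (size B), z; rewrite mem_head; split=> //; exists B.
Qed.

End HittingSets.

Definition ocons (V T : Type) (z : T) (y : V -> T) : option V -> T :=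
  fun o => if o is Some v then y v else z.

Lemma In_allpairs (T U : Type) (s : seq T) (r : seq U) x y :
  List.In (x, y) [seq (x, y) | x <- s, y <- r] <-> List.In x s /\ List.In y r.
Proof.
elim: s => [|z s IHs] /=; first by split=> // -[].
rewrite In_cat IHs In_map; split=> [[[y' yr [-> ->]]|[xs yr]]|[[->|xs] yr]].
- by split=> //; left.
- by split=> //; right.
- by left; exists y.
- by right.
Qed.

Lemma flatten_In (T : Type) (Z : eqType) (r : T -> seq Z) s q z :
  List.In q s -> z \in r q -> z \in flatten (map r s).
Proof.
elim: s => //= q' s IHs [->|qs] zr; rewrite mem_cat ?zr // (IHs qs zr).
exact: orbT.
Qed.

Section Algebraic.
Variables (n : nat) (EE : relation_on ('I_n + 'I_n)).
Arguments EE : clear implicits.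
Hypothesis dEE : definable EE.

(* [z] (resp. its coset, if [fl]) is algebraic over the class of [a]. *)
Definition aclX (K : gfield) (a : 'I_n -> K) (fl : bool) (z : K) :=
  exists Q : relation_on (option 'I_n), definable Q /\
  exists l : seq K, Q (str K) (ocons z a) /\
    forall y w, EE (str K) (spair y a) -> Q (str K) (ocons w y) ->
      exists2 w', w' \in l & near fl w w'.

Definition algS (Th : seq (seq (tm 'I_n))) (M : gfield) (x : 'I_n -> M) (b : M * bool) :=
  exists2 q, List.In q Th & exists w, polyalg q x w /\ near b.2 w b.1.

(** [inl None] is the candidate [z], [inl (Some i)] the tuple representing the class, [inr (inl k)]
    the other members of the hitting set, and [inr (inr i)] the quantified member of the class. *)
Local Notation names := (option 'I_n + (nat + 'I_n))%type.

Lemma definable_hits Th (L : seq (names * bool)) :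
  (forall v, v \in L -> forall i, v.1 <> inr (inr i)) ->
  exists P : relation_on names, definable P /\ forall (M : gfield) (u : names -> M),
    P (str M) u <-> forall x, EE (str M) (spair x (u \o inl \o Some)) ->
      exists2 vf, vf \in L & algS Th x (u vf.1, vf.2).
Proof.
move=> Lx.
have H (qv : seq (tm 'I_n) * (names * bool)) := definable_polyalg_near
  [seq tren (inr \o inr : 'I_n -> names) t | t <- qv.1] qv.2.2 qv.2.1.
have [PS PSE] := choice H.
pose s := [seq (q, v) | q <- Th, v <- L].
pose ix (v : 'I_n + 'I_n) : names := match v with inl i => inr (inr i) | inr i => inl (Some i) end.
pose xs : seq names := [seq inr (inr i) | i <- enum 'I_n].
exists (fun M u => forall y, (forall v, ~ List.In v xs -> y v = u v) ->
  EE M (y \o ix) -> foldr (fun qv (A : Prop) => PS qv M y \/ A) False s); split.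
  apply: definable_all_seq; apply: definable_imp; first exact: definable_rename.
  by apply: (@definable_seq_has _ _ _ PS) => qv; case: (PSE qv).
have foldE (M : gfield) (y : names -> M) (Y : seq (seq (tm 'I_n) * (names * bool))) :
    foldr (fun qv (A : Prop) => PS qv (str M) y \/ A) False Y <->
    exists2 qv, List.In qv Y & exists w, polyalg qv.1 (y \o inr \o inr) w /\ near qv.2.2 w (y qv.2.1).
  elim: Y => [|qv Y IHY] /=; first by split=> // -[].
  have [_ /(_ M y) PE] := PSE qv; rewrite IHY PE; split=> [[[w]|[qv' qY]]|[qv']].
  - by rewrite polyalg_ren => ?; exists qv; [left|exists w].
  - by move=> ?; exists qv' => //; right.
  - case=> [<-|qY] [w ?]; [left|right]; last by exists qv' => //; exists w.
    by exists w; rewrite polyalg_ren.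
have inxs v : List.In v xs <-> exists i, v = inr (inr i).
  split=> [/In_map[i _ ->]|[i ->]]; first by exists i.
  by apply/In_map; exists i => //; apply/In_mem; rewrite mem_enum.
move=> M u; split=> [Hu x EEx|Hu y yu EEy].
  pose y : names -> M := fun v => if v is inr (inr i) then x i else u v.
  have y1 v : ~ List.In v xs -> y v = u v.
    move=> nv; have : ~ exists i, v = inr (inr i) by move=> /inxs.
    by case: v {nv} => [o|[k|i]] // []; exists i.
  have y2 : EE (str M) (y \o ix).
    have -> : y \o ix = spair x (u \o inl \o Some) by apply/funext => -[].
    exact: EEx.
  have [qv + /= [w [qw wv]]] := (foldE M y s).1 (Hu y y1 y2).
  case: qv qw wv => q v /= qw wv /In_allpairs[qT /In_mem vL].
  exists v => //; exists q => //; exists w; split=> //.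
  by have := Lx v vL; move: wv; case: v.1 => // -[k|i] //= _ /(_ i).
apply/foldE; have [|v vL [q qT [w [qw wv]]]] := Hu (y \o inr \o inr).
  have <- : y \o ix = spair (y \o inr \o inr) (u \o inl \o Some).
    by apply/funext => -[i|i] //=; rewrite yu // => /inxs[].
  exact: EEy.
exists (q, v); first by apply/In_allpairs; split=> //; apply/In_mem.
exists w; split=> //=; rewrite yu // => /inxs[i e].
exact: (Lx v vL i).
Qed.

Lemma definable_essential Th fl (fls : seq bool) : exists Q : relation_on (option 'I_n),
  definable Q /\ forall (M : gfield) (z : M) (y : 'I_n -> M),
    Q (str M) (ocons z y) <-> exists B : seq M, size B = size fls /\
      hits (@algS Th M) ((z, fl) :: zip B fls) (fun x => EE (str M) (spair x y)) /\
      ~ hits (@algS Th M) (zip B fls) (fun x => EE (str M) (spair x y)).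
Proof.
pose L0 : seq (names * bool) := [seq (inr (inl k), nth false fls k) | k <- iota 0 (size fls)].
pose L1 := (inl None, fl) :: L0.
have L0x v : v \in L0 -> forall i, v.1 <> inr (inr i) by move=> /mapP[k _ ->].
have L1x v : v \in L1 -> forall i, v.1 <> inr (inr i).
  by rewrite inE => /predU1P[->|/L0x].
have [P0 [dP0 P0E]] := definable_hits Th L0x.
have [P1 [dP1 P1E]] := definable_hits Th L1x.
pose bs : seq names := [seq inr (inl k) | k <- iota 0 (size fls)].
pose r (v : names) : option 'I_n := if v is inl o then o else None.
exists (fun M x => exists y, (forall v, ~ List.In v bs -> y v = (x \o r) v) /\
  (P1 M y /\ ~ P0 M y)); split.
  apply: (definable_rename r (P := fun M x => exists y, (forall v, ~ List.In v bs -> y v = x v) /\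
    (P1 M y /\ ~ P0 M y))).
  by apply: definable_ex_seq; apply: definable_and => //; apply: definable_not.
have inbs v : List.In v bs <-> exists2 k, (k < size fls)%N & v = inr (inl k).
  split=> [/In_map[k /In_mem]|[k kf ->]]; first by rewrite mem_iota => kf ->; exists k.
  by apply/In_map; exists k => //; apply/In_mem; rewrite mem_iota.
move=> M z y.
have zipE (u : names -> M) (B : seq M) : size B = size fls ->
    (forall k, (k < size fls)%N -> u (inr (inl k)) = nth 0 B k) ->
    [seq (u vf.1, vf.2) | vf <- L0] = zip B fls.
  move=> sB uB; apply: (@eq_from_nth _ (0, false)).
    by rewrite !size_map size_iota size_zip sB minnn.
  move=> k; rewrite !size_map size_iota => kf.
  rewrite (nth_map (inl None, false)) ?size_map ?size_iota //.
  by rewrite (nth_map 0%N) ?size_iota // nth_iota //= nth_zip // uB.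
have hitE (u : names -> M) (L : seq (names * bool)) x :
    (exists2 vf, vf \in L & algS Th x (u vf.1, vf.2)) <->
    exists2 b, b \in [seq (u vf.1, vf.2) | vf <- L] & algS Th x b.
  split=> [[vf vL Sv]|[b /mapP[vf vL ->] Sv]]; last by exists vf.
  by exists (u vf.1, vf.2) => //; apply/mapP; exists vf.
have hitsE (u : names -> M) (P : relation_on names) L :
    (forall (M : gfield) (u : names -> M), P (str M) u <->
      forall x, EE (str M) (spair x (u \o inl \o Some)) ->
        exists2 vf, vf \in L & algS Th x (u vf.1, vf.2)) ->
    u \o inl \o Some = y ->
    P (str M) u <-> hits (@algS Th M) [seq (u vf.1, vf.2) | vf <- L] (fun x => EE (str M) (spair x y)).
  by move=> -> uy; split=> H x; [rewrite -uy|rewrite uy] => /H /hitE.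
split=> [[u [uo [Pu1 Pu0]]]|[B [sB [h1 h0]]]].
  have uy : u \o inl \o Some = y by apply/funext => i /=; rewrite uo //; move=> /inbs[].
  have uz : u (inl None) = z by rewrite uo //; move=> /inbs[].
  pose B := [seq u (inr (inl k)) | k <- iota 0 (size fls)].
  have sB : size B = size fls by rewrite size_map size_iota.
  have BE : [seq (u vf.1, vf.2) | vf <- L0] = zip B fls.
    by apply: zipE => // k kf; rewrite (nth_map 0%N) ?size_iota // nth_iota.
  exists B; split=> //; split.
    by move/(hitsE _ P1 L1 P1E uy): Pu1; rewrite /= BE uz.
  by rewrite -BE => /(hitsE _ P0 L0 P0E uy).
pose u (v : names) : M := match v with
  | inl o => ocons z y o
  | inr (inl k) => if (k < size fls)%N then nth 0 B k else z
  | inr (inr i) => z end.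
have uy : u \o inl \o Some = y by [].
have BE : [seq (u vf.1, vf.2) | vf <- L0] = zip B fls.
  by apply: zipE => // k kf; rewrite /u kf.
exists u; split.
  case=> [[i|]|[k|i]] //=; case: ifP => // kf []; apply/inbs; by exists k.
split; first by apply/(hitsE _ P1 L1 P1E uy); rewrite /= BE.
by move/(hitsE _ P0 L0 P0E uy); rewrite BE.
Qed.

(** If the requirements on [a1] were inconsistent, finitely many elements or cosets not algebraic
    over the class would hit all its members through finitely many polynomials; one of them would be
    essential, hence algebraic over the class. *)
Lemma acl_generic (K : gfield) (a : 'I_n -> K) :
  EE (str K) (spair a a) ->
  (forall x y z, EE (str K) (spair x y) -> EE (str K) (spair y z) -> EE (str K) (spair x z)) ->
  (forall x y, EE (str K) (spair x y) -> EE (str K) (spair y x)) ->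
  exists (K1 : gfield) (h : K -> K1) (a1 : 'I_n -> K1),
    [/\ elem_map h, EE (str K1) (spair a1 (h \o a)) &
        forall z fl q w, polyalg q a1 w -> near fl w (h z) -> aclX a fl z].
Proof.
move=> Eaa Etr Esy; pose X (x : 'I_n -> K) := EE (str K) (spair x a).
pose nr (x y : K * bool) := x.2 = y.2 /\ near x.2 x.1 y.1.
have nr_sym x y : nr x y -> nr y x by case=> e nxy; split=> //; rewrite -e; apply: near_sym.
have S_nr Th (x : 'I_n -> K) b w : algS Th x b -> nr b w -> algS Th x w.
  case=> q qT [v [qv vb]] [e bw]; exists q => //; exists v; split=> //.
  by rewrite -e; apply: near_trans bw.
have fin Th (x : 'I_n -> K) : exists l : seq (K * bool), forall b, algS Th x b ->
    exists2 b', b' \in l & nr b b'.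
  have [r rP] := choice (fun q => polyalg_root q x).
  exists [seq (w, fl) | w <- flatten (map r Th), fl <- [:: true; false]].
  move=> [b fl] [q qT [w [qw wb]]]; exists (w, fl); last by split=> //; apply: near_sym.
  have [w0 wr wE] := rP q K idfun w qw.
  apply/allpairsP; exists (w, fl); split=> //=; last by case: (fl).
  by apply: (flatten_In qT); rewrite wE.
have ess_acl Th z fl B : hits (@algS Th K) ((z, fl) :: B) X -> ~ hits (@algS Th K) B X ->
    aclX a fl z.
  move=> h1 h0; have [Q [dQ QE]] := definable_essential Th fl (unzip2 B).
  have [l lP] := @essential_finite _ _ nr (@algS Th K) nr_sym (S_nr Th) (size B) X (fun x (_ : X x) => fin Th x).
  exists Q; split=> //; exists [seq b.1 | b <- l]; split.
    apply/QE; exists (unzip1 B); rewrite zip_unzip; split=> //.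
    by rewrite !size_map.
  move=> y w Ey /QE[B' [sB' [h1' h0']]].
  (* Being essential depends on the class only, so one finite list serves all its members [y]. *)
  have Xy x : X x <-> EE (str K) (spair x y).
    by split=> Ex; [apply: Etr Ex (Esy _ _ Ey)|apply: Etr Ex Ey].
  have [|[w' fl'] b'l [/= e ww']] := lP (w, fl).
    exists (zip B' (unzip2 B)); split.
    - by rewrite size_zip sB' minnn size_map.
    - by move=> x /Xy; apply: h1'.
    - by move=> hB; apply: h0' => x /Xy; apply: hB.
  by exists w' => //; apply/mapP; exists (w', fl').
pose good (A : set ('I_n -> K)) := A = X \/ exists q z fl, ~ aclX a fl z /\
  A = [set x | ~ exists w, polyalg q x w /\ near fl w z].
have [s sF|U [UU FU]] := @ultra_extension ('I_n -> K) good.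
  have [Th [Zs [ZsP sP]]] : exists (Th : seq (seq (tm 'I_n))) (Zs : seq (K * bool)),
      (forall b, b \in Zs -> ~ aclX a b.2 b.1) /\
      forall x, X x -> (forall b, b \in Zs -> ~ algS Th x b) -> forall A, A \in s -> A x.
    elim: s sF => [|A s IHs] sF; first by exists [::], [::].
    have [|Th [Zs [ZsP sP]]] := IHs; first by move=> B Bs; apply: sF; rewrite inE Bs orbT.
    have [->|[q [z [fl [nz ->]]]]] := sF A (mem_head _ _).
      exists Th, Zs; split=> // x Xx nS B; rewrite inE => /predU1P[->|] //; exact: sP.
    exists (q :: Th), ((z, fl) :: Zs); split.
      by move=> b; rewrite inE => /predU1P[->|/ZsP].
    move=> x Xx nS B; rewrite inE => /predU1P[->|Bs].
      move=> [w ?]; apply: (nS (z, fl)); first exact: mem_head.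
      by exists q; [left|exists w].
    apply: sP => // b bZ [q' q'T Sb]; apply: (nS b); first by rewrite inE bZ orbT.
    by exists q' => //; right.
  have [x [Xx nS]] : exists x, X x /\ forall b, b \in Zs -> ~ algS Th x b.
    apply: contrapT => nx.
    have hZ : hits (@algS Th K) Zs X.
      move=> x Xx; apply: contrapT => nb; apply: nx; exists x; split=> // b bZ Sb.
      by apply: nb; exists b.
    have [r [[z fl] [zZ [B [_ h1 h0]]]]] := hits_essential (ex_intro _ a Eaa) hZ.
    by apply: (ZsP _ zZ); apply: ess_acl h1 h0.
  by exists x; apply: sP.
have [K1 [cls [UP los]]] := ultrapower_gfield K UU.
pose h (z : K) : K1 := cls (fun=> z); pose a1 i : K1 := cls (fun x => x i).
have hE : elem_map h.
  by move=> V P x dP; rewrite (los _ P (fun v _ => x v) dP) (ultra_const UU).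
exists K1, h, a1; split=> //.
  have := los _ EE (fun v x => spair x a v) dEE.
  rewrite (_ : (fun v => cls _) = spair a1 (h \o a)); last by apply/funext => -[].
  by move=> ->; apply: FU; left.
move=> z fl q w qw wz; apply: contrapT => nz.
have [P [dP PE]] := definable_polyalg_near [seq tren Some t | t <- q] fl (None : option 'I_n).
have Pw (M : gfield) (x : 'I_n -> M) v : P (str M) (ocons v x) <-> exists w, polyalg q x w /\ near fl w v.
  by rewrite PE; split=> -[w' [qw' nw']]; exists w'; move: qw'; rewrite polyalg_ren.
have := los _ P (fun v x => ocons z x v) dP.
rewrite (_ : (fun v => cls _) = ocons (h z) a1); last by apply/funext => -[].
rewrite Pw => -[/(_ (ex_intro _ w (conj qw wz))) UPz _].
have : U [set x | ~ exists w, polyalg q x w /\ near fl w z].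
  by apply: FU; right; exists q, z, fl.
by move/(ultra_not UU); apply; apply: (ultraS UU) UPz => x /Pw.
Qed.

End Algebraic.

(** * Coding the classes *)

Lemma definable_support (V : Type) (P : relation_on V) : definable P ->
  exists s : seq V, forall (M : structure LG) (x y : V -> M tt),
    (forall v, List.In v s -> x v = y v) -> P M x -> P M y.
Proof.
move=> [G [phi [r E]]].
have [s sP] : exists s, forall u (v : var G u), List.In (r u v) s.
  elim: G r {phi E} => [|u G IHG] r; first by exists [::]; apply: var_nilP.
  have [s sP] := IHG (ttail r); exists (r u VZ :: s).
  by apply: var_consP => [|u' v]; [left|right; apply: sP].
exists s => M x y xy; rewrite !E (_ : asg r x = asg r y) //.
apply: tup_ext => -[] v.
exact: xy.
Qed.

Lemma elem_map_valid (V : finType) (P : relation_on V) (K M : gfield) (f : K -> M) :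
  definable P -> elem_map f -> (forall u, P (str K) u) -> forall u, P (str M) u.
Proof.
move=> dP fE PK u.
have dA := definable_all_seq (enum V) dP.
have := (fE _ _ (fun=> 0) dA).1 (fun y _ => PK y); apply=> v.
by case; apply/In_mem; rewrite mem_enum.
Qed.

Definition equivalence_at n (EE : relation_on ('I_n + 'I_n)) (M : structure LG) :=
  [/\ forall x, EE M (spair x x), forall x y, EE M (spair x y) -> EE M (spair y x) &
      forall x y z, EE M (spair x y) -> EE M (spair y z) -> EE M (spair x z)].

Lemma equivalence_elem n (EE : relation_on ('I_n + 'I_n)) (K M : gfield) (f : K -> M) :
  definable EE -> elem_map f -> equivalence_at EE (str K) -> equivalence_at EE (str M).
Proof.
move=> dEE fE [er es et].
have re (W : Type) (g1 g2 : 'I_n -> W) :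
    definable (fun M (u : W -> M tt) => EE M (spair (u \o g1) (u \o g2))).
  apply: definable_ext (definable_rename (fun v => match v with inl i => g1 i | inr i => g2 i end) dEE).
  move=> N u; rewrite (_ : u \o _ = spair (u \o g1) (u \o g2)) //.
  by apply/funext => -[].
split=> [x|x y|x y z].
- exact: (elem_map_valid (re _ id id) fE er).
- have dS := definable_imp (re _ (inl : 'I_n -> 'I_n + 'I_n) inr) (re _ inr inl).
  by apply: (elem_map_valid dS fE _ (spair x y)) => u; apply: es.
- pose g1 i : 'I_n + ('I_n + 'I_n) := inl i; pose g2 i : 'I_n + ('I_n + 'I_n) := inr (inl i).
  pose g3 i : 'I_n + ('I_n + 'I_n) := inr (inr i).
  have dT := definable_imp (re _ g1 g2) (definable_imp (re _ g2 g3) (re _ g1 g3)).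
  by apply: (elem_map_valid dT fE _ (spair x (spair y z))) => u; apply: et.
Qed.

Definition env (T : zmodType) n (x : 'I_n -> T) (cs gs : seq T) : 'I_n + (nat + nat) -> T :=
  spair x (spair (nth 0 cs) (nth 0 gs)).

Section Core.
Variables (p : nat) (ACFG : theory LG).
Hypotheses (p_prime : prime p)
  (ACFG_companion : model_companion (ACF_subgroup_theory p) ACFG).
Local Notation acfg := (acfg ACFG).
Variables (n : nat) (EE : relation_on ('I_n + 'I_n)).
Arguments EE : clear implicits.
Hypothesis dEE : definable EE.

(* The class of [a] is definable over elements and cosets algebraic over it. *)
Definition weakly_coded (K : gfield) (a : 'I_n -> K) :=
  exists cs gs : seq K, [/\ forall c, c \in cs -> aclX EE a false c,
    forall g, g \in gs -> aclX EE a true g &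
    exists P : relation_on ('I_n + (nat + nat)), [/\ definable P, P (str K) (env a cs gs) &
      forall x gs', size gs' = size gs ->
        (forall k, near true (nth 0 gs' k) (nth 0 gs k)) ->
        P (str K) (env x cs gs') -> EE (str K) (spair x a)]].

(** The index set consists of the maps [K -> K], which are asked to preserve each true relation, to
    fix the algebraic elements and cosets, and to move the class of [a]. If finitely many of these
    conditions were incompatible, the relations involved, with their other parameters quantified
    away, would code the class. *)
Lemma not_coded_realization (K K1 : gfield) (h1 : K -> K1) (a : 'I_n -> K) :
  elem_map h1 -> ~ weakly_coded a ->
  exists (K2 : gfield) (h2 : K1 -> K2) (t : K -> K2),
    [/\ elem_map h2, elem_map t, ~ EE (str K2) (spair (t \o a) (h2 \o h1 \o a)) &
        forall z fl, aclX EE a fl z -> near fl (t z) (h2 (h1 z))].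
Proof.
move=> h1E nc.
pose good (A : set (K -> K)) :=
  [\/ exists P : relation_on K, [/\ definable P, P (str K) id & A = [set t : K -> K | P (str K) t]],
      exists z fl, aclX EE a fl z /\ A = [set t : K -> K | near fl (t z) z] |
      A = [set t : K -> K | ~ EE (str K) (spair (t \o a) a)]].
have [s sF|U [UU FU]] := @ultra_extension (K -> K) good.
  have [P0 [cs [gs [dP0 P0id csP [gsP sP]]]]] : exists (P0 : relation_on K) (cs gs : seq K),
      [/\ definable P0, P0 (str K) id, forall c, c \in cs -> aclX EE a false c &
      (forall g, g \in gs -> aclX EE a true g) /\
      forall t, P0 (str K) t -> (forall c, c \in cs -> t c = c) ->
        (forall g, g \in gs -> near true (t g) g) -> ~ EE (str K) (spair (t \o a) a) ->
        forall A, A \in s -> A t].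
    elim: s sF => [|A s IHs] sF.
      by exists (fun M x => True), [::], [::]; split=> //; apply: definable_true.
    have [|P0 [cs [gs [dP0 P0id csP [gsP sP]]]]] := IHs.
      by move=> B Bs; apply: sF; rewrite inE Bs orbT.
    have [[P [dP Pid ->]]|[z [[] [za ->]]]|->] := sF A (mem_head _ _).
    - exists (fun M x => P M x /\ P0 M x), cs, gs; split=> //; first exact: definable_and.
      split=> // t [Pt P0t] tc tg nE B; rewrite inE => /predU1P[->|] //; exact: sP.
    - exists P0, cs, (z :: gs); split=> //; split=> [g|t P0t tc tg nE B].
        by rewrite inE => /predU1P[->|/gsP].
      rewrite inE => /predU1P[->|Bs]; first by apply: tg; rewrite mem_head.
      by apply: sP => // g gg; apply: tg; rewrite inE gg orbT.
    - exists P0, (z :: cs), gs; split=> // [c|].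
        by rewrite inE => /predU1P[->|/csP].
      split=> // t P0t tc tg nE B; rewrite inE => /predU1P[->|Bs].
        by apply: (tc z); rewrite mem_head.
      by apply: sP => // c cc; apply: tc; rewrite inE cc orbT.
    - exists P0, cs, gs; split=> //; split=> // t P0t tc tg nE B.
      by rewrite inE => /predU1P[->|] //; apply: sP.
  pose W : Type := ('I_n + (nat + nat))%type.
  pose prs : seq (K * W) := [seq (a i, inl i) | i <- enum 'I_n] ++
    ([seq (nth 0 cs k, inr (inl k)) | k <- iota 0 (size cs)] ++
     [seq (nth 0 gs k, inr (inr k)) | k <- iota 0 (size gs)]).
  have prsP k w : List.In (k, w) prs <-> [\/ exists i, k = a i /\ w = inl i,
      exists m, [/\ (m < size cs)%N, k = nth 0 cs m & w = inr (inl m)] |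
      exists m, [/\ (m < size gs)%N, k = nth 0 gs m & w = inr (inr m)]].
    rewrite !In_cat !In_map; split=> [[[i _ [-> ->]]|[[m /In_mem + [-> ->]]|[m /In_mem + [-> ->]]]]|].
    - by constructor 1; exists i.
    - by rewrite mem_iota => mc; constructor 2; exists m.
    - by rewrite mem_iota => mc; constructor 3; exists m.
    - case=> [[i [-> ->]]|[m [mc -> ->]]|[m [mc -> ->]]].
      + by left; exists i => //; apply/In_mem; rewrite mem_enum.
      + by right; left; exists m => //; apply/In_mem; rewrite mem_iota.
      + by right; right; exists m => //; apply/In_mem; rewrite mem_iota.
  pose R (M : structure LG) (u : K + W -> M tt) := P0 M (u \o inl) /\
    foldr (fun kw (A : Prop) => u (inl kw.1) = u (inr kw.2) /\ A) True prs.
  have dR : definable R.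
    apply: definable_and; first exact: (definable_rename (inl : K -> K + W)).
    apply: (@definable_seq_all _ _ _ (fun (kw : K * W) M (u : K + W -> M tt) =>
      u (inl kw.1) = u (inr kw.2))) => kw.
    exact: (definable_eq (TVar (inl kw.1 : K + W)) (TVar (inr kw.2))).
  have foldE (u : K + W -> K) (l : seq (K * W)) :
      foldr (fun kw (A : Prop) => u (inl kw.1) = u (inr kw.2) /\ A) True l <->
      forall k w, List.In (k, w) l -> u (inl k) = u (inr w).
    elim: l => [|[k w] l IHl] /=; first by split.
    rewrite IHl; split=> [[e H] k' w' [[<- <-]|] //|H]; first exact: H.
    by split=> [|k' w' kl]; apply: H; [left|right].
  have [s0 s0P] := definable_support dP0.
  pose s1 : seq (K + W) := [seq inl k | k <- s0 ++ [seq kw.1 | kw <- prs]].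
  pose r (v : K + W) : W := match v with inl _ => inr (inl 0%N) | inr w => w end.
  have s1r w : ~ List.In (inr w) s1 by move=> /In_map[].
  pose P (M : structure LG) (x : W -> M tt) := exists y, (forall v, ~ List.In v s1 -> y v = (x \o r) v) /\ R M y.
  have dP : definable P.
    apply: (definable_rename r (P := fun M x => exists y, (forall v, ~ List.In v s1 -> y v = x v) /\ R M y)).
    exact: definable_ex_seq.
  have Pa : P (str K) (env a cs gs).
    pose y v := if pselect (List.In v s1) then spair id (env a cs gs) v else (env a cs gs \o r) v.
    have yr w : y (inr w) = env a cs gs w by rewrite /y; case: pselect => // /s1r.
    have yl k : List.In k (s0 ++ [seq kw.1 | kw <- prs]) -> y (inl k) = k.
      by move=> ks; rewrite /y; case: pselect => // -[]; apply/In_map; exists k.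
    exists y; split; first by move=> v nv; rewrite /y; case: pselect.
    split.
      apply: (s0P (str K) id); last exact: P0id.
      by move=> k ks /=; rewrite yl //; apply/In_cat; left.
    apply/foldE => k w kw; rewrite yr yl; last first.
      by apply/In_cat; right; apply/In_map; exists (k, w).
    by case/prsP: kw => [[i [-> ->]]|[m [_ -> ->]]|[m [_ -> ->]]].
  apply: contrapT => nt; apply: nc; exists cs, gs; split=> //.
  exists P; split=> // x gs' sgs' ngs' [y [yr [P0y /foldE yl]]].
  apply: contrapT => nE; apply: nt; exists (y \o inl) => A As.
  have yrE w : y (inr w) = env x cs gs' w by rewrite yr // => /s1r.
  apply: sP As => //.
  - move=> c cc; rewrite /= (yl c (inr (inl (index c cs)))) ?yrE /env /= ?nth_index //.
    by apply/prsP; constructor 2; exists (index c cs); rewrite index_mem nth_index.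
  - move=> g gg; rewrite [(_ \o _) _]/= (yl g (inr (inr (index g gs)))) ?yrE.
      by have := ngs' (index g gs); rewrite /env /= nth_index.
    by apply/prsP; constructor 3; exists (index g gs); rewrite index_mem nth_index.
  - rewrite (_ : (y \o inl) \o a = x) //; apply/funext => i /=.
    by rewrite (yl _ (inl i)) ?yrE //; apply/prsP; constructor 1; exists i.
(* The ultrapower of [K1] rather than of [K] is taken, so that the new embedding and the extension
   [K1] land in the same model. *)
have [K2 [cls [UP los]]] := ultrapower_gfield K1 UU.
pose h2 (z : K1) : K2 := cls (fun=> z); pose t z : K2 := cls (fun t => h1 (t z)).
have h2E : elem_map h2.
  by move=> V P x dP; rewrite (los _ P (fun v _ => x v) dP) (ultra_const UU).
exists K2, h2, t; split=> //.
- have tE V (P : relation_on V) x : definable P -> P (str K) x -> P (str K2) (t \o x).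
    move=> dP Px; apply/(los _ P (fun v t => h1 (t (x v))) dP).
    have : U [set t : K -> K | P (str K) (t \o x)].
      apply: FU; constructor 1; exists (fun M u => P M (u \o x)).
      by split=> //; apply: definable_rename.
    by apply: (ultraS UU) => t' /= /(h1E _ _ _ dP).
  move=> V P x dP; split; first exact: tE.
  move=> Ptx; apply: contrapT => nP.
  by have := tE _ _ x (definable_not dP) nP; apply.
- move=> E2.
  have : U [set t : K -> K | ~ EE (str K) (spair (t \o a) a)] by apply: FU; constructor 3.
  move/(ultra_not UU); apply.
  have := los _ EE (fun v t => h1 (spair (t \o a) a v)) dEE.
  rewrite (_ : (fun v => cls _) = spair (t \o a) (h2 \o h1 \o a)); last by apply/funext => -[].
  move=> -[/(_ E2) UE _]; apply: (ultraS UU) UE => t' /=.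
  by move=> /(h1E _ _ (spair (t' \o a) a) dEE).
- move=> z fl za; have [P [dP PE]] := definable_near fl true false.
  have := los _ P (fun (b : bool) t => if b then h1 (t z) else h1 z) dP.
  rewrite PE /= => ->.
  have [Q [dQ QE]] := definable_near fl true false.
  have : U [set t : K -> K | near fl (t z) z] by apply: FU; constructor 2; exists z, fl.
  apply: (ultraS UU) => t' tz; apply/PE.
  have := (h1E _ Q (fun b : bool => if b then t' z else z) dQ).1.
  by rewrite !QE /=; apply.
Qed.

End Core.

Lemma polyalg_closure (K : closedFieldType) n (a : 'I_n -> K) :
  exists (A : closedFieldType) (i : {rmorphism A -> K}),
    forall w, (exists q, polyalg q a w) <-> exists d, w = i d.
Proof.
have [R RP] : exists R : subringClosed K, forall x, x \in R <-> exists t, x = tev a t.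
  apply: build_subringClosed.
  - by exists (T1 _).
  - by move=> _ _ [t ->] [u ->]; exists (TAdd t (TOpp u)).
  - by move=> _ _ [t ->] [u ->]; exists (TMul t u).
have [A [i iP]] := alg_closure R; exists A, i => w; rewrite -iP.
split=> [[q [s0 [k kq k0]]]|[P [PR P0 Pw]]].
  exists (\poly_(m < size q) tev a (nth (T0 _) q m)); split.
  - apply/polyOverP => m; rewrite coef_poly; case: ifP => _; last exact: rpred0.
    by apply/RP; exists (nth (T0 _) q m).
  - by apply/eqP => /(congr1 (fun P : {poly K} => P`_k)); rewrite coef_poly kq coef0.
  - by rewrite horner_poly.
have wit m : exists t, P`_m = tev a t by apply/RP/(polyOverP PR).
have [t tP] := choice wit.
exists (mkseq t (size P)); rewrite /polyalg size_mkseq; split.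
  by rewrite -[RHS]Pw horner_coef; apply: eq_bigr => m _; rewrite nth_mkseq // tP.
exists (size P).-1; first by rewrite prednK ?size_poly_gt0.
rewrite nth_mkseq ?prednK ?size_poly_gt0 // -tP -lead_coefE.
by apply/eqP; rewrite lead_coef_eq0.
Qed.

(** The intersection of two closed subfields is closed: a root in [A] of a monic polynomial with
    coefficients in both is sent by [f] to a root of a polynomial over the closed field [B]. *)
Lemma preimage_subfield (A B L : closedFieldType) (f : {rmorphism A -> L}) (g : {rmorphism B -> L}) :
  exists (C : closedFieldType) (c : {rmorphism C -> A}) (d : {rmorphism C -> B}),
    (forall x, f (c x) = g (d x)) /\ forall a b, f a = g b -> exists x, a = c x.
Proof.
have [||||n c x n0 cP xE|C [c cP]] :=
    @build_closed_subfield A (fun a => exists b, f a = g b).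
- by exists 1; rewrite !rmorph1.
- by move=> x y [b fx] [b' fy]; exists (b - b'); rewrite !rmorphB fx fy.
- by move=> x y [b fx] [b' fy]; exists (b * b'); rewrite !rmorphM fx fy.
- by move=> x [b fx]; exists b^-1; rewrite !fmorphV fx.
- have [b bP] := choice cP.
  pose Q : {poly B} := 'X^n - \poly_(i < n) b i.
  apply: (@closed_root_image B L g Q).
    have sQ : (size (\poly_(i < n) b i) < size ('X^n : {poly B}))%N.
      by rewrite size_polyXn ltnS size_poly.
    by rewrite -lead_coef_eq0 lead_coefDl ?lead_coefXn ?oner_eq0 // size_polyN.
  rewrite (@horner_coef_wide _ n.+1); last first.
    rewrite size_map_poly (leq_trans (size_polyD _ _)) // geq_max size_polyXn leqnn size_polyN.
    by rewrite (leq_trans (size_poly _ _)).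
  rewrite big_ord_recr /= coef_map coefB coefXn eqxx coef_poly ltnn subr0 /= rmorph1 mul1r.
  rewrite -rmorphXn xE rmorph_sum -big_split big1 // => i _ /=.
  rewrite coef_map coefB coefXn coef_poly (ltn_ord i) ltn_eqF //= sub0r rmorphN rmorphM rmorphXn.
  by rewrite bP mulNr addNr.
have wit x : exists b, f (c x) = g b by apply/cP; exists x.
have [d0 d0P] := choice wit.
have [d dE] : exists d : {rmorphism C -> B}, forall x, d x = d0 x.
  apply: build_rmorphism => [|x y|x y]; apply: (fmorph_inj g).
  - by rewrite -d0P !rmorph1.
  - by rewrite rmorphB -!d0P !rmorphB.
  - by rewrite rmorphM -!d0P !rmorphM.
exists C, c, d; split=> [x|a b ab]; first by rewrite dE.
by apply/cP; exists b.
Qed.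

Section Coding.
Variables (p : nat) (ACFG : theory LG).
Hypotheses (p_prime : prime p)
  (ACFG_companion : model_companion (ACF_subgroup_theory p) ACFG).
Local Notation acfg := (acfg ACFG).
Variables (n : nat) (EE : relation_on ('I_n + 'I_n)).
Arguments EE : clear implicits.
Hypothesis dEE : definable EE.

Lemma elem_rmorphism (M N : gfield) (h : M -> N) : elem_map h ->
  exists g : {rmorphism M -> N}, h = g /\ gemb g.
Proof.
by move=> /elem_map_rmorphism[g [gh gG]]; exists g; split=> //; apply/funext => x; rewrite gh.
Qed.

Lemma coded (K : gfield) (a : 'I_n -> K) : acfg K -> equivalence_at EE (str K) ->
  weakly_coded EE a.
Proof.
move=> KA Keq; apply: contrapT => nc; have [Kr Ks Kt] := Keq.
have [K1 [h1f [a1 [h1E Ea1 a1acl]]]] := acl_generic dEE (Kr a) Kt Ks.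
have [K2 [h2f [tf [h2E tE nEt tacl]]]] := not_coded_realization dEE h1E nc.
have [h1 [h1e h1G]] := elem_rmorphism h1E; subst h1f.
have [h2 [h2e h2G]] := elem_rmorphism h2E; subst h2f.
have [tau [te tauG]] := elem_rmorphism tE; subst tf.
have K1A := elem_map_acfg h1E KA; have K2A := elem_map_acfg h2E K1A.
have K2eq : equivalence_at EE (str K2) := equivalence_elem dEE tE Keq.
have K1eq : equivalence_at EE (str K1) := equivalence_elem dEE h1E Keq.
have var_alg (F : closedFieldType) (y : 'I_n -> F) i : exists q, polyalg q y (y i).
  exists [:: TOpp (TVar i); T1 _]; split; last by exists 1%N => //=; apply/eqP/oner_neq0.
  by rewrite !big_ord_recl big_ord0 /= expr0 mulr1 expr1 mul1r addr0 addNr.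
have [A0 [i0 i0P]] := polyalg_closure a.
have [A1 [i1 i1P]] := polyalg_closure a1.
have [x0 x0P] := choice (fun i => (i0P (a i)).1 (var_alg _ a i)).
have [x1 x1P] := choice (fun i => (i1P (a1 i)).1 (var_alg _ a1 i)).
(* The elements of [C] lie in [K] and are field-algebraic over [a1], hence they are algebraic over
   the class and fixed by [tau]. *)
have [C [c0 [c1 [c01 Cmax]]]] := preimage_subfield (h1 \o i0) i1.
pose t0 : {rmorphism A0 -> K2} := h2 \o h1 \o i0.
pose t1 : {rmorphism A1 -> K2} := h2 \o i1.
have t01 x : t0 (c0 x) = t1 (c1 x) by rewrite /t0 /t1 /= -c01.
have tdis y y' : t0 y = t1 y' -> exists x, y = c0 x.
  by move=> /(@fmorph_inj _ _ h2) e; apply: (Cmax y y').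
pose c : {rmorphism C -> K2} := t0 \o c0.
have [R RP] := choice (@definable_rel K2 C c n).
pose Q (M : structure LG) (u : K2 + 'I_n -> M tt) :=
  EE M (u \o (fun v => match v with inl i => inr i | inr i => inl (t0 (x0 i)) end)).
have dQ : definable Q by apply: definable_rename.
have QE (M : gfield) (f : K2 -> M) y : Q (str M) (spair f y) = EE (str M) (spair y (f \o t0 \o x0)).
  by rewrite /Q; congr (EE _ _); apply/funext => -[].
(* The relations depend only on [K2] and on the embedding of [C], and the fibre only on the class.
   So the same [b] is minimal with respect to [a] and to [a1]. *)
have [N [jf [b [jE Qb min]]]] := minimal_realization (fun r => (RP r).1) dQ
  (eq_ind_r id (let: And3 r _ _ := K2eq in r _) (QE K2 id (t0 \o x0))).
have [j [je jG]] := elem_rmorphism jE; subst jf.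
have NA := elem_map_acfg jE K2A.
have Neq : equivalence_at EE (str N) := equivalence_elem dEE jE K2eq.
rewrite QE in Qb.
have min0 (N' : gfield) (j' : K2 -> N') (b' : 'I_n -> N') : elem_map j' ->
    EE (str N') (spair b' (j' \o t0 \o x0)) ->
    (forall r, rel_holds c (spair j' b') r -> rel_holds c (spair j b) r) ->
    (forall r, rel_holds c (spair j b) r -> rel_holds c (spair j' b') r).
  move=> j'E Eb' sub r /(RP r).2 Rr; apply/(RP r).2; apply: min Rr => //.
    by rewrite QE.
  by move=> r' /(RP r').2 /sub /(RP r').2.
have [ld0 _] := minimal_free p_prime ACFG_companion K2A NA jG dEE Qb min0.
have E10 : EE (str K2) (spair (t1 \o x1) (t0 \o x0)).
  have := (h2E _ _ _ dEE).1 Ea1; rewrite spair_comp.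
  congr (EE _ (spair _ _)); apply/funext => i /=; by rewrite ?x1P ?x0P.
have Qb1 : EE (str N) (spair b (j \o t1 \o x1)).
  have [_ Ns Nt] := Neq; apply: (Nt _ (j \o t0 \o x0)) => //; apply: Ns.
  by have := (jE _ _ _ dEE).1 E10; rewrite spair_comp.
have cE1 : (t1 \o c1 : C -> K2) = c by apply/funext => x; apply: esym (t01 x).
have min1 (N' : gfield) (j' : K2 -> N') (b' : 'I_n -> N') : elem_map j' ->
    EE (str N') (spair b' (j' \o t1 \o x1)) ->
    (forall r, rel_holds (t1 \o c1) (spair j' b') r -> rel_holds (t1 \o c1) (spair j b) r) ->
    (forall r, rel_holds (t1 \o c1) (spair j b) r -> rel_holds (t1 \o c1) (spair j' b') r).
  rewrite cE1 => j'E Eb'; apply: min0 => //.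
  have [_ _ N't] := equivalence_elem dEE j'E K2eq.
  apply: N't Eb' _; by have := (j'E _ _ _ dEE).1 E10; rewrite spair_comp.
have [ld1 cos1] := minimal_free p_prime ACFG_companion K2A NA jG dEE Qb1 min1.
have ldc : lin_disjoint (t0 \o c0) j b := free_intersection t01 tdis ld0 ld1.

pose io : {rmorphism A0 -> N} := j \o t0.
have [Rc RcP] := lc_ring (io \o c0) b.
have [Ra RaP] := lc_ring io b.
have [D [jD DP]] := alg_closure Ra.
have LD r (k : 'I_r -> A0) : ind c0 k -> forall d : 'I_r -> seq (C * tm 'I_n),
    \sum_m io (k m) * lc (io \o c0) b (d m) = 0 -> forall m, lc (io \o c0) b (d m) = 0.
  move=> ki d; apply: (ldc r (t0 \o k) d) => x x0E; apply: ki.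
  apply: (fmorph_inj t0); rewrite rmorph0 -[RHS]x0E rmorph_sum.
  by apply: eq_bigr => m _; rewrite rmorphM.
have inD w : w \in Ra -> exists d, w = jD d.
  move=> wR; apply/DP; exists ('X - w%:P); split.
  - by rewrite rpredB ?polyOverX ?polyOverC.
  - by rewrite polyXsubC_eq0.
  - by rewrite hornerXsubC subrr.
have ioR y : io y \in Ra by apply: io_Ra RaP y.
have bR m : b m \in Rc by apply: b_Rc RcP m.
have [i' i'P] := choice (fun y => inD _ (ioR y)).
have [i iE] : exists i : {rmorphism A0 -> D}, forall y, i y = i' y.
  apply: build_rmorphism => [|y z|y z]; apply: (fmorph_inj jD).
  - by rewrite -i'P !rmorph1.
  - by rewrite rmorphB -!i'P rmorphB.
  - by rewrite rmorphM -!i'P rmorphM.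
have jDi y : jD (i y) = io y by rewrite iE -i'P.
have [bD bDP] := choice (fun m => inD _ (Rc_Ra RcP RaP (bR m))).
have free := free_maps_alg RcP RaP LD DP jDi.
have [GD GDP] : exists GD : zmodClosed D, forall y, y \in GD <-> jD y \in gsub N.
  apply: build_zmodClosed; first by rewrite rmorph0 rpred0.
  by move=> y z yG zG; rewrite rmorphB rpredB.
pose Dg := Gfield GD.

(* The twist concerns the cosets meeting [A1]. By [cos1] they include every coset of [K2] that
   contains an element algebraic over [C] and [b]; those which also meet [A0] are fixed by [tau]. *)
pose Gam (x : N) := exists y, near true x (j (t1 y)).
have Gam0 : Gam 0 by exists 0; rewrite /= !rmorph0 subrr rpred0.
have GamB x y : Gam x -> Gam y -> Gam (x - y).
  move=> [u xu] [v yv]; exists (u - v); rewrite /near (rmorphB t1) (rmorphB j).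
  have -> : x - y - (j (t1 u) - j (t1 v)) = (x - j (t1 u)) - (y - j (t1 v)) by ring.
  exact: rpredB.
have [Ot [g1 [g2 [g1G g2G g12 gdis gGam]]]] :=
  @twisted_amalgam N C (io \o c0) Gam Gam0 GamB.
have [Nt [q [NtA qG]]] := embeds_in_acfg p_prime ACFG_companion g1 NA.
have qg1E := elem_acfg ACFG_companion (h := q \o g1) NA NtA (gemb_comp g1G qG).
have Nteq : equivalence_at EE (str Nt) := equivalence_elem dEE qg1E Neq.
(* To be used with the inclusion [io] and with the map induced by [tau]. One realization of [b],
   independent over [f] in the first copy and [io] in the second, links the two images of [x0]. *)
have copy (f : {rmorphism A0 -> N}) :
    (forall y, f y \in gsub N <-> i0 y \in gsub K) -> (forall x, f (c0 x) = io (c0 x)) ->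
    (forall y, Gam (io y) -> near true (f y) (io y)) ->
    EE (str Nt) (spair (q \o g1 \o f \o x0) (q \o g2 \o io \o x0)).
  move=> fG fc fGam.
  pose s1 : {rmorphism A0 -> Nt} := q \o g1 \o f.
  pose s2 : {rmorphism A0 -> Nt} := q \o g2 \o io.
  have ioG y : io y \in gsub N <-> i0 y \in gsub K by rewrite /io /t0 /= jG h2G h1G.
  have [|||||||O [h [u1 [u2 [hG u1G u2G [u1i u2i u12]]]]]] :=
    @independent_amalgam A0 Nt Dg i _ _ s1 s2 free.
  - by exists 0; rewrite rmorph0.
  - by move=> _ _ [y ->] [z ->]; exists (y - z); rewrite rmorphB.
  - by move=> y; rewrite /s1 /= qG g1G fG GDP jDi ioG.
  - by move=> y; rewrite /s2 /= qG g2G GDP jDi.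
  - move=> y z /(@fmorph_inj _ _ q) /gdis[x [fx zx]].
    have zE : z = c0 x by apply: (fmorph_inj io).
    have yE : y = c0 x by apply: (fmorph_inj f); rewrite fx fc.
    by split; [rewrite yE zE|exists x].
  - by move=> _ [x ->]; rewrite /s1 /s2 /= fc (g12 x).
  (* Since [y] is congruent to an element algebraic over [C[b]], its coset meets [A1]. This coset is
     preserved by [f], and the twist makes its two copies congruent. *)
  - move=> y z [P [PR P0 Pz]] /GDP; rewrite rmorphB jDi => yz.
    have wit m : exists l, P`_m = lc (io \o c0) b l by apply/RcP/(polyOverP PR).
    have [l lP] := choice wit.
    have lE m : tev (spair j b) (lct (lmap (t1 \o c1) (l m))) = P`_m.
      by rewrite tev_lct (lc_lmap (t1 \o c1)) lP; apply: lc_eq => x; exact: (congr1 j (esym (t01 x))).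
    have qz : polyalg [seq lct (lmap (t1 \o c1) l) | l <- mkseq l (size P)] (spair j b) (jD z).
      have nE m : (m < size P)%N ->
          tev (spair j b) (nth (T0 _) [seq lct (lmap (t1 \o c1) l) | l <- mkseq l (size P)] m) = P`_m.
        by move=> mP; rewrite (nth_map [::]) ?size_mkseq // nth_mkseq // lE.
      rewrite /polyalg size_map size_mkseq; split.
        by rewrite -[RHS]Pz horner_coef; apply: eq_bigr => m _; rewrite nE.
      exists (size P).-1; first by rewrite prednK ?size_poly_gt0.
      rewrite nE ?prednK ?size_poly_gt0 // -lead_coefE.
      by apply/eqP; rewrite lead_coef_eq0.
    have [|y' yy'] := cos1 _ (t0 y) (jD z) qz; first exact: near_sym.
    have Gy : Gam (io y) by exists y'; apply/(near_map true _ _ jG).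
    rewrite /s1 /s2 /= -rmorphB qG.
    have -> : g1 (f y) - g2 (io y) = g1 (f y - io y) - (g2 (io y) - g1 (io y)).
      by rewrite rmorphB; ring.
    by rewrite rpredB ?gGam // g1G; apply: fGam.
  have [N3 [e [N3A eG]]] := embeds_in_acfg p_prime ACFG_companion h NtA.
  have ehE := elem_acfg ACFG_companion (h := e \o h) NtA N3A (gemb_comp hG eG).
  have N3eq : equivalence_at EE (str N3) := equivalence_elem dEE ehE Nteq.
  (* [D] receives the same subgroup through [jD] and through [u], so the equivalence of [b] with
     [x0] carries over to the images. *)
  have trans (u : {rmorphism D -> O}) (s : {rmorphism A0 -> Nt}) :
      (forall y : D, u y \in gsub O <-> y \in GD) -> (forall y, u (i y) = h (s y)) ->
      EE (str N3) (spair (e \o u \o bD) (e \o h \o s \o x0)).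
    move=> uG ui.
    have := (types_over_closed p_prime ACFG_companion (t := jD) (i := e \o u) NA N3A _
      (spair bD (i \o x0)) dEE).1.
    rewrite !spair_comp.
    rewrite (_ : jD \o bD = b); last by apply/funext => m /=; rewrite -bDP.
    rewrite (_ : jD \o (i \o x0) = j \o t0 \o x0); last by apply/funext => m /=; rewrite jDi.
    rewrite (_ : (e \o u) \o (i \o x0) = e \o h \o s \o x0); last first.
      by apply/funext => m /=; rewrite ui.
    by apply=> // y; rewrite /= eG uG GDP.
  have T1 := trans u1 s1 u1G u1i; have T2 := trans u2 s2 u2G u2i.
  have bE : e \o u1 \o bD = e \o u2 \o bD.
    apply/funext => m /=; rewrite u12 //= -bDP; exists ('X - (b m)%:P); split.
    - by rewrite rpredB ?polyOverX ?polyOverC.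
    - by rewrite polyXsubC_eq0.
    - by rewrite hornerXsubC subrr.
  have [_ N3s N3t] := N3eq.
  apply/(ehE _ _ _ dEE); rewrite spair_comp; apply: N3t T2; rewrite -bE; exact: N3s.
have near_Gam y : Gam (io y) -> aclX EE a true (i0 y).
  move=> [y' /(near_map true _ _ jG) /(near_map true _ _ h2G) yy'].
  have [_ /(_ (ex_intro _ y' erefl))[q' q'y]] := i1P (i1 y').
  by apply: a1acl q'y _; apply: near_sym.
(* The images of [a] and of [tau a] in the first copy are both equivalent to the image of [a] in the
   second. *)
have E1 := copy io _ (fun _ => erefl) (fun y _ => near_refl true (io y)).
have E2 := copy (j \o tau \o i0).
have [_ Nts Ntt] := Nteq.
apply: nEt; apply/(jE _ _ _ dEE)/(qg1E _ _ _ dEE); rewrite !spair_comp.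
have -> : (q \o g1) \o (j \o (tau \o a)) = q \o g1 \o (j \o tau \o i0) \o x0.
  by apply/funext => m /=; rewrite x0P.
have -> : (q \o g1) \o (j \o (h2 \o h1 \o a)) = q \o g1 \o io \o x0.
  by apply/funext => m /=; rewrite x0P.
apply: Ntt (E2 _ _ _) _.
- by move=> y; rewrite /= jG tauG.
- move=> x; rewrite /=; congr (j _).
  have [_ /(_ (ex_intro _ (c1 x) erefl))[q' q'x]] := i1P (i1 (c1 x)).
  by apply: (tacl _ false); apply: (a1acl _ _ _ _ q'x); rewrite /= -c01.
- by move=> y /near_Gam ya; apply/(near_map true _ _ jG)/tacl.
- by apply/Nts/E1 => y; rewrite /io /t0 /= jG h2G h1G.
Qed.

End Coding.

(** * Passage to imaginary sorts *)

Section DefinableSets.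
Variables (L : language) (Q : structure L).

(** Definability in the single structure [Q], as opposed to the uniform [definable]; the closure
    rules below spare most explicit formulas. *)
Definition dset (Gam : seq (sort L)) (P : tup Q Gam -> Prop) :=
  exists phi : formula Gam, forall a, sat phi a <-> P a.

Lemma dset_ext Gam (P P' : tup Q Gam -> Prop) : (forall a, P a <-> P' a) -> dset P -> dset P'.
Proof. by move=> PP' [phi phiE]; exists phi => a; rewrite phiE PP'. Qed.

Lemma dset_imp Gam (P P' : tup Q Gam -> Prop) :
  dset P -> dset P' -> dset (fun a => P a -> P' a).
Proof.
by move=> [phi phiE] [psi psiE]; exists (FImp phi psi) => a /=; rewrite phiE psiE.
Qed.

Lemma dset_not Gam (P : tup Q Gam -> Prop) : dset P -> dset (fun a => ~ P a).
Proof. by move=> dP; apply: dset_imp => //; exists (FBot Gam). Qed.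

Lemma dset_true Gam : dset (fun _ : tup Q Gam => True).
Proof. by exists (FImp (FBot Gam) (FBot Gam)) => a; split=> // _ []. Qed.

Lemma dset_and Gam (P P' : tup Q Gam -> Prop) :
  dset P -> dset P' -> dset (fun a => P a /\ P' a).
Proof.
move=> dP dP'; apply: dset_ext (dset_not (dset_imp dP (dset_not dP'))) => a.
split=> [H|[p p'] H]; last exact: H.
by split; apply: contrapT => n; apply: H.
Qed.

Lemma dset_all Gam s (P : tup Q (s :: Gam) -> Prop) :
  dset P -> dset (fun a => forall x : Q s, P (tcons x a)).
Proof.
by move=> [phi phiE]; exists (FAll phi) => a; split=> H x; apply/phiE/H.
Qed.

Lemma dset_ex Gam s (P : tup Q (s :: Gam) -> Prop) :
  dset P -> dset (fun a => exists x : Q s, P (tcons x a)).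
Proof.
move=> dP; apply: dset_ext (dset_not (dset_all (dset_not dP))) => a.
split=> [H|[x Px] /(_ x)] //.
by apply: contrapT => n; apply: H => x Px; apply: n; exists x.
Qed.

Lemma dset_ord n Gam (P : 'I_n -> tup Q Gam -> Prop) :
  (forall i, dset (P i)) -> dset (fun a => forall i, P i a).
Proof.
elim: n P => [|n IHn] P dP.
  by apply: dset_ext (dset_true Gam) => a; split=> // _ [].
apply: dset_ext (dset_and (dP ord0) (IHn _ (fun i => dP (lift ord0 i)))) => a.
split=> [[P0 PS] i|H]; last by split.
by case: (unliftP ord0 i) => [i'|] ->.
Qed.

Lemma dset_rename Gam Del (r : tup (var Del) Gam) (P : tup Q Gam -> Prop) :
  dset P -> dset (fun a : tup Q Del => P (trename r a)).
Proof.
by move=> [phi phiE]; exists (rn_formula phi r) => a; rewrite sat_rn phiE.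
Qed.

Lemma dset_exblock D Gam (P : tup Q (D ++ Gam) -> Prop) :
  dset P -> dset (fun a => exists d : tup Q D, P (tcat d a)).
Proof.
elim: D P => [|s D IHD] P dP.
  apply: dset_ext dP => a; split=> [Pa|[d]] //; by exists (@tnil _ Q).
apply: dset_ext (IHD _ (dset_ex dP)) => a; split=> [[d [x Px]]|[d Pd]].
  by exists (tcons x d).
by exists (ttail d), (d s VZ).
Qed.

Fixpoint ftup (s : sort L) n : ('I_n -> Q s) -> tup Q (nseq n s) :=
  match n return ('I_n -> Q s) -> tup Q (nseq n s) with
  | 0 => fun _ => (@tnil _ Q : tup Q [::])
  | n'.+1 => fun x => (tcons (x ord0) (ftup (fun i => x (lift ord0 i))) : tup Q (s :: nseq n' s))
  end.

Lemma ftup_surj s n (d : tup Q (nseq n s)) : exists x : 'I_n -> Q s, d = ftup x.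
Proof.
elim: n d => [|n IHn] d.
  have x0 (i : 'I_0) : Q s by case: i.
  by exists x0; apply: tup_nil.
have [x xE] := IHn (ttail d).
exists (fun i => if unlift ord0 i is Some j then x j else d s VZ).
rewrite /= unlift_none [LHS]tcons_eta xE; congr (tcons _ (ftup _)).
by apply/funext => i; rewrite liftK.
Qed.

Lemma dset_exfun s n Gam (P : tup Q (nseq n s ++ Gam) -> Prop) :
  dset P -> dset (fun a => exists x : 'I_n -> Q s, P (tcat (ftup x) a)).
Proof.
move=> dP; apply: dset_ext (dset_exblock dP) => a; split=> [[d Pd]|[x Px]].
  by have [x dE] := ftup_surj d; exists x; rewrite -dE.
by exists (ftup x).
Qed.

Lemma bvar_exists s n Gam : exists bv : 'I_n -> var (nseq n s ++ Gam) s,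
  forall (x : 'I_n -> Q s) (a : tup Q Gam) i, (tcat (ftup x) a : tup Q _) s (bv i) = x i.
Proof.
elim: n => [|n [bv bvE]].
  have b0 (i : 'I_0) : var (nseq 0 s ++ Gam) s by case: i.
  by exists b0 => x a [].
exists (fun i => if unlift ord0 i is Some j then (VS (bv j) : var (s :: nseq n s ++ Gam) s)
  else (VZ : var (s :: nseq n s ++ Gam) s)) => x a i.
by case: unliftP => [j|] -> //=; apply: bvE.
Qed.

Lemma tcat_vinr D Gam (d : tup Q D) (a : tup Q Gam) s (v : var Gam s) :
  (tcat d a : tup Q _) s (vinr D v) = a s v.
Proof. exact: (congr1 (fun f : tup Q Gam => f s v) (trename_inr d a)). Qed.

Lemma entries_ftup s n Gam (x : 'I_n -> Q s) (a : tup Q Gam) u :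
  entries (tcat (ftup x) a) u -> (exists i, u = el (x i)) \/ entries a u.
Proof.
elim: n x => [|n IHn] x; first by right.
case=> s' [v uE].
have H : forall s' (v : var (s :: nseq n s ++ Gam) s'),
    u = el ((tcons (x ord0) (tcat (ftup (fun i => x (lift ord0 i))) a) : tup Q (s :: _)) s' v) ->
    (exists i, u = el (x i)) \/ entries a u.
  apply: var_consP => [->|s1 v1 u1]; first by left; exists ord0.
  have [|[i ->]|] := IHn (fun i => x (lift ord0 i)); last by right.
    by exists s1, v1.
  by left; exists (lift ord0 i).
exact: H uE.
Qed.

End DefinableSets.

(** * Codes in a structure that interprets the field *)

Section Codes.
Variables (M : gfield) (L : language) (Q : structure L) (kf : unit -> sort L) (q s0 : sort L).
Local Notation kp := (kf tt).
Variables (rK : Q kp -> M) (iK : M -> Q kp) (pq : M -> Q q).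
Hypotheses (iKK : cancel iK rK) (rKK : cancel rK iK).
Hypothesis pqE : forall x y, pq x = pq y <-> x - y \in gsub M.

(** [Q] will be the imaginary structure of [(K,G)] or of [(K,K/G)], with a sort identified with the
    field by [rK] and [iK]; the proofs serve both cases. *)
Definition unmap (G : seq unit) (a : tup Q (map kf G)) : tup (str M) G :=
  fun s => match s with tt => fun v => rK (a kp (var_map kf v)) end.

Hypothesis LG_dset : forall (G : seq unit) (phi : @formula LG G),
  dset (fun a : tup Q (map kf G) => sat phi (unmap a)).
Hypothesis pq_dset : forall Gam (xv : var Gam kp) (gv : var Gam q),
  dset (fun a : tup Q Gam => pq (rK (a kp xv)) = a q gv).

Variables (n : nat) (pr : ('I_n -> M) -> Q s0) (EE : relation_on ('I_n + 'I_n)).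
Hypothesis pr_dset : forall Gam (xv : 'I_n -> var Gam kp) (zv : var Gam s0),
  dset (fun a : tup Q Gam => pr (fun i => rK (a kp (xv i))) = a s0 zv).
Hypothesis prE : forall x y, @EE (str M) (spair x y) <-> pr x = pr y.

Lemma definable_dset V (P : relation_on V) Gam (vn : V -> var Gam kp) : definable P ->
  dset (fun a : tup Q Gam => @P (str M) (fun v => rK (a kp (vn v)))).
Proof.
move=> [G [phi [r E]]].
have [rn rnE] : exists rn : tup (var Gam) (map kf G),
    forall v : var G tt, rn kp (var_map kf v) = vn (r tt v).
  elim: G r {phi E} => [|[] G IHG] r.
    by exists tnil => v; case: (var_nilP (fun _ _ => False) v).
  have [rn rnE] := IHG (ttail r).
  exists (@tcons _ (var Gam) kp (map kf G) (vn (r tt VZ)) rn).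
  have H : forall s (v : var (tt :: G) s), match s return var (tt :: G) s -> Prop with tt => fun v =>
    @tcons _ (var Gam) kp (map kf G) (vn (r tt VZ)) rn kp (var_map kf v) = vn (r tt v) end v.
    by apply: var_consP => // -[] v; apply: rnE.
  exact: (H tt).
apply: dset_ext (dset_rename rn (LG_dset phi)) => a; rewrite E.
rewrite (_ : unmap _ = @asg (str M) V G r (fun v => rK (a kp (vn v)))) //.
apply: tup_ext => -[] v.
by rewrite /unmap /trename rnE.
Qed.

(** The finite list in [aclX] is valid for every member of the class, so the member can be
    quantified under the condition that [pr] sends it to the given code. *)
Lemma acl_code_elem (a : 'I_n -> M) c : aclX EE a false c ->
  acl [set el (pr a)] (el (iK c)).
Proof.
move=> [P [dP [l [Pc lP]]]].
have [bv bvE] := bvar_exists Q kp n [:: kp; s0].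
pose vn (o : option 'I_n) : var (nseq n kp ++ [:: kp; s0]) kp :=
  if o is Some i then bv i else vinr _ VZ.
have dF := dset_exfun (dset_and (pr_dset bv (vinr (nseq n kp) (VS VZ : var [:: kp; s0] s0)))
  (definable_dset vn dP)).
have [phi phiE] := dF.
have satE z : sat phi (tcons z (tcons (pr a) (@tnil _ Q))) <->
    exists x : 'I_n -> M, pr x = pr a /\ P (str M) (ocons (rK z) x).
  rewrite phiE; split=> [[x]|[x [xa Px]]].
    rewrite tcat_vinr => -[xa Px]; exists (fun i => rK (x i)); split.
      by rewrite -[RHS]xa; congr pr; apply/funext => i; rewrite bvE.
    move: Px; congr (P _ _); apply/funext => -[i|] /=; first by rewrite bvE.
    by rewrite tcat_vinr.
  exists (fun i => iK (x i)); rewrite tcat_vinr; split.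
    by rewrite -[RHS]xa; congr pr; apply/funext => i; rewrite bvE iKK.
  move: Px; congr (P _ _); apply/funext => -[i|] /=; first by rewrite bvE iKK.
  by rewrite tcat_vinr.
exists [:: s0], (tcons (pr a) (@tnil _ Q)), phi; split.
- move=> u [s [v ->]]; move: s v; apply: var_consP => // s v.
  by case: (var_nilP (fun _ _ => False) v).
- by apply/satE; exists a; rewrite iKK.
- apply: (sub_finite_set _ (finite_image iK (finite_seq l))).
  move=> z /satE[x [xa Px]] /=.
  have [|w wl /= zw] := lP x (rK z) _ Px; first exact/prE.
  by exists w; rewrite // -zw rKK.
Qed.

Lemma acl_code_coset (a : 'I_n -> M) g : aclX EE a true g ->
  acl [set el (pr a)] (el (pq g)).
Proof.
move=> [P [dP [l [Pg lP]]]].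
have [bv bvE] := bvar_exists Q kp n [:: kp; q; s0].
pose vn (o : option 'I_n) : var (nseq n kp ++ [:: kp; q; s0]) kp :=
  if o is Some i then bv i else vinr _ VZ.
have dF := dset_ex (dset_exfun (dset_and (pr_dset bv (vinr (nseq n kp) (VS (VS VZ) : var [:: kp; q; s0] s0)))
  (dset_and (pq_dset (vinr (nseq n kp) (VZ : var [:: kp; q; s0] kp)) (vinr (nseq n kp) (VS VZ)))
  (definable_dset vn dP)))).
have [phi phiE] := dF.
have satE z : sat phi (tcons z (tcons (pr a) (@tnil _ Q))) <->
    exists (w : M) (x : 'I_n -> M), [/\ pr x = pr a, pq w = z & P (str M) (ocons w x)].
  rewrite phiE; split=> [[w [x]]|[w [x [xa wz Px]]]].
    rewrite !tcat_vinr => -[xa [wz Px]]; exists (rK w), (fun i => rK (x i)); split=> //.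
      by rewrite -[RHS]xa; congr pr; apply/funext => i; rewrite bvE.
    move: Px; congr (P _ _); apply/funext => -[i|] /=; first by rewrite bvE.
    by rewrite tcat_vinr.
  exists (iK w), (fun i => iK (x i)); rewrite !tcat_vinr; split.
    by rewrite -[RHS]xa; congr pr; apply/funext => i; rewrite bvE iKK.
  split; first by rewrite /= iKK.
  move: Px; congr (P _ _); apply/funext => -[i|] /=; first by rewrite bvE iKK.
  by rewrite tcat_vinr /= iKK.
exists [:: s0], (tcons (pr a) (@tnil _ Q)), phi; split.
- move=> u [s [v ->]]; move: s v; apply: var_consP => // s v.
  by case: (var_nilP (fun _ _ => False) v).
- by apply/satE; exists g, a.
- apply: (sub_finite_set _ (finite_image pq (finite_seq l))).
  move=> z /satE[w [x [xa <- Px]]] /=.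
  have [|w' wl /= ww'] := lP x w _ Px; first exact/prE.
  by exists w' => //; apply/esym/pqE.
Qed.

(** The code is the only value [pr x] such that [x], together with some representatives of the
    cosets, satisfies the relation of [weakly_coded]. That relation characterizes the class for all
    choices of representatives, so the cosets suffice as parameters. *)
Lemma codes (a : 'I_n -> M) : weakly_coded EE a -> exists cs gs : seq M,
  let S : set (elem Q) := [set u | exists2 c, c \in cs & u = el (iK c)] `|`
    [set u | exists2 g, g \in gs & u = el (pq g)] in
  S `<=` acl [set el (pr a)] /\ dcl S (el (pr a)).
Proof.
move=> [cs0 [gs [csP gsP [P [dP Pa PE]]]]].
(* [env] gives the value 0 to all names beyond the lists; the added parameter 0 interprets them, and
   it is algebraic over any class. *)
pose cs := rcons cs0 0; exists cs, gs => S.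
have csE k : nth 0 cs k = nth 0 cs0 k.
  rewrite nth_rcons; case: ltngtP => // [kc|->]; last by rewrite nth_default.
  by rewrite nth_default // ltnW.
split.
  move=> u [[c cc ->]|[g gg ->]]; last exact/acl_code_coset/gsP.
  apply: acl_code_elem; move: cc; rewrite mem_rcons inE => /predU1P[->|/csP //].
  have [P0 [dP0 P0E]] := definable_teq (TVar None) (T0 (option 'I_n)).
  exists P0; split=> //; exists [:: 0]; split; first by apply/P0E.
  by move=> y w _ /P0E /= ->; exists 0; rewrite ?mem_head.
set m := size cs; set r := size gs.
pose Gam := nseq m kp ++ (nseq r q ++ [::]).
pose cv (k : 'I_m) := iK (nth 0 cs k).
pose gv (k : 'I_r) := pq (nth 0 gs k).
pose par : tup Q Gam := tcat (ftup cv) (tcat (ftup gv) (@tnil _ Q)).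
pose Del := nseq n kp ++ (nseq r kp ++ (s0 :: Gam)).
have [bx bxE] := bvar_exists Q kp n (nseq r kp ++ (s0 :: Gam)).
have [bg bgE] := bvar_exists Q kp r (s0 :: Gam).
have [bc bcE] := bvar_exists Q kp m (nseq r q ++ [::]).
have [bq bqE] := bvar_exists Q q r [::].
pose up s (v : var (s0 :: Gam) s) : var Del s := vinr (nseq n kp) (vinr (nseq r kp) v).
have [lc lcE] : exists i : 'I_m, nth 0 cs i = 0.
  have cm : (size cs0 < m)%N by rewrite /m size_rcons.
  by exists (Ordinal cm); rewrite /cs nth_rcons ltnn eqxx.
pose vn (v : 'I_n + (nat + nat)) : var Del kp :=
  match v with
  | inl i => bx i
  | inr (inl k) => up _ (VS (bc (odflt lc (insub k))))
  | inr (inr k) => if insub k is Some k' then vinr (nseq n kp) (bg k') else up _ (VS (bc lc))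
  end.
have dF := dset_exfun (dset_exfun (dset_and (pr_dset bx (up _ VZ)) (dset_and
  (dset_ord (fun k : 'I_r => pq_dset (vinr (nseq n kp) (bg k)) (up _ (VS (vinr _ (bq k))))))
  (definable_dset vn dP)))).
have [phi phiE] := dF.
have envP (x : 'I_n -> Q kp) (g : 'I_r -> Q kp) z :
    (fun v => rK ((tcat (ftup x) (tcat (ftup g) (tcons z par)) : tup Q Del) kp (vn v))) =
    env (fun i => rK (x i)) cs0 [seq rK (g k) | k <- enum 'I_r].
  apply/funext => -[i|[k|k]] /=; first by rewrite bxE.
    rewrite /up !tcat_vinr /= /par bcE /cv iKK -csE.
    have [km|mk] := ltnP k m; first by rewrite insubT.
    by rewrite insubF ?ltnNge ?mk //= lcE nth_default.
  have [kr|rk] := ltnP k r.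
    rewrite insubT /= tcat_vinr bgE (nth_map (Ordinal kr)) ?size_enum_ord //.
    by congr (rK (g _)); apply: val_inj; rewrite /= nth_enum_ord.
  rewrite insubF ?ltnNge ?rk //= /up !tcat_vinr /= /par bcE /cv iKK lcE nth_default //.
  by rewrite size_map size_enum_ord.
have satE z : sat phi (tcons z par) <-> exists (g : 'I_r -> M) (x : 'I_n -> M),
    [/\ pr x = z, forall k, pq (g k) = gv k &
        P (str M) (env x cs0 [seq g k | k <- enum 'I_r])].
  rewrite phiE; split=> [[g [x]]|[g [x [xz gE Px]]]].
    rewrite envP => -[xz [gE Px]]; exists (fun k => rK (g k)), (fun i => rK (x i)); split=> //.
      move: xz; rewrite /up !tcat_vinr /= => <-.
      by congr pr; apply/funext => i; rewrite bxE.
    by move=> k; have := gE k; rewrite /up !tcat_vinr bgE /= /par tcat_vinr bqE.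
  exists (fun k => iK (g k)), (fun i => iK (x i)); rewrite envP; split.
    rewrite /up !tcat_vinr -[RHS]xz.
    by congr pr; apply/funext => i; rewrite bxE iKK.
  split; first by move=> k; rewrite /up !tcat_vinr bgE /= /par tcat_vinr bqE iKK.
  have -> : (fun i => rK (iK (x i))) = x by apply/funext => i; rewrite iKK.
  have -> // : [seq rK (iK (g k)) | k <- enum 'I_r] = [seq g k | k <- enum 'I_r].
  by apply: eq_map => k; rewrite iKK.
have gsE : [seq nth 0 gs (nat_of_ord k) | k <- enum 'I_r] = gs.
  by rewrite -[RHS](mkseq_nth 0) /mkseq -val_enum_ord -map_comp.
exists Gam, par, phi; split.
  move=> u /entries_ftup[[k ->]|/entries_ftup[[k ->]|[s [v _]]]].
  - by left; exists (nth 0 cs k) => //; apply: mem_nth.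
  - by right; exists (nth 0 gs k) => //; apply: mem_nth.
  - by case: (var_nilP (fun _ _ => False) v).
rewrite predeqE => z; split=> /= [/satE[g [x [<- gE Px]]]|->].
  apply/prE; apply: PE Px; first by rewrite size_map size_enum_ord.
  move=> k; have [kr|rk] := ltnP k r; last first.
    rewrite !nth_default; [exact: (@near_refl M true 0)|exact: rk|].
    by rewrite size_map size_enum_ord.
  rewrite (nth_map (Ordinal kr)) ?size_enum_ord //.
  by have /pqE := gE (nth (Ordinal kr) (enum 'I_r) k); rewrite nth_enum_ord.
apply/satE; exists (fun k : 'I_r => nth 0 gs k), a; split=> //.
by rewrite gsE.
Qed.

End Codes.

Lemma tuple_choice (S S' : Type) (h : S -> S') (F : S' -> Type) (D : seq S)
    (R : forall s, var D s -> F (h s) -> Prop) :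
  (forall s v, exists x, R s v x) ->
  exists t : tup F (map h D), forall s v, R s v (t (h s) (var_map h v)).
Proof.
elim: D R => [|u D IHD] R Rx.
  by exists tnil => s v; case: (var_nilP (fun _ _ => False) v).
have [x0 Rx0] := Rx u VZ.
have [t tP] := IHD (fun s v => R s (VS v)) (fun s v => Rx s (VS v)).
by exists (@tcons _ F (h u) (map h D) x0 t); apply: var_consP.
Qed.

Section LGInterpretation.
Variables (M : gfield) (L : language) (Q : structure L) (kf : unit -> sort L).
Local Notation kp := (kf tt).
Variables (rK : Q kp -> M) (iK : M -> Q kp).
Hypotheses (iKK : cancel iK rK) (rKK : cancel rK iK).
Hypothesis t_zero : forall Ctx, exists w : term Ctx kp, forall a : tup Q Ctx, rK (eval a w) = 0.
Hypothesis t_one : forall Ctx, exists w : term Ctx kp, forall a : tup Q Ctx, rK (eval a w) = 1.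
Hypothesis t_opp : forall Ctx (t : term Ctx kp),
  exists w : term Ctx kp, forall a : tup Q Ctx, rK (eval a w) = - rK (eval a t).
Hypothesis t_add : forall Ctx (t u : term Ctx kp),
  exists w : term Ctx kp, forall a : tup Q Ctx, rK (eval a w) = rK (eval a t) + rK (eval a u).
Hypothesis t_mul : forall Ctx (t u : term Ctx kp),
  exists w : term Ctx kp, forall a : tup Q Ctx, rK (eval a w) = rK (eval a t) * rK (eval a u).
Hypothesis d_G : forall Ctx (t : term Ctx kp), dset (fun a : tup Q Ctx => rK (eval a t) \in gsub M).

Lemma interpret_term (G : seq unit) s (t : @term LG G s) : exists w : term (map kf G) kp,
  forall a : tup Q (map kf G), rK (eval a w) = eval (unmap rK a) t.
Proof.
elim: t => [[] v|[] ts IHt].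
- by exists (Var (var_map kf v)).
- by have [w wE] := t_zero (map kf G); exists w => a; rewrite wE.
- by have [w wE] := t_one (map kf G); exists w => a; rewrite wE.
- have [t tE] := IHt tt VZ; have [w wE] := t_opp t.
  by exists w => a; rewrite wE tE.
- have [t tE] := IHt tt VZ; have [u uE] := IHt tt (VS VZ); have [w wE] := t_add t u.
  by exists w => a; rewrite wE tE uE.
- have [t tE] := IHt tt VZ; have [u uE] := IHt tt (VS VZ); have [w wE] := t_mul t u.
  by exists w => a; rewrite wE tE uE.
Qed.

Lemma interpret_formula (G : seq unit) (phi : @formula LG G) :
  dset (fun a : tup Q (map kf G) => sat phi (unmap rK a)).
Proof.
elim: phi => {G} [G|G s t u|G [] ts|G p1 IH1 p2 IH2|G [] p1 IH1].
- by exists (FBot _).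
- have [t' tE] := interpret_term t; have [u' uE] := interpret_term u.
  exists (FEq t' u') => a /=; rewrite -tE -uE.
  by split=> [->|/(can_inj rKK)].
- have [t tE] := interpret_term (ts tt VZ).
  by apply: dset_ext (d_G t) => a; rewrite tE.
- exact: dset_imp.
- have unmapE (x : Q kp) (a : tup Q (map kf G)) :
      unmap rK (tcons x a : tup Q (map kf (tt :: G))) = @tcons _ (str M) tt G (rK x) (unmap rK a).
    by apply: tup_consP => // -[].
  have d1 := @dset_all L Q (map kf G) kp _ IH1.
  apply: dset_ext d1 => a /=; split=> H x; last by rewrite unmapE; apply: H.
  by have := H (iK x); rewrite unmapE iKK.
Qed.

End LGInterpretation.

Section EqStructure.
Variables (L : language) (M : structure L).
Local Notation Q := (eq_structure M).

Lemma eq_projE (E : defequiv M) (a b : tup M (dctx E)) :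
  eq_proj a = eq_proj b <-> sat (dfml E) (tcat a b).
Proof.
split=> [/(congr1 (@proj1_sig _ _)) /= e|ab].
  have : eqclass b b by apply: drefl.
  by rewrite -e.
apply: eq_exist => /=; rewrite predeqE => c; split=> /=.
  by apply: dtrans; apply: dsym.
exact: dtrans.
Qed.

Lemma eq_proj_surj (E : defequiv M) (z : Q (Imag E)) : exists a, z = eq_proj a.
Proof. by case: z => C [a CE]; exists a; apply: eq_exist. Qed.

(** The projection is itself a function symbol of the imaginary language, so it suffices that the
    entries of the tuple be values of terms. *)
Lemma eq_proj_dset (E : defequiv M) Ctx (f : tup Q Ctx -> tup M (dctx E)) (zv : var Ctx (Imag E)) :
  (forall s (v : var (dctx E) s), exists t : @term (eq_language M) Ctx (Home M s),
     forall a : tup Q Ctx, eval a t = f a s v) ->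
  dset (fun a : tup Q Ctx => eq_proj (f a) = a _ zv).
Proof.
move=> ft; have [t tE] := tuple_choice ft.
exists (FEq (@App (eq_language M) Ctx (EqProj E) t) (Var zv)) => a /=.
rewrite (_ : unhome _ = f a) //.
apply: tup_ext => s v.
exact: tE.
Qed.

End EqStructure.

Lemma pi_eqP (K : fieldType) (G : zmodClosed K) (x y : K) :
  (\pi_(Quotient.quot G) x = \pi_(Quotient.quot G) y)%qT <-> x - y \in G.
Proof. by rewrite Quotient.idealrBE; split=> [->|/eqP]. Qed.

(** Contexts are traded for finite types of names, never empty, so that a default name is always at
    hand. *)
Lemma ctx_index (S : Type) (D : seq S) : exists n (ix : tup (fun=> 'I_n.+1) D),
  forall T (t0 : T) (a : forall s, var D s -> T), exists x : 'I_n.+1 -> T,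
    forall s v, a s v = x (ix s v).
Proof.
elim: D => [|s D [n [ix ixP]]].
  exists 0%N, tnil => T t0 a; exists (fun=> t0) => s v.
  by case: (var_nilP (fun _ _ => False) v).
exists n.+1, (@tcons _ (fun=> 'I_n.+2) s D ord0 (fun s v => lift ord0 (ix s v))).
move=> T t0 a; have [x xP] := ixP T t0 (fun s v => a s (VS v)).
exists (fun i => if unlift ord0 i is Some j then x j else a s VZ).
by apply: var_consP => [|s' v] /=; rewrite ?unlift_none ?liftK.
Qed.

(** * Codes in the one-sorted and in the two-sorted structure *)

Section Coding.
Variables (p : nat) (ACFG : theory LG).
Hypotheses (p_prime : prime p)
  (ACFG_companion : model_companion (ACF_subgroup_theory p) ACFG).
Variables (K : closedFieldType) (G : zmodClosed K).
Hypothesis KA : models ACFG (KG G).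
Local Notation M := (Gfield G).

Lemma coded_by_home (L : language) (Q : structure L) (kf : unit -> sort L) (q s0 : sort L)
    (rK : Q (kf tt) -> M) (iK : M -> Q (kf tt)) (pq : M -> Q q) n (pr : ('I_n -> M) -> Q s0)
    (EE : relation_on ('I_n + 'I_n)) :
  cancel iK rK -> cancel rK iK ->
  (forall x y, pq x = pq y <-> x - y \in gsub M) ->
  (forall (D : seq unit) (phi : @formula LG D),
     dset (fun a : tup Q (map kf D) => sat phi (unmap rK a))) ->
  (forall Gam (xv : var Gam (kf tt)) (gv : var Gam q),
     dset (fun a : tup Q Gam => pq (rK (a _ xv)) = a q gv)) ->
  definable EE ->
  (forall Gam (xv : 'I_n -> var Gam (kf tt)) (zv : var Gam s0),
     dset (fun a : tup Q Gam => pr (fun i => rK (a _ (xv i))) = a s0 zv)) ->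
  (forall x y, EE (KG G) (spair x y) <-> pr x = pr y) ->
  forall a, exists cs gs : seq K,
    let S : set (elem Q) := [set u | exists2 c, c \in cs & u = el (iK c)] `|`
      [set u | exists2 g, g \in gs & u = el (pq g)] in
    S `<=` acl [set el (pr a)] /\ dcl S (el (pr a)).
Proof.
move=> iKK rKK pqE LGd pqd dEE prd prE a.
apply: (@codes M L Q kf q s0 rK iK pq iKK rKK pqE LGd pqd n pr EE prd prE a).
apply: (coded p_prime ACFG_companion dEE) => //; split.
- by move=> x; apply/prE.
- by move=> x y /prE xy; apply/prE.
- by move=> x y z /prE xy /prE yz; apply/prE; rewrite xy.
Qed.

(** Elements of the field are treated as classes of 1-tuples under equality, so they need no
    separate argument. *)
Lemma definable_ord0_eq : exists EE : relation_on ('I_1 + 'I_1),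
  definable EE /\ forall x y, EE (KG G) (spair x y) <-> x ord0 = y ord0 :> K.
Proof.
have [EE [dEE EEE]] := definable_teq (TVar (inl ord0 : 'I_1 + 'I_1)) (TVar (inr ord0)).
by exists EE; split=> // x y; rewrite (EEE M).
Qed.

Lemma definable_ord0_coset : exists EE : relation_on ('I_1 + 'I_1),
  definable EE /\ forall x y : 'I_1 -> K, EE (KG G) (spair x y) <-> x ord0 - y ord0 \in G.
Proof.
have [EE [dEE EEE]] := definable_tG (TAdd (TVar (inl ord0 : 'I_1 + 'I_1)) (TOpp (TVar (inr ord0)))).
by exists EE; split=> // x y; rewrite (EEE M).
Qed.

Section OneSorted.
Local Notation Q := (eq_structure (KG G)).
Local Notation EL := (eq_language (KG G)).
Local Notation kf := (@Home LG (KG G)).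

Definition one_pq (x : K) : Q (Imag (coset_equiv G)) :=
  @eq_proj _ (KG G) (coset_equiv G) (@tcons _ (KG G) tt _ x (@tnil _ (KG G))).

Lemma one_pqE (x y : K) : one_pq x = one_pq y <-> x - y \in G.
Proof. exact: eq_projE. Qed.

Lemma one_LG_dset (D : seq unit) (phi : @formula LG D) :
  dset (fun a : tup Q (map kf D) => sat phi (unmap (M := M) (id : Q (kf tt) -> K) a)).
Proof.
apply: (@interpret_formula M EL Q kf id id) => //.
- by move=> Ctx; exists (@App EL Ctx (EqFun (KG G) Zero) tnil).
- by move=> Ctx; exists (@App EL Ctx (EqFun (KG G) One) tnil).
- by move=> Ctx t; exists (@App EL Ctx (EqFun (KG G) Opp) (@tcons _ (@term EL Ctx) (kf tt) _ t tnil)).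
- by move=> Ctx t u; exists (@App EL Ctx (EqFun (KG G) Add)
    (@tcons _ (@term EL Ctx) (kf tt) _ t (@tcons _ (@term EL Ctx) (kf tt) _ u tnil))).
- by move=> Ctx t u; exists (@App EL Ctx (EqFun (KG G) Mul)
    (@tcons _ (@term EL Ctx) (kf tt) _ t (@tcons _ (@term EL Ctx) (kf tt) _ u tnil))).
- by move=> Ctx t; exists (@FRel EL Ctx tt (@tcons _ (@term EL Ctx) (kf tt) _ t tnil)).
Qed.

Lemma one_pq_dset Ctx (xv : var Ctx (kf tt)) (gv : var Ctx (Imag (coset_equiv G))) :
  dset (fun a : tup Q Ctx => one_pq (a _ xv) = a _ gv).
Proof.
apply: (@eq_proj_dset _ (KG G) (coset_equiv G) Ctx
  (fun a => @tcons _ (KG G) tt _ (a _ xv) (@tnil _ (KG G)))).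
apply: var_consP; first by exists (@Var EL Ctx (kf tt) xv).
by move=> s v; case: (var_nilP (fun _ _ => False) v).
Qed.

Lemma one_sorted_codes (e : elem Q) : exists (c : seq K) (gamma : seq (Quotient.quot G)),
  let cgamma : set (elem Q) :=
    (home_elem G @` [set` c]) `|` (@coset_elem K G @` [set` gamma]) in
  cgamma `<=` acl [set e] /\ dcl cgamma e.
Proof.
suff : exists cs gs : seq K, let S : set (elem Q) :=
    [set u | exists2 c, c \in cs & u = @el _ Q (kf tt) c] `|`
    [set u | exists2 g, g \in gs & u = @el _ Q _ (one_pq g)] in
    S `<=` acl [set e] /\ dcl S e.
  move=> [cs [gs H]]; exists cs, [seq \pi_(Quotient.quot G)%qT g | g <- gs].
  lazy zeta in H |- *; set S := (X in X `<=` _) in H; set S' := (X in X `<=` _).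
  suff SE : S' = S by split; [rewrite SE|change (dcl S' e); rewrite SE]; case: H.
  have cosetE g : @coset_elem K G (\pi_(Quotient.quot G)%qT g) = el (one_pq g).
    congr el; apply/one_pqE; apply/pi_eqP; exact: reprK.
  rewrite /S' /S; congr (_ `|` _); rewrite predeqE => u; split.
  - by move=> [c /= cc <-]; exists c.
  - by move=> [c cc ->]; exists c.
  - by move=> [g' /= /mapP[g gg ->] <-]; exists g.
  - by move=> [g gg ->]; exists (\pi_(Quotient.quot G)%qT g); rewrite //= map_f.
have main s0 n (pr : ('I_n -> M) -> Q s0) EE :=
  @coded_by_home EL Q kf _ s0 id id one_pq n pr EE (fun=> erefl) (fun=> erefl) one_pqE one_LG_dset one_pq_dset.
case: e => [[[]|E] z].
  have [EE [dEE EEE]] := definable_ord0_eq.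
  apply: (main (kf tt) 1%N (fun x => x ord0) EE dEE _ EEE (fun=> z)) => Gam xv zv.
  by exists (FEq (@Var EL Gam (kf tt) (xv ord0)) (@Var EL Gam (kf tt) zv)).
have [n [ix ixP]] := ctx_index (dctx E).
have [a0 ->] := eq_proj_surj z.
have [x0 x0P] := ixP K 0 (fun s => match s with tt => fun v => a0 tt v end).
have -> : a0 = @asg (KG G) _ _ ix x0.
  by apply: tup_ext => -[] v;
    exact: x0P tt v.
pose ix2 := tcat (fun s v => inl (ix s v) : 'I_n.+1 + 'I_n.+1) (fun s v => inr (ix s v)).
apply: (main (Imag E) n.+1 (fun x => eq_proj (@asg (KG G) _ _ ix x)) _ (definable_form (dfml E) ix2)).
  move=> Gam xv zv; apply: eq_proj_dset => -[] v.
  by exists (@Var EL Gam (kf tt) (xv (ix tt v))).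
by move=> x y; rewrite eq_projE asg_tcat !asg_comp.
Qed.

End OneSorted.

Section TwoSorted.
Local Notation MQ := (KQ G).
Local Notation Q := (eq_structure MQ).
Local Notation EL := (eq_language MQ).
Local Notation hK := (@Home L2 MQ SK : sort EL).
Local Notation hQ := (@Home L2 MQ SQ : sort EL).
Local Notation kf := (fun _ : unit => hK).
Local Notation proj := (\pi_(Quotient.quot G)%qT).

Definition two_val (s : sort2) : K -> MQ s :=
  match s return K -> MQ s with SK => id | SQ => fun x => proj x end.

Lemma two_val_surj s (z : MQ s) : exists x, z = two_val s x.
Proof. by case: s z => z; [exists z|exists (repr z); rewrite /= reprK]. Qed.

Definition two_asg V (D : seq sort2) (r : tup (fun=> V) D) (u : V -> K) : tup MQ D :=
  fun s v => two_val s (u (r s v)).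

Lemma two_asg_tcat V (D D' : seq sort2) (r : tup (fun=> V) D) (q : tup (fun=> V) D') (u : V -> K) :
  two_asg (tcat r q) u = tcat (two_asg r u) (two_asg q u).
Proof.
rewrite [LHS]tcat_surj.
rewrite -[X in tcat X _]/(two_asg (trename (@vinl _ D D') (tcat r q)) u).
rewrite -[X in tcat _ X]/(two_asg (trename (@vinr _ D D') (tcat r q)) u).
by rewrite trename_inl trename_inr.
Qed.

Lemma two_term V (D : seq sort2) (r : tup (fun=> V) D) s (t : @term L2 D s) :
  exists w : tm V, forall u : V -> K, eval (two_asg r u) t = two_val s (tev u w).
Proof.
elim: t => [s' v|[[]||||] ts IHt]; first by exists (TVar (r s' v)).
- by exists (T0 V).
- by exists (T1 V).
- by have [w wE] := IHt SK VZ; exists (TOpp w) => u; rewrite /= wE.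
- have [w wE] := IHt SK VZ; have [w' wE'] := IHt SK (VS VZ).
  by exists (TAdd w w') => u; rewrite /= wE wE'.
- have [w wE] := IHt SK VZ; have [w' wE'] := IHt SK (VS VZ).
  by exists (TMul w w') => u; rewrite /= wE wE'.
- by exists (T0 V) => u; rewrite /= raddf0.
- by have [w wE] := IHt SQ VZ; exists (TOpp w) => u; rewrite /= wE raddfN.
- have [w wE] := IHt SQ VZ; have [w' wE'] := IHt SQ (VS VZ).
  by exists (TAdd w w') => u; rewrite /= wE wE' raddfD.
- by have [w wE] := IHt SK VZ; exists w => u; rewrite /= wE.
Qed.

(** Quotient variables are replaced by representatives, and an equation between cosets by membership
    of a difference in [G]. The name [v0] only gives [None] a value before it is overwritten. *)
Lemma two_formula (D : seq sort2) (phi : @formula L2 D) V (v0 : V) (r : tup (fun=> V) D) :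
  exists P : relation_on V, definable P /\
    forall u : V -> K, P (KG G) u <-> sat phi (two_asg r u).
Proof.
elim: phi V v0 r => {D} [D|D s t t'|D []|D p1 IH1 p2 IH2|D s p1 IH1] V v0 r.
- by exists (fun _ _ => False); split=> //; apply: definable_bot.
- have [w wE] := two_term r t; have [w' wE'] := two_term r t'.
  case: s t t' wE wE' => t t' wE wE'.
    have [P [dP PE]] := definable_teq w w'.
    by exists P; split=> // u; rewrite (PE M) /= wE wE'.
  have [P [dP PE]] := definable_tG (TAdd w (TOpp w')).
  by exists P; split=> // u; rewrite (PE M) /= wE wE' /= pi_eqP.
- have [P1 [dP1 P1E]] := IH1 V v0 r; have [P2 [dP2 P2E]] := IH2 V v0 r.
  exists (fun M x => P1 M x -> P2 M x); split; first exact: definable_imp.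
  by move=> u; rewrite P1E P2E.
have [P [dP PE]] := IH1 (option V) None (@tcons _ (fun=> option V) s D None (fun s v => Some (r s v))).
pose P' := fun (M : structure LG) (x : V -> M tt) =>
  forall y, P M (upd (x \o odflt v0) None y).
exists P'; split.
  exact: (definable_rename (odflt v0) (definable_all None dP)).
have asgE u y : two_asg (@tcons _ (fun=> option V) s D None (fun s v => Some (r s v)))
    (upd (u \o odflt v0) None y) = tcons (two_val s y) (two_asg r u).
  by apply: tup_consP => [|s' v]; rewrite /two_asg /= ?updE // upd_neq.
move=> u; split=> [H x|H y].
  by have [y ->] := two_val_surj x; have := H y; rewrite PE asgE.
by rewrite PE asgE; apply: H.
Qed.

Lemma two_LG_dset (D : seq unit) (phi : @formula LG D) :
  dset (fun a : tup Q (map kf D) => sat phi (@unmap M EL Q kf (id : Q hK -> K) D a)).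
Proof.
apply: (@interpret_formula M EL Q kf id id) => //.
- by move=> Ctx; exists (@App EL Ctx (EqFun MQ (RingOp Zero)) tnil).
- by move=> Ctx; exists (@App EL Ctx (EqFun MQ (RingOp One)) tnil).
- by move=> Ctx t; exists (@App EL Ctx (EqFun MQ (RingOp Opp)) (@tcons _ (@term EL Ctx) hK _ t tnil)).
- by move=> Ctx t u; exists (@App EL Ctx (EqFun MQ (RingOp Add))
    (@tcons _ (@term EL Ctx) hK _ t (@tcons _ (@term EL Ctx) hK _ u tnil))).
- by move=> Ctx t u; exists (@App EL Ctx (EqFun MQ (RingOp Mul))
    (@tcons _ (@term EL Ctx) hK _ t (@tcons _ (@term EL Ctx) hK _ u tnil))).
- move=> Ctx t; exists (@FEq EL Ctx hQ
    (@App EL Ctx (EqFun MQ Pi) (@tcons _ (@term EL Ctx) hK _ t tnil))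
    (@App EL Ctx (EqFun MQ QZero) tnil)) => a /=.
  by rewrite -(raddf0 proj) pi_eqP subr0.
Qed.

Lemma two_pq_dset Ctx (xv : var Ctx hK) (gv : var Ctx hQ) :
  dset (fun a : tup Q Ctx => proj (a _ xv : K) = a _ gv).
Proof.
by exists (@FEq EL Ctx hQ (@App EL Ctx (EqFun MQ Pi)
  (@tcons _ (@term EL Ctx) hK _ (@Var EL Ctx hK xv) tnil)) (@Var EL Ctx hQ gv)).
Qed.

(** A class of tuples mixing both sorts becomes, through representatives, a class of tuples of [K]
    under the pulled-back relation. *)
Lemma two_sorted_codes (e : elem Q) : exists cs gs : seq K,
  let S : set (elem Q) := [set u | exists2 c, c \in cs & u = @el _ Q hK c] `|`
    [set u | exists2 g, g \in gs & u = @el _ Q hQ (proj g)] in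
  S `<=` acl [set e] /\ dcl S e.
Proof.
have main s0 n (pr : ('I_n -> M) -> Q s0) EE :=
  @coded_by_home EL Q kf hQ s0 id id (fun x => proj x) n pr EE (fun=> erefl) (fun=> erefl)
    (@pi_eqP K G) two_LG_dset two_pq_dset.
case: e => [[[]|E] z].
- have [EE [dEE EEE]] := definable_ord0_eq.
  apply: (main hK 1%N (fun x => x ord0) EE dEE _ EEE (fun=> z)) => Gam xv zv.
  by exists (FEq (@Var EL Gam hK (xv ord0)) (@Var EL Gam hK zv)).
- have [EE [dEE EEE]] := definable_ord0_coset.
  have [x ->] := two_val_surj z.
  apply: (main hQ 1%N (fun x => proj (x ord0)) EE dEE _ _ (fun=> x)).
    by move=> Gam xv zv; apply: two_pq_dset.
  by move=> x' y'; rewrite EEE pi_eqP.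
have [n [ix ixP]] := ctx_index (dctx E).
have [a0 ->] := eq_proj_surj z.
have [x0 x0P] := ixP K 0 (fun s v => projT1 (cid (two_val_surj (a0 s v)))).
have -> : a0 = two_asg ix x0.
  apply: tup_ext => s v.
  by rewrite /two_asg -x0P; case: cid.
pose ix2 := tcat (fun s v => inl (ix s v) : 'I_n.+1 + 'I_n.+1) (fun s v => inr (ix s v)).
have [EE [dEE EEE]] := two_formula (dfml E) (inl ord0) ix2.
apply: (main (Imag E) n.+1 (fun x => eq_proj (two_asg ix x)) EE dEE).
  move=> Gam xv zv; apply: eq_proj_dset => -[] v.
    by exists (@Var EL Gam hK (xv (ix SK v))).
  by exists (@App EL Gam (EqFun MQ Pi)
    (@tcons _ (@term EL Gam) hK _ (@Var EL Gam hK (xv (ix SQ v))) tnil)).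
move=> x y; rewrite EEE eq_projE.
by rewrite two_asg_tcat.
Qed.

Lemma weak_elimination_KQ : weak_elimination_of_imaginaries MQ.
Proof.
move=> e; have [cs [gs H]] := two_sorted_codes e.
lazy zeta in H; set S := (X in X `<=` _) in H.
have [bc bcE] := bvar_exists MQ SK (size cs) (nseq (size gs) SQ ++ [::]).
have [bg bgE] := bvar_exists MQ SQ (size gs) [::].
pose c : tup MQ _ := tcat (@ftup _ MQ SK (size cs) (fun k => nth 0 cs k))
  (tcat (@ftup _ MQ SQ (size gs) (fun k => proj (nth 0 gs k))) (@tnil _ MQ)).
exists (nseq (size cs) SK ++ (nseq (size gs) SQ ++ [::])), c => C.
suff CE : C = S by split; [rewrite CE|change (dcl C e); rewrite CE]; case: H.
pose home (u : elem MQ) : elem Q := @el _ Q (Home MQ (projT1 u)) (projT2 u).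
rewrite predeqE => u; split.
  move=> [s [v ->]].
  have /entries_ftup[[k cE]|/entries_ftup[[k cE]|[s' [v' _]]]] :
      entries c (el (c s v)) by exists s, v.
  - left; exists (nth 0 cs k); first exact: mem_nth.
    by have := congr1 home cE; rewrite /home.
  - right; exists (nth 0 gs k); first exact: mem_nth.
    by have := congr1 home cE; rewrite /home.
  - by case: (var_nilP (fun _ _ => False) v').
move=> [[x /(nthP 0)[k kc <-] ->]|[g /(nthP 0)[k kg <-] ->]].
  by exists SK, (bc (Ordinal kc)); rewrite /c bcE.
by exists SQ, (vinr _ (bg (Ordinal kg))); rewrite /c tcat_vinr bgE.
Qed.

End TwoSorted.

End Coding.

Theorem theorem2p15 (p : nat) (p_prime : prime p)
    (ACFG : theory LG)
    (ACFG_companion : model_companion (ACF_subgroup_theory p) ACFG)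
    (K : closedFieldType) (G : zmodClosed K)
    (KG_model : models ACFG (KG G)) (KG_saturated : saturated (KG G)) :
  (forall e : elem (eq_structure (KG G)),
     exists (c : seq K) (gamma : seq (Quotient.quot G)),
       let cgamma : set (elem (eq_structure (KG G))) :=
         (home_elem G @` [set` c]) `|` (@coset_elem K G @` [set` gamma]) in
       cgamma `<=` acl [set e] /\ dcl cgamma e)
  /\ weak_elimination_of_imaginaries (KQ G).
Proof.
split=> [e|].
  exact: (one_sorted_codes p_prime ACFG_companion KG_model e).
exact: (weak_elimination_KQ p_prime ACFG_companion KG_model).
Qed.
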